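(* Let $(M,g)$ be a connected $4$-dimensional Riemannian or Lorentzian Einstein manifold. Suppose $\bar g$ is a metric on $M$ that is projectively equivalent to $g$ but not affinely equivalent to $g$. Then $g$ has constant sectional curvature.
   Context: A pseudo-Riemannian metric is Einstein if its Ricci curvature is proportional to the metric. Riemannian means positive definite; Lorentzian means signature $(1,n-1)$ (one negative direction). Two pseudo-Riemannian metrics (of possibly different signature) on $M$ are projectively equivalent if their unparametrized geodesics coincide; they are affinely equivalent if their Levi-Civita connections coincide. *)

(* Defs.v *)
From HB Require Import structures.
From mathcomp Require Import all_boot all_order all_algebra.
From mathcomp Require Import all_classical all_reals all_analysis.
Set Implicit Arguments.
Unset Strict Implicit.
Unset Printing Implicit Defensive.
Import Order.TTheory GRing.Theory Num.Theory.
Import numFieldNormedType.Exports.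
Local Open Scope ring_scope.
Local Open Scope classical_set_scope.

(* Tangent vectors and tensors are handled classically, through their
   components in the charts of an atlas. Tangent vectors are row vectors, in the
   coordinate frame of the chart. Component functions are total functions on
   'rV[R]_n whose values are meaningful only on the (open) image of the chart. *)

Section Smoothness.
Context {R : realType}.

Definition partial n (a : 'I_n) (f : 'rV[R]_n -> R) (x : 'rV[R]_n) : R :=
  'D_(delta_mx 0 a) f x.

Fixpoint partials n (s : seq 'I_n) (f : 'rV[R]_n -> R) : 'rV[R]_n -> R :=
  if s is a :: s' then partial a (partials s' f) else f.

(* C^infinity on U, for U open. *)
Definition smooth_on n (U : set 'rV[R]_n) (f : 'rV[R]_n -> R) : Prop :=
  forall (s : seq 'I_n) (x : 'rV[R]_n), U x ->
    {for x, continuous (partials s f)} /\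
    forall a : 'I_n, derivable (partials s f) x (delta_mx 0 a).

(* C^infinity on J, for J open; continuity of the derivatives is automatic. *)
Definition smooth_on_line (J : set R) (f : R -> R) : Prop :=
  forall (k : nat) (t : R), J t -> derivable (derive1n k f) t 1.

End Smoothness.

Record manifold (R : realType) (n : nat) := Manifold {
  carrier :> topologicalType;
  manifold_hausdorff : hausdorff_space carrier;
  manifold_second_countable : @second_countable carrier;
  atlas : Type;
  dom : atlas -> set carrier;
  chart : atlas -> carrier -> 'rV[R]_n;
  chart_inv : atlas -> 'rV[R]_n -> carrier;
  dom_open : forall i, open (dom i);
  dom_cover : forall p : carrier, exists i, dom i p;
  chart_image_open : forall i, open (chart i @` dom i);
  chartK : forall i p, dom i p -> chart_inv i (chart i p) = p;
  chart_continuous : forall i, {within dom i, continuous (chart i)};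
  chart_inv_continuous :
    forall i, {within chart i @` dom i, continuous (chart_inv i)};
  transition_smooth : forall i j (k : 'I_n),
    smooth_on (chart i @` (dom i `&` dom j))
      (fun x => chart j (chart_inv i x) 0 k)
}.

Section Metrics.
Context {R : realType} {n : nat}.

Definition chart_image (M : manifold R n) (i : atlas M) : set 'rV[R]_n :=
  chart i @` dom i.

(* Row a is the derivative of the coordinates of chart j along the a-th
   coordinate vector of chart i. *)
Definition transition_jacobian (M : manifold R n) (i j : atlas M)
    (x : 'rV[R]_n) : 'M[R]_n :=
  \matrix_(a, b) partial a (fun y => chart j (chart_inv i y) 0 b) x.

(* Pseudo-Riemannian metrics, of arbitrary signature. *)
Record metric (M : manifold R n) := Metric {
  comps :> atlas M -> 'rV[R]_n -> 'M[R]_n;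
  metric_smooth : forall i (a b : 'I_n),
    smooth_on (chart_image i) (fun x => comps i x a b);
  metric_sym : forall i x, chart_image i x -> (comps i x)^T = comps i x;
  metric_nondegenerate : forall i x, chart_image i x -> comps i x \in unitmx;
  metric_transition : forall i j p, dom i p -> dom j p ->
    comps i (chart i p) =
      transition_jacobian i j (chart i p) *m comps j (chart j p)
        *m (transition_jacobian i j (chart i p))^T
}.

Definition inner (A : 'M[R]_n) (u v : 'rV[R]_n) : R := (u *m A *m v^T) 0 0.

Definition riemannian (M : manifold R n) (g : metric M) : Prop :=
  forall i x, chart_image i x ->
    forall u : 'rV[R]_n, u != 0 -> 0 < inner (g i x) u u.

(* Signature (1, n - 1): the rows of P form an orthonormal frame in which
   exactly one vector, the first one, is negative. *)
Definition lorentzian (M : manifold R n) (g : metric M) : Prop :=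
  forall i x, chart_image i x ->
    exists2 P : 'M[R]_n, P \in unitmx &
      P *m g i x *m P^T =
        diag_mx (\row_(k < n) if k == 0%N :> nat then -1 else 1).

End Metrics.

Section Curvature.
Context {R : realType} {n : nat}.
Variable G : 'rV[R]_n -> 'M[R]_n.

(* christoffel k a b = Gamma^k_{ab} *)
Definition christoffel (k a b : 'I_n) (x : 'rV[R]_n) : R :=
  2^-1 * \sum_(l < n) invmx (G x) k l *
    (partial a (fun y => G y b l) x + partial b (fun y => G y a l) x
      - partial l (fun y => G y a b) x).

(* riemann l c a b = R^l_{cab}, with
   R(X, Y)Z = nabla_X nabla_Y Z - nabla_Y nabla_X Z - nabla_[X, Y] Z and
   R(e_a, e_b) e_c = sum_l R^l_{cab} e_l. *)
Definition riemann (l c a b : 'I_n) (x : 'rV[R]_n) : R :=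
  partial a (christoffel l b c) x - partial b (christoffel l a c) x
  + \sum_(m < n) (christoffel l a m x * christoffel m b c x
                  - christoffel l b m x * christoffel m a c x).

(* Ric(Y, Z) = tr (X |-> R(X, Y)Z) *)
Definition ricci (x : 'rV[R]_n) : 'M[R]_n :=
  \matrix_(b, c) \sum_(a < n) riemann a c a b x.

Definition curvature (x u v w : 'rV[R]_n) : 'rV[R]_n :=
  \row_l \sum_(a < n) \sum_(b < n) \sum_(c < n)
    riemann l c a b x * u 0 a * v 0 b * w 0 c.

Definition gram (x u v : 'rV[R]_n) : R :=
  inner (G x) u u * inner (G x) v v - inner (G x) u v ^+ 2.

Definition sectional (x u v : 'rV[R]_n) : R :=
  inner (G x) (curvature x u v v) u / gram x u v.

End Curvature.

Section Geometry.
Context {R : realType} {n : nat} {M : manifold R n}.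

Definition einstein (g : metric M) : Prop :=
  exists lambda : M -> R, forall i p, dom i p ->
    ricci (g i) (chart i p) = lambda p *: g i (chart i p).

(* gram != 0 says that u and v span a plane on which g is nondegenerate. *)
Definition constant_sectional_curvature (g : metric M) : Prop :=
  exists kappa : R, forall i x, chart_image i x ->
    forall u v : 'rV[R]_n, gram (g i) x u v != 0 ->
      sectional (g i) x u v = kappa.

Definition coord (i : atlas M) (c : R -> M) (k : 'I_n) : R -> R :=
  fun t => chart i (c t) 0 k.

Definition smooth_curve (J : set R) (c : R -> M) : Prop :=
  (forall t, J t -> {for t, continuous c}) /\
  forall (i : atlas M) (k : 'I_n),
    smooth_on_line (J `&` c @^-1` dom i) (coord i c k).

(* Affinely parametrized geodesics on an open interval J; constant curves are
   excluded by the nonvanishing of the velocity. *)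
Definition geodesic (g : metric M) (J : set R) (c : R -> M) : Prop :=
  smooth_curve J c /\
  forall t i, J t -> dom i (c t) ->
    (exists k : 'I_n, derive1 (coord i c k) t != 0) /\
    forall k : 'I_n,
      derive1n 2 (coord i c k) t
      + \sum_(a < n) \sum_(b < n) christoffel (g i) k a b (chart i (c t))
          * derive1 (coord i c a) t * derive1 (coord i c b) t = 0.

(* c, on the open interval J, is a reparametrization of a geodesic. *)
Definition unparametrized_geodesic (g : metric M) (J : set R) (c : R -> M) :
    Prop :=
  exists (I : set R) (c0 : R -> M) (theta : R -> R),
    [/\ open I /\ is_interval I, geodesic g I c0,
        smooth_on_line J theta /\ (forall t, J t -> derive1 theta t != 0),
        theta @` J = I & forall t, J t -> c t = c0 (theta t)].

Definition projectively_equivalent (g h : metric M) : Prop :=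
  forall (J : set R) (c : R -> M), open J -> is_interval J ->
    unparametrized_geodesic g J c <-> unparametrized_geodesic h J c.

(* The Levi-Civita connections coincide. *)
Definition affinely_equivalent (g h : metric M) : Prop :=
  forall i x, chart_image i x -> forall k a b : 'I_n,
    christoffel (g i) k a b x = christoffel (h i) k a b x.

End Geometry.

(* Main.v *)
Require Import Defs.
From HB Require Import structures.
From mathcomp Require Import all_boot all_order all_algebra.
From mathcomp Require Import all_classical all_reals all_analysis.
From mathcomp Require Import ring lra.
Set Implicit Arguments.
Unset Strict Implicit.
Unset Printing Implicit Defensive.
Import Order.TTheory GRing.Theory Num.Theory.
Import numFieldNormedType.Exports.
(* restores the meaning of coord and metric_sym, which have homonyms *)
Import Defs.
Local Open Scope ring_scope.

(** Projectively equivalent metrics g and gbar have the same geodesics up to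
    parametrization. Comparing accelerations along the geodesic through a point
    with an arbitrary velocity shows that the difference of the Christoffel
    symbols sends every v to a multiple of v, hence has the form
    phi_i delta^m_p + phi_p delta^m_i ([christoffel_projective]); this uses that
    geodesics exist ([geodesic_exists]). With f a suitable power of
    det gbar / det g, so that df = 2 phi f, the tensor a = f g gbar^-1 g then
    satisfies the linear equation of Sinjukov,
    nabla_p a_ij = lam_i g_pj + lam_j g_pi, where lam vanishes exactly where the
    two connections agree ([sinjukov_exists]).

    The curvature computations are carried out over a commutative ring with
    commuting derivations, instantiated by the ring of smooth functions on an
    open subset of a chart. On an Einstein space of dimension four with
    Ric = 3 K g, the integrability conditions of this equation give
    R(X, Y) lam = K (lam(Y) X - lam(X) Y) ([rlamE]) and express the second covariant
    derivative of lam through K and lam ([TlamE]). Two facts follow. First, lam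
    and nabla lam solve a closed linear system, so that lam vanishes on a ball as
    soon as it vanishes near one of its points ([gradient_unique_continuation]).
    Secondly, lam contracts the Weyl tensor W to zero ([weyl_grad]).

    At a point where lam is not null, the latter forces W = 0: W lives on the
    three-dimensional orthogonal complement of lam, where a trace-free curvature
    tensor vanishes ([weyl_eq0_of_nonnull]). Suppose then that lam is null,
    without zeros, and W without zeros, on some open set; this already excludes
    the Riemannian signature. The derivatives of lam.lam = 0 and the integrability
    conditions give nabla lam = 0, whence K = 0 ([Lam_eq0], [einstein_scalar0]). Now a commutes with W, which is
    of Petrov type N in Lorentzian signature, so the trace-free part of a is a
    multiple of lam (x) lam ([null_commutant_rank1]); differentiating this
    through the Sinjukov equation gives lam (x) lam = 0
    ([parallel_null_lam]), a contradiction.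

    Globally, the points near which the connections agree form an open and closed
    set by unique continuation; it is empty since the metrics are not affinely
    equivalent ([open_same_empty]). So the points with lam <> 0 are dense, W
    vanishes everywhere by continuity ([weyl_zero]), and the Einstein scalar is
    constant by Schur's lemma ([schur_einstein], [lambda_constant]). *)

(** * Commuting derivations and covariant derivatives *)

(** The partial derivatives of a chart, abstractly: the tensor calculus below only
    uses these rules, and a ring makes its identities provable by [ring]. *)
Record commuting_derivations (A : comNzRingType) (n : nat)
    (D : 'I_n -> A -> A) : Prop := CommutingDerivations {
  derivD : forall p x y, D p (x + y) = D p x + D p y;
  derivM : forall p x y, D p (x * y) = D p x * y + x * D p y;
  derivC : forall p q x, D p (D q x) = D q (D p x)
}.

(** [Gam p i m] is the Christoffel symbol Gamma^m_{pi}; metric compatibility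
    is stated as the formula for the derivatives of the components of [g]. *)
Record levi_civita (A : comNzRingType) (n : nat) (D : 'I_n -> A -> A)
    (g gi : 'I_n -> 'I_n -> A) (Gam : 'I_n -> 'I_n -> 'I_n -> A) : Prop :=
  LeviCivita {
  lc_gC : forall i j, g i j = g j i;
  lc_giC : forall i j, gi i j = gi j i;
  lc_inv : forall i j, \sum_m gi i m * g m j = (i == j)%:R;
  lc_torsion : forall p i m, Gam p i m = Gam i p m;
  lc_compat : forall p i j,
    D p (g i j) = \sum_m Gam p i m * g m j + \sum_m Gam p j m * g i m
}.

Section Calculus.
Context (A : comNzRingType) (n : nat) (D : 'I_n -> A -> A).
Hypothesis HD : commuting_derivations D.

Lemma deriv0 p : D p 0 = 0.
Proof. by apply: (addrI (D p 0)); rewrite -(derivD HD) !addr0. Qed.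

Lemma derivN p x : D p (- x) = - D p x.
Proof. by apply: (addrI (D p x)); rewrite -(derivD HD) !subrr deriv0. Qed.

Lemma deriv1 p : D p 1 = 0.
Proof.
have h := derivM HD p 1 1; move: h; rewrite !mul1r mulr1 => h.
by apply: (addrI (D p 1)); rewrite -h addr0.
Qed.

Lemma deriv_nat p k : D p k%:R = 0.
Proof.
elim: k => [|k IH]; first exact: deriv0.
by rewrite -natr1 (derivD HD) IH deriv1 addr0.
Qed.

Lemma deriv_sum p (I : finType) (P : pred I) (F : I -> A) :
  D p (\sum_(i | P i) F i) = \sum_(i | P i) D p (F i).
Proof. by apply: (big_morph (D p)); [move=> x y; exact: (derivD HD)|exact: deriv0]. Qed.

Definition Dm p k l (M : 'M[A]_(k, l)) := map_mx (D p) M.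

Lemma DmD p k l (M N : 'M[A]_(k, l)) : Dm p (M + N) = Dm p M + Dm p N.
Proof. by apply/matrixP => i j; rewrite !mxE (derivD HD). Qed.

Lemma DmN p k l (M : 'M[A]_(k, l)) : Dm p (- M) = - Dm p M.
Proof. by apply/matrixP => i j; rewrite !mxE derivN. Qed.

Lemma DmM p k l m (M : 'M[A]_(k, l)) (N : 'M[A]_(l, m)) :
  Dm p (M *m N) = Dm p M *m N + M *m Dm p N.
Proof.
apply/matrixP => i j; rewrite !mxE deriv_sum -big_split /=.
by apply: eq_bigr => s _; rewrite (derivM HD) !mxE.
Qed.

Lemma DmC p q k l (M : 'M[A]_(k, l)) : Dm p (Dm q M) = Dm q (Dm p M).
Proof. by apply/matrixP => i j; rewrite !mxE (derivC HD). Qed.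

Lemma Dm_tr p k l (M : 'M[A]_(k, l)) : Dm p M^T = (Dm p M)^T.
Proof. by apply/matrixP => i j; rewrite !mxE. Qed.

Lemma Dm_scalar p (a : A) : Dm p (a%:M : 'M[A]_n) = (D p a)%:M.
Proof.
apply/matrixP => i j; rewrite !mxE.
by case: (i == j); rewrite ?mulr1n ?mulr0n // deriv0.
Qed.

Lemma Dm_inv p (G Gi : 'M[A]_n) :
  Gi *m G = 1%:M -> Dm p Gi = - (Gi *m Dm p G *m Gi).
Proof.
move=> h; have h' := mulmx1C h.
have : Dm p (Gi *m G) *m Gi = 0 by rewrite h Dm_scalar deriv1 raddf0 mul0mx.
rewrite DmM mulmxDl -mulmxA h' mulmx1 => e.
by apply/eqP; rewrite -addr_eq0 e.
Qed.

End Calculus.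

Lemma trmxD (A : comNzRingType) k l (M N : 'M[A]_(k, l)) :
  (M + N)^T = M^T + N^T.
Proof. by apply/matrixP => i j; rewrite !mxE. Qed.

Lemma trmxN (A : comNzRingType) k l (M : 'M[A]_(k, l)) : (- M)^T = - M^T.
Proof. by apply/matrixP => i j; rewrite !mxE. Qed.

Lemma mxDE (A : comNzRingType) k l (M N : 'M[A]_(k, l)) i j :
  (M + N) i j = M i j + N i j.
Proof. by rewrite mxE. Qed.

Lemma mxNE (A : comNzRingType) k l (M : 'M[A]_(k, l)) i j :
  (- M) i j = - M i j.
Proof. by rewrite mxE. Qed.

Lemma mx0E (A : comNzRingType) k l i j : (0 : 'M[A]_(k, l)) i j = 0.
Proof. by rewrite mxE. Qed.

Ltac mx_ring :=
  rewrite ?(mulmxDl, mulmxDr, mulNmx, mulmxN, mulmxA);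
  let i := fresh in let j := fresh in
  apply/matrixP => i j; rewrite ?(mxDE, mxNE, mx0E);
  repeat match goal with
  | |- context [fun_of_matrix ?M i j] =>
      let x := fresh in move: (fun_of_matrix M i j) => x
  end; ring.

Section Connection.
Context (A : comNzRingType) (n : nat) (D : 'I_n -> A -> A).
Hypothesis HD : commuting_derivations D.
Context (Gam : 'I_n -> 'I_n -> 'I_n -> A).

Definition mx2 (B : 'I_n -> 'I_n -> A) : 'M[A]_n := \matrix_(i, j) B i j.
Definition cv1 (X : 'I_n -> A) : 'cV[A]_n := \col_i X i.

(** Covariant derivatives of covariant tensors of rank one to four. The index of
    the derivative comes first, and rank [k + 1] is obtained from rank [k] by
    treating the first slot separately, so that contractions over the other slots
    are not disturbed. *)
Definition nabla1 p (X : 'I_n -> A) i := D p (X i) - \sum_m Gam p i m * X m.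
Definition nabla2 p (B : 'I_n -> 'I_n -> A) i j :=
  nabla1 p (B i) j - \sum_m Gam p i m * B m j.
Definition nabla3 p (S : 'I_n -> 'I_n -> 'I_n -> A) c i j :=
  nabla2 p (S c) i j - \sum_m Gam p c m * S m i j.
Definition nabla4 p (F : 'I_n -> 'I_n -> 'I_n -> 'I_n -> A) d c i j :=
  nabla3 p (F d) c i j - \sum_m Gam p d m * F m c i j.

(** [riem d c i l] is R^l_{idc}, the [l]-th component of R(e_d, e_c) e_i. *)
Definition riem d c i l :=
  D d (Gam c i l) - D c (Gam d i l)
  + \sum_m (Gam d m l * Gam c i m - Gam c m l * Gam d i m).

Local Notation Gm p := (mx2 (Gam p)).
Local Notation Rm d c := (mx2 (riem d c)).

(** In matrix form the curvature is, up to sign, the commutator of D_d - Gam_d and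
    D_c - Gam_c, which makes the Ricci and Bianchi identities formal
    consequences of noncommutative algebra. *)
Lemma riem_mx d c :
  Rm d c = Dm D d (Gm c) - Dm D c (Gm d) + Gm c *m Gm d - Gm d *m Gm c.
Proof.
apply/matrixP => i l; rewrite !mxE /riem sumrB addrA.
by congr (_ + _ - _); apply: eq_bigr => m _; rewrite !mxE mulrC.
Qed.

Lemma cov2_mx p B :
  mx2 (nabla2 p B) = Dm D p (mx2 B) - Gm p *m mx2 B - mx2 B *m (Gm p)^T.
Proof.
apply/matrixP => i j; rewrite !mxE /nabla2 /nabla1 addrAC.
by congr (_ - _ - _); apply: eq_bigr => m _; rewrite !mxE // mulrC.
Qed.

Lemma cov1_mx p X : cv1 (nabla1 p X) = Dm D p (cv1 X) - Gm p *m cv1 X.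
Proof.
apply/matrixP => i j; rewrite !mxE /nabla1.
by congr (_ - _); apply: eq_bigr => m _; rewrite !mxE.
Qed.

Lemma riem_skew d c i l : riem c d i l = - riem d c i l.
Proof.
rewrite /riem opprD opprB; congr (_ + _).
by rewrite -sumrN; apply: eq_bigr => m _; rewrite opprB.
Qed.

Hypothesis torsion : forall p i m, Gam p i m = Gam i p m.

Lemma bianchi1 d c i l : riem d c i l + riem c i d l + riem i d c l = 0.
Proof.
rewrite /riem (torsion d i l) (torsion c i l) (torsion c d l).
have -> : \sum_m (Gam d m l * Gam c i m - Gam c m l * Gam d i m)
  = \sum_m (Gam d m l * Gam c i m) - \sum_m (Gam c m l * Gam d i m) by rewrite sumrB.
have -> : \sum_m (Gam c m l * Gam i d m - Gam i m l * Gam c d m)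
  = \sum_m (Gam c m l * Gam d i m) - \sum_m (Gam i m l * Gam c d m).
  by rewrite -sumrB; apply: eq_bigr => m _; rewrite (torsion i d).
have -> : \sum_m (Gam i m l * Gam d c m - Gam d m l * Gam i c m)
  = \sum_m (Gam i m l * Gam c d m) - \sum_m (Gam d m l * Gam c i m).
  by rewrite -sumrB; apply: eq_bigr => m _; rewrite (torsion i c) (torsion d c).
ring.
Qed.

Lemma ricci_identity1 (X : 'I_n -> A) d c i :
  nabla2 d (fun c => nabla1 c X) c i - nabla2 c (fun c => nabla1 c X) d i
  = - \sum_l riem d c i l * X l.
Proof.
rewrite /nabla2 (eq_bigr (fun m => Gam c d m * nabla1 m X i)); last first.
  by move=> m _; rewrite torsion.
rewrite opprB addrA subrK.
have E : cv1 (nabla1 d (fun i => nabla1 c X i)) - cv1 (nabla1 c (fun i => nabla1 d X i))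
  = - (Rm d c *m cv1 X).
  rewrite !cov1_mx riem_mx !(DmD HD, DmN HD, DmM HD) (DmC HD d c); mx_ring.
move/matrixP: E => /(_ i 0); rewrite !mxE => ->.
by congr (- _); apply: eq_bigr => l _; rewrite !mxE.
Qed.

Lemma ricci_identity2 (B : 'I_n -> 'I_n -> A) d c i j :
  nabla3 d (fun c => nabla2 c B) c i j - nabla3 c (fun c => nabla2 c B) d i j
  = - (\sum_l riem d c i l * B l j + \sum_l riem d c j l * B i l).
Proof.
rewrite /nabla3 (eq_bigr (fun m => Gam c d m * nabla2 m B i j)); last first.
  by move=> m _; rewrite torsion.
rewrite opprB addrA subrK.
have E : mx2 (nabla2 d (fun i j => nabla2 c B i j)) - mx2 (nabla2 c (fun i j => nabla2 d B i j))
  = - (Rm d c *m mx2 B + mx2 B *m (Rm d c)^T).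
  rewrite !cov2_mx riem_mx !(trmxD, trmxN, trmx_mul).
  rewrite !(DmD HD, DmN HD, DmM HD) (DmC HD d c) !Dm_tr.
  mx_ring.
move/matrixP: E => /(_ i j); rewrite !mxE => ->.
by congr (- (_ + _)); apply: eq_bigr => l _; rewrite !mxE // mulrC.
Qed.

(** The Jacobi identity for the operators D_p - Gam_p. *)
Lemma bianchi2_mx p d c :
  let N p d c := Dm D p (Rm d c) - Gm p *m Rm d c + Rm d c *m Gm p in
  N p d c + N d c p + N c p d = 0.
Proof.
rewrite /= !riem_mx !(DmD HD, DmN HD, DmM HD).
rewrite (DmC HD d p) (DmC HD c p) (DmC HD c d); mx_ring.
Qed.

End Connection.

(** * Metric contractions and the symmetries of the curvature tensor *)

Section Trace.
Context (A : comNzRingType) (n : nat) (gi : 'I_n -> 'I_n -> A).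

(** The trace of a covariant tensor of rank two for the metric with inverse [gi]. *)
Definition gtr (B : 'I_n -> 'I_n -> A) := \sum_k \sum_l gi k l * B k l.
Definition ip (X Y : 'I_n -> A) := gtr (fun k l => X k * Y l).

Lemma eq_gtr B C : (forall k l, B k l = C k l) -> gtr B = gtr C.
Proof. by move=> h; apply: eq_bigr => k _; apply: eq_bigr => l _; rewrite h. Qed.

Lemma gtrD B C : gtr (fun k l => B k l + C k l) = gtr B + gtr C.
Proof.
rewrite /gtr -big_split; apply: eq_bigr => k _ /=.
by rewrite -big_split; apply: eq_bigr => l _; rewrite mulrDr.
Qed.

Lemma gtrZ a B : gtr (fun k l => a * B k l) = a * gtr B.
Proof.
rewrite /gtr mulr_sumr; apply: eq_bigr => k _.
by rewrite mulr_sumr; apply: eq_bigr => l _; rewrite mulrCA.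
Qed.

Lemma gtrN B : gtr (fun k l => - B k l) = - gtr B.
Proof. by rewrite -mulN1r -gtrZ; apply: eq_gtr => k l; rewrite mulN1r. Qed.

Lemma gtrB B C : gtr (fun k l => B k l - C k l) = gtr B - gtr C.
Proof. by rewrite gtrD gtrN. Qed.

Lemma gtr0 : gtr (fun _ _ => 0) = 0.
Proof. by rewrite /gtr big1 // => k _; rewrite big1 // => l _; rewrite mulr0. Qed.

Lemma gtr_sum (I : finType) (F : I -> 'I_n -> 'I_n -> A) :
  gtr (fun k l => \sum_m F m k l) = \sum_m gtr (F m).
Proof.
rewrite /gtr [RHS]exchange_big; apply: eq_bigr => k _ /=.
by rewrite [RHS]exchange_big; apply: eq_bigr => l _ /=; rewrite mulr_sumr.
Qed.

Lemma ipDl X X' Y : ip (fun k => X k + X' k) Y = ip X Y + ip X' Y.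
Proof. by rewrite /ip -gtrD; apply: eq_gtr => k l; rewrite mulrDl. Qed.
Lemma ipDr X Y Y' : ip X (fun k => Y k + Y' k) = ip X Y + ip X Y'.
Proof. by rewrite /ip -gtrD; apply: eq_gtr => k l; rewrite mulrDr. Qed.
Lemma ipZl a X Y : ip (fun k => a * X k) Y = a * ip X Y.
Proof. by rewrite /ip -gtrZ; apply: eq_gtr => k l; rewrite mulrA. Qed.
Lemma ipZr a X Y : ip X (fun k => a * Y k) = a * ip X Y.
Proof. by rewrite /ip -gtrZ; apply: eq_gtr => k l; rewrite mulrCA. Qed.
Lemma ipNl X Y : ip (fun k => - X k) Y = - ip X Y.
Proof. by rewrite /ip -gtrN; apply: eq_gtr => k l; rewrite mulNr. Qed.
Lemma ipNr X Y : ip X (fun k => - Y k) = - ip X Y.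
Proof. by rewrite /ip -gtrN; apply: eq_gtr => k l; rewrite mulrN. Qed.
Lemma ipBl X X' Y : ip (fun k => X k - X' k) Y = ip X Y - ip X' Y.
Proof. by rewrite ipDl ipNl. Qed.
Lemma ipBr X Y Y' : ip X (fun k => Y k - Y' k) = ip X Y - ip X Y'.
Proof. by rewrite ipDr ipNr. Qed.
Lemma ip_suml (I : finType) (F : I -> 'I_n -> A) Y :
  ip (fun k => \sum_m F m k) Y = \sum_m ip (F m) Y.
Proof. by rewrite /ip -gtr_sum; apply: eq_gtr => k l; rewrite mulr_suml. Qed.
Lemma eq_ip X Y X' Y' : (forall k, X k = X' k) -> (forall k, Y k = Y' k) ->
  ip X Y = ip X' Y'.
Proof. by move=> h h'; apply: eq_gtr => k l; rewrite h h'. Qed.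
Lemma ip0l Y : ip (fun=> 0) Y = 0.
Proof. by rewrite -[RHS]gtr0; apply: eq_gtr => k l; rewrite mul0r. Qed.

Lemma gtr_ipr (X : 'I_n -> 'I_n -> 'I_n -> A) Y :
  gtr (fun k l => ip (X k l) Y) = ip (fun m => gtr (fun k l => X k l m)) Y.
Proof.
transitivity (gtr (fun k l => \sum_s \sum_t (gi s t * Y t) * X k l s)).
  apply: eq_gtr => k l; apply: eq_bigr => s _; apply: eq_bigr => t _; ring.
rewrite gtr_sum; apply: eq_bigr => s _.
rewrite gtr_sum; apply: eq_bigr => t _.
by rewrite gtrZ; ring.
Qed.

Hypothesis giC : forall i j, gi i j = gi j i.

Lemma gtr_sym B : gtr (fun k l => B l k) = gtr B.
Proof.
rewrite /gtr exchange_big; apply: eq_bigr => k _.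
by apply: eq_bigr => l _; rewrite giC.
Qed.

Lemma ipC X Y : ip X Y = ip Y X.
Proof. by rewrite /ip -gtr_sym; apply: eq_gtr => k l; rewrite mulrC. Qed.

End Trace.

Section MetricConnection.
Context (A : comNzRingType) (n : nat) (D : 'I_n -> A -> A).
Hypothesis HD : commuting_derivations D.
Context (g gi : 'I_n -> 'I_n -> A) (Gam : 'I_n -> 'I_n -> 'I_n -> A).
Hypothesis HG : levi_civita D g gi Gam.

Local Notation tr := (gtr gi).
Local Notation "<< X , Y >>" := (ip gi X Y).
Local Notation cov1 := (nabla1 D Gam).
Local Notation cov2 := (nabla2 D Gam).
Local Notation cov3 := (nabla3 D Gam).
Local Notation cov4 := (nabla4 D Gam).
Local Notation riem := (riem D Gam).
Local Notation gC := (lc_gC HG).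
Local Notation giC := (lc_giC HG).
Local Notation torsion := (lc_torsion HG).

Lemma sum_delta (F : 'I_n -> A) i : \sum_k (i == k)%:R * F k = F i.
Proof.
rewrite (bigD1 i) //= eqxx mul1r big1 ?addr0 // => k /negPf.
by rewrite eq_sym => ->; rewrite mul0r.
Qed.

Lemma ip_g i X : << g i, X >> = X i.
Proof.
rewrite /ip /gtr exchange_big /= -[RHS](sum_delta X i); apply: eq_bigr => l _.
rewrite eq_sym -(lc_inv HG) mulr_suml; apply: eq_bigr => k _.
by rewrite gC giC mulrA.
Qed.

Lemma ip_gr i X : << X, g i >> = X i.
Proof. by rewrite (ipC giC) ip_g. Qed.

Lemma gtr_gr i B : tr (fun k l => g i k * B l) = B i.
Proof. exact: ip_g. Qed.

Lemma gtr_g : tr g = n%:R.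
Proof.
rewrite /gtr (eq_bigr (fun=> 1)) ?sumr_const ?card_ord // => k _.
transitivity ((k == k)%:R : A); last by rewrite eqxx.
by rewrite -(lc_inv HG); apply: eq_bigr => l _; rewrite gC.
Qed.

Local Notation Gi := (mx2 gi).
Local Notation G := (mx2 g).

Lemma GiG : Gi *m G = 1%:M.
Proof.
apply/matrixP => i j; rewrite !mxE -(lc_inv HG).
by apply: eq_bigr => m _; rewrite !mxE.
Qed.

Lemma DG p : Dm D p G = mx2 (Gam p) *m G + G *m (mx2 (Gam p))^T.
Proof.
apply/matrixP => i j; rewrite !mxE (lc_compat HG).
by congr (_ + _); apply: eq_bigr => m _; rewrite !mxE // mulrC.
Qed.

Lemma deriv_gi p k l : D p (gi k l)
  = - \sum_m gi k m * Gam p m l - \sum_m Gam p m k * gi m l.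
Proof.
have E : Dm D p Gi = - (Gi *m mx2 (Gam p)) - (mx2 (Gam p))^T *m Gi.
  rewrite (Dm_inv HD p GiG) DG mulmxDr mulmxDl !mulmxA GiG mul1mx.
  by rewrite -(mulmxA _ G) (mulmx1C GiG) mulmx1 opprD.
move/matrixP: E => /(_ k l); rewrite !mxE => ->.
by congr (- _ - _); apply: eq_bigr => m _; rewrite !mxE.
Qed.

Lemma deriv_gtr p B : D p (tr B) = tr (cov2 p B).
Proof.
have E1 : \sum_k \sum_l (\sum_m gi k m * Gam p m l) * B k l
    = tr (fun k l => \sum_m Gam p l m * B k m).
  apply: eq_bigr => k _; under eq_bigr do rewrite mulr_suml.
  under [RHS]eq_bigr do rewrite mulr_sumr.
  by rewrite exchange_big; do 2 apply: eq_bigr => ? _; rewrite mulrA.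
have E2 : \sum_k \sum_l (\sum_m Gam p m k * gi m l) * B k l
    = tr (fun k l => \sum_m Gam p k m * B m l).
  rewrite exchange_big [RHS]exchange_big; apply: eq_bigr => l _ /=.
  under eq_bigr do rewrite mulr_suml.
  under [RHS]eq_bigr do rewrite mulr_sumr.
  rewrite exchange_big; do 2 apply: eq_bigr => ? _; ring.
rewrite /cov2 /cov1 !gtrB -E1 -E2 /gtr (deriv_sum HD) -!sumrB.
apply: eq_bigr => k _; rewrite (deriv_sum HD) -!sumrB.
apply: eq_bigr => l _; rewrite (derivM HD) deriv_gi; ring.
Qed.

Lemma cov2_tensor p (u v : 'I_n -> A) i j :
  cov2 p (fun i j => u i * v j) i j = cov1 p u i * v j + u i * cov1 p v j.
Proof.
rewrite /cov2 /cov1 (derivM HD) mulrBl mulrBr mulr_suml mulr_sumr.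
have -> : \sum_m Gam p j m * (u i * v m) = \sum_m u i * (Gam p j m * v m).
  by apply: eq_bigr => m _; rewrite mulrCA.
have -> : \sum_m Gam p i m * (u m * v j) = \sum_m Gam p i m * u m * v j.
  by apply: eq_bigr => m _; rewrite mulrA.
ring.
Qed.

Lemma deriv_ip p X Y : D p << X, Y >> = << cov1 p X, Y >> + << X, cov1 p Y >>.
Proof.
by rewrite /ip deriv_gtr -gtrD; apply: eq_gtr => k l; rewrite cov2_tensor.
Qed.

Lemma cov2_g p i j : cov2 p g i j = 0.
Proof.
rewrite /cov2 /cov1 (lc_compat HG).
by rewrite addrK subrr.
Qed.

Definition Rl d c i j := \sum_l riem d c i l * g l j.

Lemma ip_Rl d c i X : << Rl d c i, X >> = \sum_l riem d c i l * X l.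
Proof.
rewrite ip_suml; apply: eq_bigr => l _.
by rewrite -(ip_g l X) -ipZl.
Qed.

Lemma Rl_skew12 d c i j : Rl c d i j = - Rl d c i j.
Proof. by rewrite /Rl -sumrN; apply: eq_bigr => l _; rewrite riem_skew mulNr. Qed.

(** The Ricci identity for [g] itself, which is parallel. *)
Lemma Rl_skew34 d c i j : Rl d c j i = - Rl d c i j.
Proof.
have z : (fun c => cov2 c g) = fun _ _ _ => 0.
  by apply/funext => p; apply/funext => s; apply/funext => t; rewrite cov2_g.
have z3 p c' s t : cov3 p (fun _ _ _ => 0) c' s t = 0.
  rewrite /nabla3 /nabla2 /nabla1 (deriv0 HD) !big1 ?subrr // => *; exact: mulr0.
have := ricci_identity2 HD torsion g d c i j.
rewrite z !z3 subrr => /esym/eqP; rewrite oppr_eq0 addrC addr_eq0 => /eqP h.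
rewrite /Rl -h; apply: eq_bigr => l _; by rewrite (gC l i).
Qed.

Lemma Rl_bianchi1 d c i j : Rl d c i j + Rl c i d j + Rl i d c j = 0.
Proof.
rewrite /Rl -!big_split big1 //= => l _.
by rewrite -!mulrDl bianchi1 ?mul0r //; apply: torsion.
Qed.

Hypothesis torsion_free_A : forall m (x : A), x *+ m.+1 = 0 -> x = 0.

(** The usual octahedron argument: the four cyclic identities are added with
    signs, and 2 is not a zero divisor. *)
Lemma Rl_pair d c i j : Rl d c i j = Rl i j d c.
Proof.
apply/eqP; rewrite -subr_eq0; apply/eqP; apply: (torsion_free_A (m := 1)).
have b1 := Rl_bianchi1 d c i j; have b2 := Rl_bianchi1 c i j d.
have b3 := Rl_bianchi1 i j d c; have b4 := Rl_bianchi1 j d c i.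
have e1 : Rl c i j d = - Rl c i d j by rewrite Rl_skew34.
have e2 : Rl i j c d = - Rl i j d c by rewrite Rl_skew34.
have e3 : Rl j c i d = - Rl c j i d by rewrite Rl_skew12.
have e4 : Rl j d i c = Rl d j c i by rewrite Rl_skew12 Rl_skew34 opprK.
have e5 : Rl d i j c = Rl i d c j by rewrite Rl_skew12 Rl_skew34 opprK.
have e6 : Rl j d c i = - Rl d j c i by rewrite Rl_skew12.
have e7 : Rl d c j i = - Rl d c i j by rewrite Rl_skew34.
have e8 : Rl c j d i = - Rl c j i d by rewrite Rl_skew34.
rewrite e1 e2 e3 in b2; rewrite e4 e5 in b3; rewrite e6 e7 e8 in b4.
have <- : (Rl d c i j + Rl c i d j + Rl i d c j)
  - (- Rl d j c i - Rl d c i j - Rl c j i d)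
  + (- Rl c i d j - Rl i j d c - Rl c j i d)
  - (Rl i j d c + Rl d j c i + Rl i d c j) = 0 by rewrite b1 b2 b3 b4; ring.
ring.
Qed.

Lemma cov2_Rl p d c :
  mx2 (cov2 p (Rl d c)) =
  (Dm D p (mx2 (riem d c)) - mx2 (Gam p) *m mx2 (riem d c)
   + mx2 (riem d c) *m mx2 (Gam p)) *m G.
Proof.
have -> : mx2 (cov2 p (Rl d c)) = Dm D p (mx2 (riem d c) *m G)
    - mx2 (Gam p) *m (mx2 (riem d c) *m G)
    - mx2 (riem d c) *m G *m (mx2 (Gam p))^T.
  have -> : mx2 (riem d c) *m G = mx2 (Rl d c).
    by apply/matrixP => i j; rewrite !mxE; apply: eq_bigr => l _; rewrite !mxE.
  exact: cov2_mx.
rewrite (DmM HD) DG; mx_ring.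
Qed.

(** The differential Bianchi identity; lowering the index commutes with the
    covariant derivative. *)
Lemma bianchi2 p d c i j :
  cov4 p Rl d c i j + cov4 d Rl c p i j + cov4 c Rl p d i j = 0.
Proof.
have /matrixP/(_ i j) : mx2 (cov2 p (Rl d c)) + mx2 (cov2 d (Rl c p))
    + mx2 (cov2 c (Rl p d)) = 0.
  by rewrite !cov2_Rl -!mulmxDl bianchi2_mx // mul0mx.
rewrite !mxE => h.
rewrite /nabla4 /nabla3.
have s p' d' c' : \sum_m Gam p' d' m * Rl m c' i j = - \sum_m Gam d' p' m * Rl c' m i j.
  rewrite -sumrN; apply: eq_bigr => m _.
  by rewrite torsion (Rl_skew12 c' m) mulrN.
rewrite (s p d c) (s d c p) (s c p d).
transitivity (cov2 p (Rl d c) i j + cov2 d (Rl c p) i j + cov2 c (Rl p d) i j); last by [].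
ring.
Qed.

End MetricConnection.

(** * The contracted Bianchi identity and Einstein scalars *)

Section CovariantRules.
Context (A : comNzRingType) (n : nat) (D : 'I_n -> A -> A).
Hypothesis HD : commuting_derivations D.
Context (g gi : 'I_n -> 'I_n -> A) (Gam : 'I_n -> 'I_n -> 'I_n -> A).
Hypothesis HG : levi_civita D g gi Gam.

Local Notation tr := (gtr gi).
Local Notation "<< X , Y >>" := (ip gi X Y).
Local Notation cov1 := (nabla1 D Gam).
Local Notation cov2 := (nabla2 D Gam).
Local Notation cov3 := (nabla3 D Gam).
Local Notation cov4 := (nabla4 D Gam).
Implicit Types (F H : 'I_n -> 'I_n -> 'I_n -> 'I_n -> A).

Lemma cov4N p F d c i j :
  cov4 p (fun d c i j => - F d c i j) d c i j = - cov4 p F d c i j.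
Proof.
rewrite /nabla4 /nabla3 /nabla2 /nabla1 (derivN HD).
have s (X Y : 'I_n -> A) : \sum_m X m * - Y m = - \sum_m X m * Y m.
  by rewrite -sumrN; apply: eq_bigr => m _; rewrite mulrN.
rewrite !s; ring.
Qed.

Lemma cov4D p F H d c i j :
  cov4 p (fun d c i j => F d c i j + H d c i j) d c i j
  = cov4 p F d c i j + cov4 p H d c i j.
Proof.
rewrite /nabla4 /nabla3 /nabla2 /nabla1 (derivD HD).
have s (X Y Z : 'I_n -> A) :
    \sum_m X m * (Y m + Z m) = \sum_m X m * Y m + \sum_m X m * Z m.
  by rewrite -big_split; apply: eq_bigr => m _; rewrite mulrDr.
rewrite !s; ring.
Qed.

Lemma cov4_swap12 p F d c i j :
  cov4 p (fun d c i j => F c d i j) d c i j = cov4 p F c d i j.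
Proof. rewrite /nabla4 /nabla3 /nabla2 /nabla1; ring. Qed.

Lemma cov4_swap34 p F d c i j :
  cov4 p (fun d c i j => F d c j i) d c i j = cov4 p F d c j i.
Proof. rewrite /nabla4 /nabla3 /nabla2 /nabla1; ring. Qed.

Lemma cov4_0 p d c i j : cov4 p (fun _ _ _ _ => 0) d c i j = 0.
Proof.
rewrite /nabla4 /nabla3 /nabla2 /nabla1 (deriv0 HD) !big1 ?subrr //.
all: by move=> *; rewrite mulr0.
Qed.

Lemma cov4_tensor p (L B : 'I_n -> 'I_n -> A) d c i j :
  cov4 p (fun d c i j => L d i * B c j) d c i j
  = cov2 p L d i * B c j + L d i * cov2 p B c j.
Proof.
rewrite /nabla4 /nabla3 /nabla2 /nabla1 (derivM HD).
have s1 (X Y : 'I_n -> A) a : \sum_m X m * (a * Y m) = a * \sum_m X m * Y m.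
  by rewrite mulr_sumr; apply: eq_bigr => m _; rewrite mulrCA.
have s2 (X Y : 'I_n -> A) a : \sum_m X m * (Y m * a) = (\sum_m X m * Y m) * a.
  by rewrite mulr_suml; apply: eq_bigr => m _; rewrite mulrA.
rewrite !s1 !s2; ring.
Qed.

Lemma cov3_tensor p (X : 'I_n -> A) (B : 'I_n -> 'I_n -> A) c i j :
  cov3 p (fun c i j => X i * B c j) c i j
  = cov1 p X i * B c j + X i * cov2 p B c j.
Proof.
rewrite /nabla4 /nabla3 /nabla2 /nabla1 (derivM HD).
have s1 (Z Y : 'I_n -> A) a : \sum_m Z m * (a * Y m) = a * \sum_m Z m * Y m.
  by rewrite mulr_sumr; apply: eq_bigr => m _; rewrite mulrCA.
have s2 (Z Y : 'I_n -> A) a : \sum_m Z m * (Y m * a) = (\sum_m Z m * Y m) * a.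
  by rewrite mulr_suml; apply: eq_bigr => m _; rewrite mulrA.
rewrite !s1 !s2; ring.
Qed.

Lemma cov3_swap23 p (S : 'I_n -> 'I_n -> 'I_n -> A) c i j :
  cov3 p (fun c i j => S c j i) c i j = cov3 p S c j i.
Proof. rewrite /nabla3 /nabla2 /nabla1; ring. Qed.

Lemma cov3D p (S T : 'I_n -> 'I_n -> 'I_n -> A) c i j :
  cov3 p (fun c i j => S c i j + T c i j) c i j = cov3 p S c i j + cov3 p T c i j.
Proof.
rewrite /nabla3 /nabla2 /nabla1 (derivD HD).
have s (X Y Z : 'I_n -> A) :
    \sum_m X m * (Y m + Z m) = \sum_m X m * Y m + \sum_m X m * Z m.
  by rewrite -big_split; apply: eq_bigr => m _; rewrite mulrDr.
rewrite !s; ring.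
Qed.

Lemma cov4_ip p F (B : 'I_n -> 'I_n -> A) d c i j :
  cov4 p (fun d c i j => << F d c i, B j >>) d c i j
  = << cov4 p F d c i, B j >> + << F d c i, cov2 p B j >>.
Proof.
rewrite [in LHS]/nabla4 [in LHS]/nabla3 [in LHS]/nabla2 [in LHS]/nabla1 (deriv_ip HD HG).
have s1 (X : 'I_n -> A) (Y : 'I_n -> 'I_n -> A) Z :
    \sum_m X m * << Y m, Z >> = << fun k => \sum_m X m * Y m k, Z >>.
  by rewrite ip_suml; apply: eq_bigr => m _; rewrite ipZl.
have s2 (X : 'I_n -> A) (Y : 'I_n -> 'I_n -> A) Z :
    \sum_m X m * << Z, Y m >> = << Z, fun k => \sum_m X m * Y m k >>.
  rewrite (ipC (lc_giC HG)) ip_suml; apply: eq_bigr => m _.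
  by rewrite ipZl (ipC (lc_giC HG)).
rewrite !s1 s2 -[cov4 p F d c i]/(fun k => cov1 p (F d c i) k
   - (\sum_m Gam p i m * F d c m k) - (\sum_m Gam p c m * F d m i k)
   - (\sum_m Gam p d m * F m c i k)).
rewrite -[cov2 p B j]/(fun k => cov1 p (B j) k - (\sum_m Gam p j m * B m k)).
rewrite /nabla1 !ipBl !ipBr; ring.
Qed.

Lemma gtr_cov4 q F c i :
  tr (fun p j => cov4 q F c p i j)
  = cov2 q (fun c i => tr (fun p j => F c p i j)) c i.
Proof.
have e p j : cov4 q F c p i j = cov2 q (fun p j => F c p i j) p j
    - (\sum_m Gam q i m * F c p m j) - \sum_m Gam q c m * F m p i j.
  by rewrite /nabla4 /nabla3 /nabla2 /nabla1; ring.
rewrite (eq_gtr _ e) 2!gtrB -(deriv_gtr HD HG) !gtr_sum.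
rewrite [RHS]/nabla2 /nabla1; congr (_ - _ - _); apply: eq_bigr => m _;
by rewrite gtrZ.
Qed.

End CovariantRules.

Section Einstein.
Context (A : comNzRingType) (n : nat) (D : 'I_n -> A -> A).
Hypothesis HD : commuting_derivations D.
Context (g gi : 'I_n -> 'I_n -> A) (Gam : 'I_n -> 'I_n -> 'I_n -> A).
Hypothesis HG : levi_civita D g gi Gam.
Hypothesis torsion_free_A : forall m (x : A), x *+ m.+1 = 0 -> x = 0.

Local Notation tr := (gtr gi).
Local Notation "<< X , Y >>" := (ip gi X Y).
Local Notation cov1 := (nabla1 D Gam).
Local Notation cov2 := (nabla2 D Gam).
Local Notation cov3 := (nabla3 D Gam).
Local Notation cov4 := (nabla4 D Gam).
Local Notation Rl := (Rl D g Gam).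
Local Notation gC := (lc_gC HG).
Local Notation giC := (lc_giC HG).

Context (rho : A).
Hypothesis einstein_rho :
  forall c i, \sum_d riem D Gam d c i d = rho * g c i.

Lemma gtr_Rl14 c i : tr (fun p d => Rl d c i p) = rho * g c i.
Proof.
rewrite -einstein_rho gtr_sum; apply: eq_bigr => l _.
rewrite -(gtr_gr HG l (fun d => riem D Gam d c i l)).
by apply: eq_gtr => p d; rewrite mulrC.
Qed.

Lemma gtr_Rl24 c i : tr (fun p j => Rl c p i j) = - (rho * g c i).
Proof.
rewrite -gtr_Rl14 -(gtr_sym giC) -gtrN; apply: eq_gtr => p j.
by rewrite Rl_skew12.
Qed.

Definition divR d c i := tr (fun p j => cov4 p Rl d c i j).

Lemma cov2_rho q c i : cov2 q (fun c i => - (rho * g c i)) c i = - (D q rho * g c i).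
Proof.
have := cov2_g HG q c i; rewrite /nabla2 /nabla1 (derivN HD) (derivM HD).
have s (X Y : 'I_n -> A) : \sum_m X m * - (rho * Y m) = - (rho * \sum_m X m * Y m).
  by rewrite mulr_sumr -sumrN; apply: eq_bigr => m _; rewrite mulrN mulrCA.
rewrite !s => /eqP; rewrite !subr_eq0 subr_eq => /eqP ->; ring.
Qed.

(** Contraction of the differential Bianchi identity with the inverse metric,
    the Ricci tensor being [rho * g]. *)
Lemma divR_drho d c i : divR d c i = D d rho * g c i - D c rho * g d i.
Proof.
have e q a b : tr (fun p j => cov4 q Rl a p b j) = - (D q rho * g a b).
  rewrite (gtr_cov4 HD HG) -cov2_rho; congr (nabla2 _ _ _ _ _ _).
  by apply/funext => x; apply/funext => y; exact: gtr_Rl24.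
have s12 : (fun d c i j => Rl c d i j) = fun d c i j => - Rl d c i j.
  by do 4 (apply/funext => ?); rewrite Rl_skew12.
have z : tr (fun p j => cov4 p Rl d c i j + cov4 d Rl c p i j - cov4 c Rl d p i j) = 0.
  rewrite -[RHS](gtr0 gi); apply: eq_gtr => p j.
  rewrite -(bianchi2 HD HG p d c i j); congr (_ + _).
  by rewrite -(cov4N HD) -s12 (cov4_swap12 D Gam c Rl).
rewrite gtrB gtrD !e in z.
apply/eqP; rewrite -subr_eq0 -z /divR; apply/eqP; ring.
Qed.

(** Contracting the divergence of the curvature once more gives
    D rho = (n - 1) D rho. *)
Lemma schur_einstein (m : nat) (hn : n = m.+3) d : D d rho = 0.
Proof.
apply: (torsion_free_A (m := m)).
have s34 : (fun d c i j => Rl d c j i) = fun d c i j => - Rl d c i j.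
  by do 4 (apply/funext => ?); rewrite (Rl_skew34 HD HG).
have e1 : tr (fun c i => divR d c i) = D d rho.
  rewrite /divR.
  transitivity (tr (fun p j => tr (fun c i => cov4 p Rl d c i j))).
    rewrite {1}/gtr /gtr.
    under eq_bigr do under eq_bigr do (rewrite mulr_sumr;
      under eq_bigr do rewrite mulr_sumr).
    under [RHS]eq_bigr do under eq_bigr do (rewrite mulr_sumr;
      under eq_bigr do rewrite mulr_sumr).
    transitivity (\sum_k \sum_p \sum_l \sum_j
       gi k l * (gi p j * cov4 p Rl d k l j)).
      by apply: eq_bigr => k _; rewrite exchange_big.
    rewrite exchange_big; apply: eq_bigr => p _ /=.
    transitivity (\sum_k \sum_j \sum_l gi k l * (gi p j * cov4 p Rl d k l j)).
      by apply: eq_bigr => k _; rewrite exchange_big.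
    rewrite exchange_big; apply: eq_bigr => j _ /=.
    by apply: eq_bigr => k _; apply: eq_bigr => l _; rewrite mulrCA.
  rewrite -[RHS](gtr_gr HG d (fun p => D p rho)) -(gtr_sym giC).
  apply: eq_gtr => j p.
  transitivity (- tr (fun c i => cov4 p Rl d c j i)).
    rewrite -gtrN; apply: eq_gtr => c i.
    by rewrite -(cov4N HD) -s34 (cov4_swap34 D Gam p Rl).
  rewrite (gtr_cov4 HD HG).
  have -> : (fun c i => tr (fun p j => Rl c p i j)) = fun c i => - (rho * g c i).
    by do 2 (apply/funext => ?); exact: gtr_Rl24.
  by rewrite cov2_rho opprK mulrC.
have : tr (fun c i => divR d c i) = D d rho *+ n - D d rho.
  rewrite (eq_gtr _ (divR_drho d)) gtrB gtrZ (gtr_g HG) mulr_natr.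
  congr (_ - _); rewrite -[RHS](gtr_gr HG d (fun p => D p rho)) -(gtr_sym giC).
  by apply: eq_gtr => ? ?; rewrite mulrC.
rewrite e1 hn => h.
rewrite -[RHS](subrr (D d rho)) {2}h !mulrSr; ring.
Qed.

End Einstein.

(** * The logarithmic derivative of the determinant of a metric *)

Section Jacobi.
Context (A : comNzRingType) (n : nat) (D : 'I_n -> A -> A).
Hypothesis HD : commuting_derivations D.

Lemma deriv_prod p (I : eqType) (r : seq I) (F : I -> A) : uniq r ->
  D p (\prod_(i <- r) F i)
  = \sum_(k <- r) \prod_(i <- r) (if i == k then D p (F i) else F i).
Proof.
elim: r => [|x r IH] /=; first by rewrite !big_nil (deriv1 HD).
case/andP => xr ur; rewrite !big_cons (derivM HD) (IH ur) eqxx; congr (_ + _).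
  congr (_ * _); rewrite !big_seq; apply: eq_bigr => i ir.
  by case: eqP => // e; rewrite -e ir in xr.
rewrite mulr_sumr !big_seq; apply: eq_bigr => k kr; rewrite big_cons.
by case: eqP => // e; rewrite e kr in xr.
Qed.

(** Formula of Jacobi. *)
Lemma deriv_det p m (M : 'M[A]_m) :
  D p (\det M) = \tr (\adj M *m Dm D p M).
Proof.
rewrite /determinant (deriv_sum HD).
pose M' k := \matrix_(i, j) (if i == k then D p (M i j) else M i j).
transitivity (\sum_k \det (M' k)).
  rewrite /determinant exchange_big; apply: eq_bigr => s _ /=.
  rewrite -mulr_sumr (derivM HD).
  have -> : D p ((-1) ^+ perm.odd_perm s) = 0.
    by case: (perm.odd_perm s); rewrite ?expr1 ?expr0 ?(derivN HD) ?(deriv1 HD) ?oppr0.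
  rewrite mul0r add0r deriv_prod ?index_enum_uniq //; congr (_ * _).
  by apply: eq_bigr => k _; apply: eq_bigr => i _; rewrite mxE.
rewrite /mxtrace; under [RHS]eq_bigr do rewrite mxE.
rewrite [RHS]exchange_big; apply: eq_bigr => k _ /=.
rewrite (expand_det_row _ k); apply: eq_bigr => j _.
rewrite !mxE eqxx mulrC; congr (_ * _); congr (_ * \det _).
by apply/matrixP => i l; rewrite !mxE eq_sym (negPf (neq_lift _ _)).
Qed.

Context (g gi : 'I_n -> 'I_n -> A) (Gam : 'I_n -> 'I_n -> 'I_n -> A).
Hypothesis HG : levi_civita D g gi Gam.

Lemma deriv_det_metric p :
  D p (\det (mx2 g)) = 2%:R * (\sum_m Gam p m m) * \det (mx2 g).
Proof.
rewrite deriv_det (DG HG) mulmxDr mxtraceD.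
have e : \tr (mx2 (Gam p)) = \sum_m Gam p m m by apply: eq_bigr => m _; rewrite mxE.
rewrite mulmxA mxtrace_mulC mulmxA mul_mx_adj mul_scalar_mx.
rewrite mulmxA mul_adj_mx mul_scalar_mx !mxtraceZ mxtrace_tr e; ring.
Qed.

End Jacobi.

(** * The Sinjukov equation on a four-dimensional Einstein space *)

Section Sinjukov.
Context (A : comNzRingType) (D : 'I_4 -> A -> A).
Hypothesis HD : commuting_derivations D.
Context (g gi : 'I_4 -> 'I_4 -> A) (Gam : 'I_4 -> 'I_4 -> 'I_4 -> A).
Hypothesis HG : levi_civita D g gi Gam.
Hypothesis torsion_free_A : forall m (x : A), x *+ m.+1 = 0 -> x = 0.

Local Notation tr := (gtr gi).
Local Notation "<< X , Y >>" := (ip gi X Y).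
Local Notation cov1 := (nabla1 D Gam).
Local Notation cov2 := (nabla2 D Gam).
Local Notation cov3 := (nabla3 D Gam).
Local Notation cov4 := (nabla4 D Gam).
Local Notation Rl := (Rl D g Gam).
Local Notation gC := (lc_gC HG).
Local Notation giC := (lc_giC HG).

Context (K : A).
Hypothesis einstein_K :
  forall c i, \sum_d riem D Gam d c i d = 3%:R * K * g c i.

Context (a : 'I_4 -> 'I_4 -> A) (lam : 'I_4 -> A).
Hypothesis aC : forall i j, a i j = a j i.
Hypothesis sinjukov :
  forall p i j, cov2 p a i j = lam i * g p j + lam j * g p i.

Definition Lam p i := cov1 p lam i.

Lemma torsion_free_eq m (x y : A) : x *+ m.+1 = y *+ m.+1 -> x = y.
Proof.
move=> h; apply/eqP; rewrite -subr_eq0; apply/eqP.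
by apply: (torsion_free_A (m := m)); rewrite mulrnBl h subrr.
Qed.

(** The trace of the Sinjukov equation: [lam] is half the gradient of tr a, hence
    its covariant derivative is symmetric. *)
Lemma deriv_tr_a p : D p (tr a) = lam p *+ 2.
Proof.
rewrite (deriv_gtr HD HG).
transitivity (tr (fun i j => g p j * lam i) + tr (fun i j => g p i * lam j)).
  by rewrite -gtrD; apply: eq_gtr => i j; rewrite sinjukov !(mulrC (g _ _)).
by rewrite -[X in X + _](gtr_sym giC) !(gtr_gr HG) mulr2n.
Qed.

Lemma LamC p i : Lam p i = Lam i p.
Proof.
rewrite /Lam /nabla1; congr (_ - _); last first.
  by apply: eq_bigr => m _; rewrite (lc_torsion HG).
apply: (@torsion_free_eq 1).
have dn q x : D q (x *+ 2) = D q x *+ 2 by rewrite !mulr2n (derivD HD).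
by rewrite -!dn -!deriv_tr_a (derivC HD).
Qed.

(** The Ricci identity for [a], the left hand side being the action of the
    curvature on [a]. *)
Lemma integrability d c i j :
  << Rl d c i, a j >> + << Rl d c j, a i >>
  = - (Lam d i * g c j + Lam d j * g c i - Lam c i * g d j - Lam c j * g d i).
Proof.
have e : (fun c => cov2 c a) = fun c i j => lam i * g c j + lam j * g c i.
  by do 3 apply/funext => ?; rewrite sinjukov.
have f q e' s t : cov3 q (fun c i j => lam i * g c j + lam j * g c i) e' s t
    = Lam q s * g e' t + Lam q t * g e' s.
  rewrite (cov3D HD Gam q (fun c i j => lam i * g c j)).
  rewrite (cov3_swap23 D Gam q (fun c i j => lam i * g c j)).
  by rewrite !(cov3_tensor HD) !(cov2_g HG) !mulr0 !addr0.
have := ricci_identity2 HD (lc_torsion HG) a d c i j.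
rewrite e !f !(ip_Rl HG) => h.
apply/eqP; rewrite eq_sym eqr_oppLR; apply/eqP.
have -> : \sum_l riem D Gam d c i l * a j l = \sum_l riem D Gam d c i l * a l j.
  by apply: eq_bigr => l _; rewrite aC.
rewrite -h; ring.
Qed.

Definition rlam d c i := << Rl d c i, lam >>.
Definition Tlam p d i := cov2 p Lam d i.
Definition tau i := tr (fun p d => Tlam p d i).

Lemma deriv_3K p : D p (3%:R * K) = 0.
Proof. exact: (schur_einstein HD HG torsion_free_A einstein_K (m := 1)). Qed.

Lemma deriv_K p : D p K = 0.
Proof.
apply: (torsion_free_A (m := 2)).
by rewrite -(deriv_3K p) (derivM HD) (deriv_nat HD) mul0r add0r mulr_natl.
Qed.

(** By the pair symmetry the divergence in any slot is the one in the last slot,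
    which vanishes as the Einstein scalar is constant. *)
Lemma div_Rl c i m : tr (fun p d => cov4 p Rl d c i m) = 0.
Proof.
have s : Rl = (fun d c i j => Rl j i c d).
  do 4 apply/funext => ?.
  rewrite (Rl_pair HD HG torsion_free_A) Rl_skew12.
  by rewrite (Rl_skew34 HD HG) opprK.
rewrite -[RHS](mul0r (g i c)) -[X in _ = X](subr0) -{2}(mul0r (g m c)).
rewrite -{1}(deriv_3K m) -(deriv_3K i) -(divR_drho HD HG einstein_K) /divR.
apply: eq_gtr => p d; rewrite {1}s.
rewrite /nabla4 /nabla3 /nabla2 /nabla1; ring.
Qed.

(** The trace over [p] and [d] of the covariant derivative by [p] of the
    integrability condition. *)
Lemma contracted_derivative j c i :
  3%:R * K * (g c i * lam j + g c j * lam i) + rlam j c i + rlam i c j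
  + tau i * g c j + tau j * g c i - Tlam j c i - Tlam i c j = 0.
Proof.
pose H1 d c i j := << Rl d c i, a j >>.
pose H2 (d c i j : 'I_4) := Lam d i * g c j.
pose E d c i j := H1 d c i j + H1 d c j i + H2 d c i j + H2 d c j i
   + - H2 c d i j + - H2 c d j i.
have E0 : E = fun _ _ _ _ => 0.
  do 4 apply/funext => ?; rewrite /E /H1 integrability /H2; ring.
have e1 p d e s t : cov4 p H1 d e s t = << cov4 p Rl d e s, a t >>
    + (lam t * Rl d e s p + g p t * rlam d e s).
  rewrite (cov4_ip HD HG p Rl a); congr (_ + _).
  transitivity << Rl d e s, fun m => lam t * g p m + g p t * lam m >>.
    by apply: eq_ip => // k; rewrite sinjukov (mulrC (lam k)).
  by rewrite ipDr !ipZr (ip_gr HG).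
have e2 p d e s t : cov4 p H2 d e s t = Tlam p d s * g e t.
  by rewrite (cov4_tensor HD) (cov2_g HG) mulr0 addr0.
have : tr (fun p d => cov4 p E d c i j) = 0.
  by rewrite -[RHS](gtr0 gi); apply: eq_gtr => p d; rewrite E0 (cov4_0 HD).
have k p d : cov4 p E d c i j =
   cov4 p H1 d c i j + cov4 p H1 d c j i + cov4 p H2 d c i j + cov4 p H2 d c j i
   - cov4 p H2 c d i j - cov4 p H2 c d j i.
  rewrite /E !(cov4D HD) !(cov4N HD).
  rewrite (cov4_swap34 D Gam p H1) (cov4_swap34 D Gam p H2).
  rewrite (cov4_swap12 D Gam p H2).
  by rewrite (cov4_swap12 D Gam p (fun d c i j => H2 d c j i))
     (cov4_swap34 D Gam p H2).
rewrite (eq_gtr _ k).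
have t1 s t : tr (fun p d => cov4 p H1 d c s t)
    = lam t * (3%:R * K * g c s) + rlam t c s.
  rewrite (eq_gtr _ (fun p d => e1 p d c s t)) gtrD gtr_ipr.
  rewrite (_ : (fun m => tr _) = fun=> 0); last first.
    by apply/funext => m; exact: div_Rl.
  rewrite ip0l add0r gtrD gtrZ (gtr_Rl14 HG einstein_K); congr (_ + _).
  rewrite -(gtr_gr HG t (fun d => rlam d c s)).
  by apply: eq_gtr => p d; rewrite gC.
have t2 s t : tr (fun p d => cov4 p H2 d c s t) = tau s * g c t.
  rewrite (eq_gtr _ (fun p d => e2 p d c s t)) mulrC -gtrZ.
  by apply: eq_gtr => p d; rewrite mulrC.
have t3 s t : tr (fun p d => cov4 p H2 c d s t) = Tlam t c s.
  rewrite (eq_gtr _ (fun p d => e2 p c d s t)).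
  rewrite -(gtr_gr HG t (fun p => Tlam p c s)) -(gtr_sym giC).
  by apply: eq_gtr => p d; rewrite mulrC gC.
rewrite 2!gtrB 3!gtrD !t1 !t2 !t3 => <-; ring.
Qed.

Lemma Tlam_sym p d i : Tlam p d i = Tlam p i d.
Proof.
rewrite /Tlam.
have -> : cov2 p Lam d i = cov2 p (fun d i => Lam i d) d i.
  by congr (nabla2 _ _ _ _ _ _); do 2 apply/funext => ?; rewrite LamC.
by rewrite /nabla2 /nabla1; ring.
Qed.

Lemma Tlam_ricci p d i : Tlam p d i = Tlam d p i - rlam p d i.
Proof.
apply/eqP; rewrite -subr_eq0 opprB addrCA addrC addr_eq0; apply/eqP.
have := ricci_identity1 HD (lc_torsion HG) lam p d i.
by rewrite -(ip_Rl HG) => <-; rewrite /rlam /Tlam; ring.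
Qed.

Lemma rlam_bianchi d c i : rlam d c i + rlam c i d + rlam i d c = 0.
Proof.
rewrite /rlam -!ipDl -[RHS](ip0l gi lam); apply: eq_ip => // k.
by rewrite (Rl_bianchi1 HG).
Qed.

Lemma rlam_skew d c i : rlam c d i = - rlam d c i.
Proof. by rewrite /rlam -ipNl; apply: eq_ip => // k; rewrite Rl_skew12. Qed.

(** The Ricci identity exchanges the outer indices of the second derivative of
    [lam], and the first Bianchi identity merges the curvature terms. *)
Lemma two_Tlam j c i : Tlam j c i *+ 2 = rlam i c j *+ 2
  + 3%:R * K * (g c i * lam j + g c j * lam i) + tau i * g c j + tau j * g c i.
Proof.
have h := contracted_derivative j c i.
have e1 : Tlam i c j = Tlam j c i - rlam i j c.
  by rewrite (Tlam_sym i c j) Tlam_ricci (Tlam_sym j i c).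
have e2 := rlam_bianchi i j c; rewrite (rlam_skew i c j) in e2.
rewrite e1 in h; apply/eqP; rewrite -subr_eq0; apply/eqP.
have h' : - 0 + 0 = 0 :> A by rewrite oppr0 addr0.
rewrite -[RHS]h' -{1}h -e2; ring.
Qed.

(** The second covariant derivative is symmetric in its last two indices, while
    the right hand side of [two_Tlam] is not obviously so; comparing both
    expressions leaves a formula for the curvature applied to [lam]. *)
Lemma four_rlam i c j : rlam i c j *+ 4 =
  - (3%:R * K * lam i + tau i) * g c j + (3%:R * K * lam c + tau c) * g i j.
Proof.
have h1 := two_Tlam j c i; have h2 := two_Tlam j i c.
rewrite (Tlam_sym j i c) h1 (rlam_skew i c j) in h2.
apply/eqP; rewrite -subr_eq0; apply/eqP.
move/eqP: h2; rewrite -subr_eq0 => /eqP <-.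
rewrite (gC c i); ring.
Qed.

(** The trace of [four_rlam] is a Ricci contraction, hence known. *)
Lemma sigma_eq i : 3%:R * K * lam i + tau i = - 4%:R * K * lam i.
Proof.
apply: (@torsion_free_eq 2).
have e1 : tr (fun s j => rlam s i j) = - (3%:R * K * lam i).
  rewrite gtr_ipr.
  transitivity << (fun m => - (3%:R * K * g i m)), lam >>.
    apply: eq_ip => // m.
    rewrite -(gtr_Rl24 HG einstein_K) (gtr_Rl24 HG einstein_K) -(gtr_Rl14 HG einstein_K).
    rewrite -(gtr_sym giC) -gtrN; apply: eq_gtr => s j.
    by rewrite -(Rl_skew34 HD HG).
  by rewrite ipNl ipZl (ip_g HG).
have : tr (fun s j => rlam s i j *+ 4) = - (3%:R * K * lam i) *+ 4.
  rewrite -e1 -mulr_natl -gtrZ; apply: eq_gtr => s j; by rewrite mulr_natl.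
rewrite (eq_gtr _ (fun s j => four_rlam s i j)) gtrD gtrZ (gtr_g HG).
rewrite (_ : tr _ = - (3%:R * K * lam i + tau i)); last first.
  rewrite -(gtr_gr HG i (fun s => - (3%:R * K * lam s + tau s))) -(gtr_sym giC).
  by apply: eq_gtr => s j; rewrite mulrC.
move=> h.
transitivity (- (3%:R * K * lam i + tau i) + (3%:R * K * lam i + tau i) * 4%:R).
  ring.
rewrite h; ring.
Qed.

Theorem rlamE i c j : rlam i c j = K * (lam i * g c j - lam c * g i j).
Proof.
apply: (@torsion_free_eq 3).
rewrite four_rlam !sigma_eq; ring.
Qed.

Theorem TlamE j c i :
  Tlam j c i = - K * (lam i * g c j + lam c * g i j + (lam j * g c i) *+ 2).
Proof.
apply: (@torsion_free_eq 1).
rewrite two_Tlam rlamE.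
have t k : tau k = - 4%:R * K * lam k - 3%:R * K * lam k.
  by rewrite -sigma_eq; ring.
rewrite !t; ring.
Qed.

Section NullGradient.
Hypothesis lam_null : << lam, lam >> = 0.

Lemma ip_Lam_lam p : << Lam p, lam >> = 0.
Proof.
apply: (torsion_free_A (m := 1)).
have := deriv_ip HD HG p lam lam.
rewrite lam_null (deriv0 HD) (ipC giC lam) => ->.
by rewrite mulr2n.
Qed.

(** Leibniz rule for the tensor [<< B q, C s >>], whose two free indices are
    those of [B] and [C]. *)
Lemma cov1_ip p (B C : 'I_4 -> 'I_4 -> A) q s :
  D p << B q, C s >> - \sum_m Gam p q m * << B m, C s >>
   - \sum_m Gam p s m * << B q, C m >>
  = << cov2 p B q, C s >> + << B q, cov2 p C s >>.
Proof.
rewrite (deriv_ip HD HG).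
have s1 (X : 'I_4 -> A) (Y : 'I_4 -> 'I_4 -> A) Z :
    \sum_m X m * << Y m, Z >> = << fun k => \sum_m X m * Y m k, Z >>.
  by rewrite ip_suml; apply: eq_bigr => m _; rewrite ipZl.
have s2 (X : 'I_4 -> A) (Y : 'I_4 -> 'I_4 -> A) Z :
    \sum_m X m * << Z, Y m >> = << Z, fun k => \sum_m X m * Y m k >>.
  rewrite (ipC giC) ip_suml; apply: eq_bigr => m _.
  by rewrite ipZl (ipC giC).
rewrite s1 s2 /nabla2 /nabla1 !ipBl !ipBr; ring.
Qed.

Lemma ip_Tlam_lam q p : << Tlam q p, lam >> = - 3%:R * K * (lam p * lam q).
Proof.
transitivity << fun i => (- K * g p q) * lam i + (- K * lam p) * g q i
   + (- 2%:R * K * lam q) * g p i, lam >>.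
  by apply: eq_ip => // i; rewrite TlamE (gC i q); ring.
rewrite !ipDl !ipZl lam_null !(ip_g HG); ring.
Qed.

Lemma ip_Lam_Lam p q : << Lam p, Lam q >> = 3%:R * K * (lam p * lam q).
Proof.
have h := deriv_ip HD HG q (Lam p) lam.
rewrite ip_Lam_lam (deriv0 HD) in h.
have : << Tlam q p, lam >> + << Lam p, Lam q >> = 0.
  rewrite /Tlam /nabla2 ipBl ip_suml.
  rewrite (eq_bigr (fun=> 0)) => [|m _]; last by rewrite ipZl ip_Lam_lam mulr0.
  by rewrite big1 // subr0 -h.
rewrite ip_Tlam_lam => /eqP; rewrite addrC addr_eq0 => /eqP ->; ring.
Qed.

Lemma ip_Tlam_Lam s p q :
  << Tlam s p, Lam q >> = - K * (lam p * Lam q s + (lam s * Lam q p) *+ 2).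
Proof.
transitivity << fun i => (- K * g p s) * lam i + (- K * lam p) * g s i
   + (- 2%:R * K * lam s) * g p i, Lam q >>.
  by apply: eq_ip => // i; rewrite TlamE (gC i s); ring.
rewrite !ipDl !ipZl (ipC giC lam) ip_Lam_lam !(ip_g HG); ring.
Qed.

(** The covariant derivative of [ip_Lam_Lam], with the second derivatives of
    [lam] replaced through [TlamE]. *)
Lemma K_lam_Lam s p q :
  K * (lam p * Lam q s + lam q * Lam p s + lam s * Lam p q) = 0.
Proof.
apply: (torsion_free_A (m := 3)).
have h := cov1_ip s Lam Lam p q.
have e : D s << Lam p, Lam q >> - \sum_m Gam s p m * << Lam m, Lam q >>
   - \sum_m Gam s q m * << Lam p, Lam m >>
   = 3%:R * K * (Lam s p * lam q + lam p * Lam s q).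
  rewrite ip_Lam_Lam (derivM HD) deriv_3K mul0r add0r (derivM HD).
  have -> : \sum_m Gam s p m * << Lam m, Lam q >>
      = \sum_m (3%:R * K * lam q) * (Gam s p m * lam m).
    by apply: eq_bigr => m _; rewrite ip_Lam_Lam; ring.
  have -> : \sum_m Gam s q m * << Lam p, Lam m >>
      = \sum_m (3%:R * K * lam p) * (Gam s q m * lam m).
    by apply: eq_bigr => m _; rewrite ip_Lam_Lam; ring.
  rewrite -!mulr_sumr /Lam /nabla1; ring.
rewrite e (ipC giC) in h.
have h2 : << cov2 s Lam p, Lam q >> = << Tlam s p, Lam q >> by [].
have h3 : << Lam p, cov2 s Lam q >> = << Tlam s q, Lam p >>.
  by rewrite (ipC giC).
move: h; rewrite (ipC giC) h2 h3 !ip_Tlam_Lam (LamC q p) (LamC s p) (LamC s q).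
move=> /eqP; rewrite -subr_eq0 => /eqP <-; ring.
Qed.

End NullGradient.

End Sinjukov.

(** * Parallel gradients *)

Section Parallel.
Context (A : comNzRingType) (D : 'I_4 -> A -> A).
Hypothesis HD : commuting_derivations D.
Context (g gi : 'I_4 -> 'I_4 -> A) (Gam : 'I_4 -> 'I_4 -> 'I_4 -> A).
Hypothesis HG : levi_civita D g gi Gam.
Hypothesis torsion_free_A : forall m (x : A), x *+ m.+1 = 0 -> x = 0.

Local Notation tr := (gtr gi).
Local Notation "<< X , Y >>" := (ip gi X Y).
Local Notation cov1 := (nabla1 D Gam).
Local Notation cov2 := (nabla2 D Gam).
Local Notation cov3 := (nabla3 D Gam).
Local Notation gC := (lc_gC HG).
Local Notation giC := (lc_giC HG).

Context (K : A).
Hypothesis einstein_K :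
  forall c i, \sum_d riem D Gam d c i d = 3%:R * K * g c i.
Context (a : 'I_4 -> 'I_4 -> A) (lam : 'I_4 -> A).
Hypothesis aC : forall i j, a i j = a j i.
Hypothesis sinjukov :
  forall p i j, cov2 p a i j = lam i * g p j + lam j * g p i.
Hypothesis Lam0 : forall p i, Lam D Gam lam p i = 0.

(** The trace of [TlamE], whose left hand side vanishes for a parallel gradient. *)
Lemma parallel_K_lam i : K * lam i = 0.
Proof.
apply: (torsion_free_A (m := 6)).
have z : Lam D Gam lam = fun _ _ => 0 by do 2 apply/funext => ?; rewrite Lam0.
have T0 j c s : Tlam D Gam lam j c s = 0.
  rewrite /Tlam z /nabla2 /nabla1 (deriv0 HD) !big1 ?subrr // => *; exact: mulr0.
have : tr (fun c j => Tlam D Gam lam j c i) = 0.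
  by rewrite -[RHS](gtr0 gi); apply: eq_gtr => *; rewrite T0.
rewrite (eq_gtr _ (fun c j => TlamE HD HG torsion_free_A einstein_K aC sinjukov j c i)).
rewrite gtrZ gtrD gtrD gtrZ (gtr_g HG).
have e1 : tr (fun c j => lam c * g i j) = lam i.
  rewrite -[RHS](gtr_gr HG i lam) -(gtr_sym giC).
  by apply: eq_gtr => *; rewrite mulrC.
have e2 : tr (fun c j => lam j * g c i *+ 2) = lam i *+ 2.
  rewrite -[X in _ = X *+ _](gtr_gr HG i lam) -[RHS]mulr_natl -gtrZ.
  by apply: eq_gtr => c j; rewrite (gC c) (mulrC (lam j)) mulr_natl.
rewrite e1 e2 => h; apply/eqP; rewrite -oppr_eq0 -h; apply/eqP; ring.
Qed.

Hypothesis lam_null : << lam, lam >> = 0.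
Let b i j := 4%:R * a i j - tr a * g i j.
Hypothesis b_rank1 : forall i j k, b i j * lam k = b k j * lam i.

(** As [lam] is parallel, differentiating [b_rank1] gives
    lam_i nabla_p b_cj = lam_c nabla_p b_ij, where nabla b is known from the
    Sinjukov equation; its trace over [p] and [c] reads
    18 lam_i lam_j = 8 lam_i lam_j. *)
Lemma parallel_null_lam i j : lam i * lam j = 0.
Proof.
apply: (torsion_free_A (m := 9)).
have Db p s t : cov2 p b s t
    = 4%:R * (lam s * g p t + lam t * g p s) - 2%:R * lam p * g s t.
  rewrite -sinjukov.
  have h := cov2_g HG p s t.
  transitivity (4%:R * cov2 p a s t - D p (tr a) * g s t - tr a * cov2 p g s t).
    rewrite /b /nabla2 /nabla1 (derivD HD) (derivN HD) !(derivM HD).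
    rewrite (deriv_nat HD).
    have s' (X Y Z : 'I_4 -> A) (c e : A) : \sum_m X m * (c * Y m - e * Z m)
        = c * (\sum_m X m * Y m) - e * (\sum_m X m * Z m).
      by rewrite !mulr_sumr -sumrB; apply: eq_bigr => m _; ring.
    rewrite !s'; ring.
  rewrite h (deriv_tr_a HD HG sinjukov); ring.
pose F (c i j : 'I_4) := lam i * b c j.
have FE : (fun c i j => F i c j) = F.
  by do 3 apply/funext => ?; rewrite /F mulrC b_rank1 mulrC.
have E p c : lam i * cov2 p b c j = lam c * cov2 p b i j.
  have e1 s t : cov3 p F s t j = lam t * cov2 p b s j.
    rewrite (cov3_tensor HD) -/(Lam D Gam lam p t) Lam0 mul0r add0r //.
  rewrite -e1 -(e1 i c) -{1}FE.
  by rewrite /nabla3 /nabla2 /nabla1; ring.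
have : tr (fun p c => lam i * cov2 p b c j) = tr (fun p c => lam c * cov2 p b i j).
  by apply: eq_gtr => p c; exact: E.
have e0 X s : tr (fun p c => g p s * X c) = X s.
  by rewrite -[RHS](gtr_gr HG s X); apply: eq_gtr => *; rewrite (gC _ s).
have e0' X s : tr (fun p c => g c s * X p) = X s.
  by rewrite -[RHS](e0 X s) -[RHS](gtr_sym giC).
have -> : tr (fun p c => lam i * cov2 p b c j) = lam i * (18%:R * lam j).
  rewrite gtrZ; congr (_ * _).
  transitivity (4%:R * (tr (fun p c => g p j * lam c) + lam j * tr g)
     - 2%:R * tr (fun p c => g c j * lam p)).
    rewrite -!gtrZ -gtrD -gtrZ -gtrB; apply: eq_gtr => p c; rewrite Db; ring.
  rewrite e0 e0' (gtr_g HG); ring.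
have -> : tr (fun p c => lam c * cov2 p b i j) = 8%:R * (lam i * lam j).
  transitivity (4%:R * lam i * tr (fun p c => g p j * lam c)
    + 4%:R * lam j * tr (fun p c => g p i * lam c)
     - 2%:R * g i j * << lam, lam >>).
    rewrite /ip -!gtrZ -gtrD -gtrB; apply: eq_gtr => p c; rewrite Db; ring.
  rewrite !e0 lam_null; ring.
move=> /eqP; rewrite -subr_eq0 => /eqP <-; ring.
Qed.

End Parallel.

(** * The Sinjukov tensor of a projective change *)

Section ProjectiveChange.
Context (A : comNzRingType) (n : nat) (D : 'I_n -> A -> A).
Hypothesis HD : commuting_derivations D.
Context (g gi : 'I_n -> 'I_n -> A) (Gam : 'I_n -> 'I_n -> 'I_n -> A).
Hypothesis HG : levi_civita D g gi Gam.
Context (gb gbi : 'I_n -> 'I_n -> A) (Gamb : 'I_n -> 'I_n -> 'I_n -> A).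
Hypothesis HGb : levi_civita D gb gbi Gamb.
Context (phi : 'I_n -> A) (f : A).
Hypothesis Gam_phi : forall p i m,
  Gamb p i m = Gam p i m + phi i * (p == m)%:R + phi p * (i == m)%:R.
Hypothesis df : forall p, D p f = 2%:R * phi p * f.

(** a = f g gbar^-1 g; for projectively related connections this combination
    solves a linear differential equation, unlike [gb]. *)
Definition sinj_form i j := f * \sum_k \sum_l g i k * gbi k l * g l j.
Definition sinj_grad i := - (f * \sum_k \sum_l g i k * gbi k l * phi l).

Lemma sinj_formC i j : sinj_form i j = sinj_form j i.
Proof.
rewrite /sinj_form exchange_big; congr (_ * _); apply: eq_bigr => k _.
apply: eq_bigr => l _.
by rewrite (lc_gC HG i) (lc_gC HG k) (lc_giC HGb l); ring.
Qed.

Local Notation G := (mx2 g).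
Local Notation H := (mx2 gbi).
Local Notation Ga p := (mx2 (Gam p)).
Local Notation F := (cv1 phi).
Local Notation e p := (delta_mx 0 p : 'rV[A]_n).

(** The inverse of [gb] is parallel for [Gamb]; rewritten in terms of [Gam]
    the terms with phi appear. *)
Lemma Dm_gbi p : Dm D p H = - (H *m Ga p) - (Ga p)^T *m H
  - (2%:R * phi p) *: H - H *m F *m e p - (H *m F *m e p)^T.
Proof.
have GbE : mx2 (Gamb p) = Ga p + (phi p)%:M + F *m e p.
  apply/matrixP => i m; rewrite !mxE Gam_phi big_ord_recl big_ord0 addr0 !mxE.
  rewrite addrAC; congr (_ + _ + _); last by rewrite mulr_natr.
  by rewrite (eq_sym p) eqxx.
have HT : H^T = H by apply/matrixP => i j; rewrite !mxE (lc_giC HGb).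
have E : Dm D p H = - (H *m mx2 (Gamb p)) - (mx2 (Gamb p))^T *m H.
  apply/matrixP => k l; rewrite !mxE (deriv_gi HD HGb).
  by congr (- _ - _); apply: eq_bigr => m _; rewrite !mxE.
rewrite E GbE !trmxD tr_scalar_mx !mulmxDl !mulmxDr mul_mx_scalar mul_scalar_mx.
rewrite !trmx_mul HT.
have -> : (2%:R * phi p) *: H = phi p *: H + phi p *: H.
  by rewrite mulr_natl mulr2n scalerDl.
mx_ring.
Qed.

Lemma sinjukov_of_projective p i j :
  nabla2 D Gam p sinj_form i j = sinj_grad i * g p j + sinj_grad j * g p i.
Proof.
have GT : G^T = G by apply/matrixP => k l; rewrite !mxE (lc_gC HG).
have aE : mx2 sinj_form = f *: (G *m H *m G).
  apply/matrixP => k l; rewrite !mxE /sinj_form exchange_big; congr (_ * _).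
  apply: eq_bigr => s _; rewrite !mxE mulr_suml; apply: eq_bigr => t _.
  by rewrite !mxE.
have lE : cv1 sinj_grad = - (f *: (G *m H *m F)).
  apply/matrixP => k l; rewrite !mxE /sinj_grad exchange_big; congr (- (_ * _)).
  apply: eq_bigr => s _; rewrite !mxE mulr_suml; apply: eq_bigr => t _.
  by rewrite !mxE.
have DmZ (c : A) (M : 'M[A]_n) : Dm D p (c *: M) = D p c *: M + c *: Dm D p M.
  by apply/matrixP => k l; rewrite !mxE (derivM HD).
have E : mx2 (nabla2 D Gam p sinj_form) =
    cv1 sinj_grad *m (e p *m G) + (cv1 sinj_grad *m (e p *m G))^T.
  rewrite cov2_mx aE lE DmZ df !(DmM HD) Dm_gbi (DG HG).
  rewrite !mulmxDl !mulmxDr !trmx_mul !mulNmx !mulmxN GT trmxN.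
  have HT : H^T = H by apply/matrixP => k l; rewrite !mxE (lc_giC HGb).
  have -> : (f *: (G *m H *m F))^T = f *: (F^T *m H *m G).
    by rewrite linearZ /= !trmx_mul GT HT !mulmxA.
  rewrite -?scalemxAl -?scalemxAr HT ?(mulmxA, mulmxDl, mulmxDr, mulNmx, mulmxN).
  rewrite -?scalemxAl -?scalemxAr.
  apply/matrixP => k l; rewrite ?(mxDE, mxNE, mx0E).
  have sE (c : A) (M : 'M[A]_n) x y : (c *: M) x y = c * M x y by rewrite mxE.
  rewrite ?(sE, mxDE, mxNE).
  rewrite ?mulmxA; ring.
move/matrixP: E => /(_ i j); rewrite !mxE => ->.
have eG k : (e p *m G) 0 k = g p k by rewrite -rowE !mxE.
by rewrite !big_ord_recl !big_ord0 !addr0 !eG !mxE; ring.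
Qed.

End ProjectiveChange.

(** * The integrability condition along the gradient, and the Weyl tensor *)

Section ContractedIntegrability.
Context (A : comNzRingType) (D : 'I_4 -> A -> A).
Hypothesis HD : commuting_derivations D.
Context (g gi : 'I_4 -> 'I_4 -> A) (Gam : 'I_4 -> 'I_4 -> 'I_4 -> A).
Hypothesis HG : levi_civita D g gi Gam.
Hypothesis torsion_free_A : forall m (x : A), x *+ m.+1 = 0 -> x = 0.
Local Notation tr := (gtr gi).
Local Notation "<< X , Y >>" := (ip gi X Y).
Local Notation Rl := (Rl D g Gam).
Local Notation Lam := (Lam D Gam).
Context (K : A).
Hypothesis einstein_K :
  forall c i, \sum_d riem D Gam d c i d = 3%:R * K * g c i.
Context (a : 'I_4 -> 'I_4 -> A) (lam : 'I_4 -> A).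
Hypothesis aC : forall i j, a i j = a j i.
Hypothesis sinjukov :
  forall p i j, nabla2 D Gam p a i j = lam i * g p j + lam j * g p i.
Hypothesis lam_null : << lam, lam >> = 0.

(** By the pair symmetry the contraction of the second slot with [lam] is the
    contraction of the last slot, known from [rlamE]. *)
Lemma contract_Rl d i j : << fun c => << Rl d c i, a j >>, lam >>
  = K * (lam i * a j d - << lam, a j >> * g i d).
Proof.
transitivity << fun m => K * (lam i * g d m) - K * g i d * lam m, a j >>; last first.
  by rewrite ipBl !ipZl (ip_g HG); ring.
transitivity (tr (fun c l => << fun m => lam l * Rl d c i m, a j >>)).
  by apply: eq_gtr => c l; rewrite ipZl mulrC.
rewrite gtr_ipr; apply: eq_ip => // m.
transitivity << Rl i m d, lam >>.
  apply: eq_gtr => c l; rewrite mulrC.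
  by rewrite (Rl_pair HD HG torsion_free_A d c i m).
have := rlamE HD HG torsion_free_A einstein_K aC sinjukov i m d.
by rewrite /rlam => ->; rewrite (lc_gC HG m); ring.
Qed.

(** Contracting the index [c] of [integrability] with [lam] removes the
    curvature, and the terms containing nabla_lam lam vanish for null [lam]. At
    points where [K] vanishes the right hand side is zero. *)
Lemma contracted_integrability d i j : Lam lam d i * lam j + Lam lam d j * lam i
  = - K * (lam i * a j d + lam j * a i d - << lam, a j >> * g i d - << lam, a i >> * g j d).
Proof.
have h c := integrability HD HG aC sinjukov d c i j.
have L c k := LamC HD HG torsion_free_A sinjukov c k.
have n k := ip_Lam_lam HD HG torsion_free_A lam_null k.
have : << fun c => << Rl d c i, a j >> + << Rl d c j, a i >>, lam >>
  = << fun c => - (Lam lam d i * g j c + Lam lam d j * g i c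
     - g d j * Lam lam i c - g d i * Lam lam j c), lam >>.
  apply: eq_ip => // c; rewrite h (L c i) (L c j) (lc_gC HG j) (lc_gC HG i).
  by congr (- _); ring.
rewrite ipDl !contract_Rl ipNl !ipBl ipDl !ipZl !(ip_g HG) !n => e.
by apply: oppr_inj; rewrite -[RHS]/(- (- K * _)) mulNr opprK; transitivity
  (K * (lam i * a j d - << lam, a j >> * g i d) + K * (lam j * a i d - << lam, a i >> * g j d));
  [rewrite e; ring|ring].
Qed.

End ContractedIntegrability.

Section WeylTensor.
Context (A : comNzRingType) (D : 'I_4 -> A -> A).
Hypothesis HD : commuting_derivations D.
Context (g gi : 'I_4 -> 'I_4 -> A) (Gam : 'I_4 -> 'I_4 -> 'I_4 -> A).
Hypothesis HG : levi_civita D g gi Gam.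
Hypothesis torsion_free_A : forall m (x : A), x *+ m.+1 = 0 -> x = 0.
Local Notation tr := (gtr gi).
Local Notation "<< X , Y >>" := (ip gi X Y).
Local Notation Rl := (Rl D g Gam).
Context (K : A).
Hypothesis einstein_K :
  forall c i, \sum_d riem D Gam d c i d = 3%:R * K * g c i.

(** For an Einstein metric this is the Weyl tensor: the curvature minus the
    curvature of constant sectional curvature [K]. *)
Definition weyl d c i j := Rl d c i j - K * (g d j * g c i - g c j * g d i).

Lemma weyl_skew12 d c i j : weyl c d i j = - weyl d c i j.
Proof. by rewrite /weyl Rl_skew12; ring. Qed.

Lemma weyl_skew34 d c i j : weyl d c j i = - weyl d c i j.
Proof. by rewrite /weyl (Rl_skew34 HD HG); ring. Qed.

Lemma weyl_pair d c i j : weyl d c i j = weyl i j d c.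
Proof.
rewrite /weyl (Rl_pair HD HG torsion_free_A) (lc_gC HG d j) (lc_gC HG d i).
by rewrite (lc_gC HG c i) (lc_gC HG c j); ring.
Qed.

Lemma weyl_trace c i : tr (fun p d => weyl d c i p) = 0.
Proof.
rewrite gtrB (gtr_Rl14 HG einstein_K) gtrZ gtrB.
have -> : tr (fun p d => g d p * g c i) = 4%:R * g c i.
  rewrite -(gtr_g HG) mulrC -gtrZ; apply: eq_gtr => p d.
  by rewrite mulrC (lc_gC HG d).
have -> : tr (fun p d => g c p * g d i) = g c i.
  by rewrite (gtr_gr HG c (fun d => g d i)).
ring.
Qed.

Context (a : 'I_4 -> 'I_4 -> A) (lam : 'I_4 -> A).
Hypothesis aC : forall i j, a i j = a j i.
Hypothesis sinjukov :
  forall p i j, nabla2 D Gam p a i j = lam i * g p j + lam j * g p i.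

(** The curvature applied to [lam] is that of a space form, by [rlamE]. *)
Lemma weyl_grad d c i : << weyl d c i, lam >> = 0.
Proof.
have e := rlamE HD HG torsion_free_A einstein_K aC sinjukov d c i.
rewrite /weyl ipBl -/(rlam D g gi Gam lam d c i) e ipZl ipBl.
have -> : << fun j => g d j * g c i, lam >> = g c i * lam d.
  by rewrite -(ip_g HG d lam) -ipZl; apply: eq_ip => // j; rewrite mulrC.
have -> : << fun j => g c j * g d i, lam >> = g d i * lam c.
  by rewrite -(ip_g HG c lam) -ipZl; apply: eq_ip => // j; rewrite mulrC.
ring.
Qed.

End WeylTensor.

(** * Components of tensors in a frame *)

Section Pull.
Context (R : fieldType) (n : nat).
Implicit Types (P : 'M[R]_n) (X : 'I_n -> R) (B : 'I_n -> 'I_n -> R).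

(** The rows of [P] are the vectors of a frame, and [pull P X] lists the values
    of the covector [X] on them; [pull2], [pull3] and [pull4] do the same for
    tensors of higher rank. *)
Definition pull P X i := \sum_a P i a * X a.

Lemma pull_eq0 P X : P \in unitmx -> (forall i, pull P X i = 0) -> forall a, X a = 0.
Proof.
move=> uP h a.
have : P *m cv1 X = 0.
  by apply/matrixP => i j; rewrite !mxE -[RHS](h i); apply: eq_bigr => k _; rewrite mxE.
move/(congr1 (mulmx (invmx P))); rewrite mulKmx // mulmx0 => /matrixP/(_ a 0).
by rewrite !mxE.
Qed.

Lemma pullC P B i j :
  pull P (fun a => pull P (B a) j) i = pull P (fun b => pull P (B^~ b) i) j.
Proof.
rewrite /pull; under eq_bigr do rewrite mulr_sumr.
under [RHS]eq_bigr do rewrite mulr_sumr.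
rewrite exchange_big; apply: eq_bigr => b _; apply: eq_bigr => a _.
by rewrite mulrCA.
Qed.

Lemma pull0 P i : pull P (fun=> 0) i = 0.
Proof. by rewrite /pull big1 // => a _; rewrite mulr0. Qed.

Lemma pullD P X Y i : pull P (fun a => X a + Y a) i = pull P X i + pull P Y i.
Proof. by rewrite /pull -big_split; apply: eq_bigr => a _; rewrite mulrDr. Qed.

Lemma pullZ P c X i : pull P (fun a => c * X a) i = c * pull P X i.
Proof. by rewrite /pull mulr_sumr; apply: eq_bigr => a _; rewrite mulrCA. Qed.

Lemma pullZr P c X i : pull P (fun a => X a * c) i = pull P X i * c.
Proof. by rewrite /pull mulr_suml; apply: eq_bigr => a _; rewrite mulrA. Qed.

Lemma pullN P X i : pull P (fun a => - X a) i = - pull P X i.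
Proof. by rewrite /pull -sumrN; apply: eq_bigr => a _; rewrite mulrN. Qed.

Lemma pull_gtr P ni (F : 'I_n -> 'I_n -> 'I_n -> R) i :
  pull P (fun a => gtr ni (F a)) i = gtr ni (fun k l => pull P (fun a => F a k l) i).
Proof.
rewrite /pull gtr_sum; apply: eq_bigr => a _; by rewrite gtrZ.
Qed.

Definition pull2 P B i j := pull P (fun a => pull P (B a) j) i.
Definition pull3 P (T : 'I_n -> 'I_n -> 'I_n -> R) i j k :=
  pull P (fun a => pull2 P (T a) j k) i.
Definition pull4 P (W : 'I_n -> 'I_n -> 'I_n -> 'I_n -> R) i j k l :=
  pull P (fun a => pull3 P (W a) j k l) i.

Lemma pull3_eq0 P T : P \in unitmx -> (forall i j k, pull3 P T i j k = 0) ->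
  forall a b c, T a b c = 0.
Proof.
move=> uP h a b c; apply: (pull_eq0 uP) => k; move: b.
apply: (pull_eq0 uP) => j; move: a; apply: (pull_eq0 uP) => i; exact: h.
Qed.

Lemma pull4_eq0 P W : P \in unitmx -> (forall i j k l, pull4 P W i j k l = 0) ->
  forall a b c d, W a b c d = 0.
Proof.
move=> uP h a; apply: (pull3_eq0 uP) => j k l; move: a.
by apply: (pull_eq0 uP) => i; exact: h.
Qed.

Lemma eq_pull P X Y i : (forall a, X a = Y a) -> pull P X i = pull P Y i.
Proof. by move=> h; apply: eq_bigr => a _; rewrite h. Qed.

Lemma pull4_skew12 P W : (forall a b c d, W b a c d = - W a b c d) ->
  forall i j k l, pull4 P W j i k l = - pull4 P W i j k l.
Proof.
move=> h i j k l; rewrite /pull4 /pull3 pullC -pullN.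
apply: eq_pull => a; rewrite -pullN; apply: eq_pull => b.
rewrite /pull2 -pullN; apply: eq_pull => c; rewrite -pullN; exact: eq_pull.
Qed.

Lemma pull4_skew34 P W : (forall a b c d, W a b d c = - W a b c d) ->
  forall i j k l, pull4 P W i j l k = - pull4 P W i j k l.
Proof.
move=> h i j k l; rewrite /pull4 -pullN; apply: eq_pull => a.
rewrite /pull3 -pullN; apply: eq_pull => b.
rewrite /pull2 pullC -pullN; apply: eq_pull => c.
by rewrite -pullN; apply: eq_pull => d.
Qed.

(** Exchanging the pairs of slots is a product of four transpositions of adjacent
    slots. *)
Lemma pull4_pair P W : (forall a b c d, W a b c d = W c d a b) ->
  forall i j k l, pull4 P W i j k l = pull4 P W k l i j.
Proof.
move=> h i j k l.
have swap23 V i' j' k' l' : pull4 P V i' j' k' l'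
    = pull4 P (fun a b c d => V a c b d) i' k' j' l'.
  by rewrite /pull4; apply: eq_pull => a; rewrite /pull3 /pull2 pullC.
have swap12 V i' j' k' l' : pull4 P V i' j' k' l'
    = pull4 P (fun a b c d => V b a c d) j' i' k' l'.
  by rewrite /pull4 /pull3 pullC.
have swap34 V i' j' k' l' : pull4 P V i' j' k' l'
    = pull4 P (fun a b c d => V a b d c) i' j' l' k'.
  rewrite /pull4; apply: eq_pull => a; rewrite /pull3; apply: eq_pull => b.
  by rewrite /pull2 pullC.
rewrite swap23 swap12 swap34 swap23.
rewrite /pull4; apply: eq_pull => a; rewrite /pull3; apply: eq_pull => b.
by rewrite /pull2; apply: eq_pull => c; apply: eq_pull => d; rewrite h.
Qed.

Section Frame.
Context (g gi ni : 'I_n -> 'I_n -> R) (P : 'M[R]_n).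
Hypothesis GiG : mx2 gi *m mx2 g = 1%:M.
Hypothesis uP : P \in unitmx.
Hypothesis NiN : mx2 ni *m (P *m mx2 g *m P^T) = 1%:M.

(** [ni] is the inverse of the Gram matrix of the frame. *)
Lemma gi_frame : mx2 gi = P^T *m mx2 ni *m P.
Proof.
have uPT : P^T \in unitmx by rewrite unitmx_tr.
have e : P^T *m mx2 ni *m P *m mx2 g = 1%:M.
  apply: (can_inj (mulmxK uPT)); rewrite mul1mx.
  by rewrite -[LHS]/(_ *m _) -!mulmxA (mulmxA P) NiN mulmx1.
by rewrite -[RHS]mulmx1 -(mulmx1C GiG) mulmxA e mul1mx.
Qed.

Lemma gtr_mx h B : gtr h B = \tr (mx2 h *m (mx2 B)^T).
Proof.
apply: eq_bigr => k _; rewrite !mxE; apply: eq_bigr => l _; by rewrite !mxE.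
Qed.

Lemma gtr_frame B : gtr gi B = gtr ni (pull2 P B).
Proof.
have e : mx2 (pull2 P B) = P *m mx2 B *m P^T.
  apply/matrixP => i j; rewrite !mxE /pull2 pullC; apply: eq_bigr => l _.
  by rewrite !mxE mulrC; congr (_ * _); apply: eq_bigr => k _; rewrite !mxE.
rewrite !gtr_mx e gi_frame !trmx_mul trmxK -!mulmxA mxtrace_mulC -!mulmxA.
by rewrite mxtrace_mulC -!mulmxA mxtrace_mulC -!mulmxA.
Qed.

Lemma ip_frame X Y : ip gi X Y = ip ni (pull P X) (pull P Y).
Proof.
rewrite /ip gtr_frame; apply: eq_gtr => k l.
rewrite /pull2 mulrC -pullZ; apply: eq_pull => a.
by rewrite pullZ mulrC.
Qed.

Lemma pull4_trace14 W : (forall c i, gtr gi (fun p d => W d c i p) = 0) ->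
  forall j k, gtr ni (fun l i => pull4 P W i j k l) = 0.
Proof.
move=> h j k.
have : pull P (fun b => pull P (fun c => gtr gi (fun p d => W d b c p)) k) j = 0.
  rewrite -[RHS](pull0 P j); apply: eq_pull => b.
  by rewrite -[RHS](pull0 P k); apply: eq_pull => c.
move=> <-.
rewrite (eq_pull _ _ (fun b => eq_pull _ _ (fun c => gtr_frame _))).
rewrite (eq_pull _ _ (fun b => pull_gtr _ _ _ _)) pull_gtr.
apply: eq_gtr => l i.
rewrite /pull4 /pull3 /pull2 pullC; apply: eq_pull => b.
rewrite pullC; apply: eq_pull => c.
by rewrite pullC.
Qed.

Lemma pull4_commutator W a :
  (forall d c i j, ip gi (W d c i) (a j) + ip gi (W d c j) (a i) = 0) ->
  forall d c i j, ip ni (pull4 P W d c i) (pull2 P a j)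
    + ip ni (pull4 P W d c j) (pull2 P a i) = 0.
Proof.
move=> h d c i j.
have c1 (X : 'I_n -> R) (Y : 'I_n -> 'I_n -> R) s :
    pull P (fun k => ip ni X (Y k)) s = ip ni X (fun m => pull P (Y^~ m) s).
  rewrite /ip pull_gtr; apply: eq_gtr => p q; by rewrite pullZ.
have c2 (X : 'I_n -> 'I_n -> R) (Y : 'I_n -> R) s :
    pull P (fun k => ip ni (X k) Y) s = ip ni (fun m => pull P (X^~ m) s) Y.
  rewrite /ip pull_gtr; apply: eq_gtr => p q; by rewrite pullZr.
have main s t : pull P (fun d => pull P (fun c => pull P (fun i => pull P (fun j =>
     ip gi (W d c i) (a j)) t) s) c) d = ip ni (pull4 P W d c s) (pull2 P a t).
  transitivity (pull P (fun d => pull P (fun c => pull P (fun i =>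
     ip ni (pull P (W d c i)) (pull2 P a t)) s) c) d).
    apply: eq_pull => d'; apply: eq_pull => c'; apply: eq_pull => i'.
    transitivity (pull P (fun j => ip ni (pull P (W d' c' i')) (pull P (a j))) t).
      by apply: eq_pull => ?; rewrite ip_frame.
    by rewrite c1; apply: eq_ip => // k; rewrite /pull2 pullC.
  transitivity (pull P (fun d => pull P (fun c =>
     ip ni (pull2 P (W d c) s) (pull2 P a t)) c) d).
    by apply: eq_pull => d'; apply: eq_pull => c'; rewrite c2; apply: eq_ip.
  transitivity (pull P (fun d => ip ni (pull3 P (W d) c s) (pull2 P a t)) d).
    by apply: eq_pull => d'; rewrite c2; apply: eq_ip.
  by rewrite c2; apply: eq_ip.
rewrite -!main [X in _ + X](_ : _ = pull P (fun d => pull P (fun c =>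
   pull P (fun i => pull P (fun j => ip gi (W d c j) (a i)) j) i) c) d); last first.
  by apply: eq_pull => d'; apply: eq_pull => c'; rewrite pullC.
rewrite -pullD -[RHS](pull0 P d); apply: eq_pull => d'.
rewrite -pullD -[RHS](pull0 P c); apply: eq_pull => c'.
rewrite -pullD -[RHS](pull0 P i); apply: eq_pull => i'.
by rewrite -pullD -[RHS](pull0 P j); apply: eq_pull => j'.
Qed.

End Frame.

End Pull.

(** * Frames in dimension four, and the case of a nonnull direction *)

Section OrthogonalBasis.
Context (R : numFieldType).

(** Gram-Schmidt: a nonnull vector [l] is completed by the components orthogonal
    to it of the coordinate vectors, except one on which [l] does not vanish. *)
Lemma orthogonal_step n (G : 'M[R]_(1 + n)) (l : 'rV[R]_(1 + n)) :
  G^T = G -> (l *m G *m l^T) 0 0 != 0 ->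
  exists P : 'M[R]_(1 + n), [/\ P \in unitmx, usubmx P = l &
    exists2 G' : 'M[R]_n, G'^T = G' &
      P *m G *m P^T = block_mx (l *m G *m l^T) 0 0 G'].
Proof.
move=> symG c0; set c := (l *m G *m l^T) 0 0 in c0.
have [j lj] : exists j, l 0 j != 0.
  apply/existsP; apply: contraNT c0 => /existsPn h.
  rewrite /c; suff -> : l = 0 by rewrite mul0mx mul0mx mxE.
  by apply/rowP => j; rewrite mxE; apply/eqP; move: (h j); rewrite negbK.
have cE : l *m G *m l^T = c%:M.
  by rewrite [LHS]mx11_scalar.
pose S : 'M[R]_(n, 1 + n) := row' j 1%:M.
pose Q := S - c^-1 *: (S *m G *m l^T *m l).
have Ql : Q *m G *m l^T = 0.
  have e : S *m G *m l^T *m l *m G *m l^T = c *: (S *m G *m l^T).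
    by rewrite -(mulmxA _ l G) -(mulmxA _ (l *m G)) cE mul_mx_scalar.
  rewrite /Q mulmxBl -scalemxAl mulmxBl -scalemxAl e.
  by rewrite scalerA mulVf // scale1r subrr.
have lQ : l *m G *m Q^T = 0.
  by move/(congr1 trmx): Ql; rewrite !trmx_mul trmxK symG trmx0 mulmxA.
exists (col_mx l Q); split; last 1 first.
- exists (Q *m G *m Q^T); first by rewrite !trmx_mul trmxK symG mulmxA.
  by rewrite tr_col_mx mul_col_mx mul_col_row Ql lQ.
- rewrite -row_free_unit -kermx_eq0 -submx0; apply/rV_subP => x.
  move/sub_kermxP; rewrite -[x]hsubmxK mul_row_col.
  set x0 := lsubmx x; set x1 := rsubmx x => e.
  have x00 : x0 = 0.
    have : (x0 *m l + x1 *m Q) *m (G *m l^T) = 0 by rewrite e mul0mx.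
    rewrite mulmxDl (mulmxA (x1 *m Q)) -(mulmxA x1) -(mulmxA x1) Ql mulmx0 addr0.
    rewrite (mulmxA (x0 *m l)) -(mulmxA x0) -(mulmxA x0) cE mul_mx_scalar.
    by move/eqP; rewrite scaler_eq0 (negPf c0) /= => /eqP.
  rewrite x00 mul0mx add0r in e.
  have : x1 *m Q = x1 *m S - (c^-1 *: (x1 *m (S *m G *m l^T))) *m l.
    by rewrite /Q mulmxBr -scalemxAr -scalemxAl !mulmxA.
  rewrite e => /esym/eqP; rewrite subr_eq0 => /eqP e1.
  have Sj : (x1 *m S) 0 j = 0.
    rewrite mxE big1 // => k _; rewrite !mxE.
    by rewrite eq_sym (negPf (neq_lift _ _)) mulr0.
  set m := c^-1 *: _ in e1.
  have m0 : m = 0.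
    apply/matrixP => a b; rewrite !ord1 [RHS]mxE.
    move/rowP: e1 => /(_ j); rewrite Sj mxE big_ord_recl big_ord0 addr0.
    by move/esym/eqP; rewrite mulf_eq0 (negPf lj) orbF => /eqP.
  rewrite m0 mul0mx in e1.
  have x10 : x1 = 0.
    apply/rowP => k; rewrite mxE; move/rowP: e1 => /(_ (lift j k)).
    rewrite !mxE (bigD1 k) //= big1 ?addr0 => [|i ik].
      by rewrite !mxE eqxx mulr1.
    by rewrite !mxE (inj_eq (@lift_inj _ j)) (negPf ik) mulr0.
  by rewrite x00 x10 row_mx0 sub0mx.
- by rewrite col_mxKu.
Qed.

(** Induction on the dimension: if some vector is not null its orthogonal
    complement is diagonalized, and otherwise the form is zero by polarization. *)
Lemma orthogonal_basis n (G : 'M[R]_n) : G^T = G ->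
  exists2 P : 'M[R]_n, P \in unitmx & is_diag_mx (P *m G *m P^T).
Proof.
elim: n G => [|n IH] G symG.
  by exists 1%:M; [exact: unitmx1|apply/is_diag_mxP => [[]]].
have [[l hl]|hG] := pselect (exists l : 'rV[R]_n.+1, (l *m G *m l^T) 0 0 != 0).
  have [P [uP _ [G' symG' e]]] := orthogonal_step (n := n) symG hl.
  have [P' uP' dP'] := IH _ symG'.
  pose B : 'M[R]_(1 + n) := block_mx 1%:M 0 0 P'.
  have uB : B \in unitmx by rewrite unitmxE det_ublock det1 mul1r -unitmxE.
  exists (B *m P); first by rewrite unitmx_mul uB.
  have -> : B *m P *m G *m (B *m P)^T = B *m (P *m G *m P^T) *m B^T.
    by rewrite trmx_mul !mulmxA.
  rewrite e /B (tr_block_mx 1%:M 0 0 P') !mulmx_block.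
  rewrite ?(mul0mx, mulmx0, trmx0, trmx1, mul1mx, mulmx1, addr0, add0r).
  rewrite -[is_diag_mx _]/(@is_diag_mx _ (1 + n) (1 + n) (block_mx _ _ _ _)).
  by rewrite is_diag_block_mx // !eqxx mx11_is_diag dP'.
exists 1%:M; first exact: unitmx1.
rewrite trmx1 mul1mx mulmx1.
suff -> : G = 0 by apply/is_diag_mxP => i j _; rewrite mxE.
have h (l : 'rV[R]_n.+1) : (l *m G *m l^T) 0 0 = 0.
  by apply/eqP; apply: contra_notT hG => hl; exists l.
apply/matrixP => i j; rewrite mxE.
have eE (a b : 'I_n.+1) : ((delta_mx 0 a : 'rV_n.+1) *m G *m (delta_mx 0 b : 'rV_n.+1)^T) 0 0 = G a b.
  by rewrite trmx_delta -rowE -colE !mxE.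
have := h (delta_mx 0 i + delta_mx 0 j).
rewrite linearD /= !mulmxDl !mulmxDr.
rewrite mxE [X in X + _]mxE [X in _ + X]mxE !eE.
have -> : G i i = 0 by rewrite -eE h.
have -> : G j j = 0 by rewrite -eE h.
have -> : G j i = G i j by rewrite -{1}symG mxE.
by rewrite add0r addr0 -mulr2n => /eqP; rewrite mulrn_eq0 /= => /eqP.
Qed.

End OrthogonalBasis.

Ltac ord4 i := case: i => [[|[|[|[|//]]]] ?].

Section Frames.
Context (R : realFieldType).
Implicit Types (W : 'I_4 -> 'I_4 -> 'I_4 -> 'I_4 -> R).

Definition o0 : 'I_4 := @Ordinal 4 0 isT.
Definition o1 : 'I_4 := @Ordinal 4 1 isT.
Definition o2 : 'I_4 := @Ordinal 4 2 isT.
Definition o3 : 'I_4 := @Ordinal 4 3 isT.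

Lemma sum4 (F : 'I_4 -> R) : \sum_i F i = F o0 + F o1 + F o2 + F o3.
Proof.
rewrite !big_ord_recl big_ord0 addr0 !addrA.
by congr (F _ + F _ + F _ + F _); apply: val_inj.
Qed.

Lemma forall4 (Q : 'I_4 -> Prop) : Q o0 -> Q o1 -> Q o2 -> Q o3 -> forall i, Q i.
Proof.
move=> h0 h1 h2 h3 i; case: i => [[|[|[|[|//]]]] hi].
- by rewrite (_ : Ordinal hi = o0) //; apply: val_inj.
- by rewrite (_ : Ordinal hi = o1) //; apply: val_inj.
- by rewrite (_ : Ordinal hi = o2) //; apply: val_inj.
- by rewrite (_ : Ordinal hi = o3) //; apply: val_inj.
Qed.

Lemma skew_eq0 (F : 'I_4 -> 'I_4 -> R) :
  (forall a b, F b a = - F a b) ->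
  F o0 o1 = 0 -> F o0 o2 = 0 -> F o0 o3 = 0 ->
  F o1 o2 = 0 -> F o1 o3 = 0 -> F o2 o3 = 0 -> forall a b, F a b = 0.
Proof.
move=> s h01 h02 h03 h12 h13 h23.
have d a : F a a = 0 by have := s a a; lra.
have z a b : F a b = 0 -> F b a = 0 by move=> h; rewrite s h oppr0.
apply: forall4; apply: forall4 => //; exact: z.
Qed.

(** An orthogonal frame whose first vector is in the kernel of [W]. Only the
    components with indices 1, 2, 3 remain, and a curvature tensor in dimension
    three is determined by its Ricci contraction, which is zero. *)
Lemma weyl_adapted_eq0 W (q : 'I_4 -> R) :
  (forall i, q i != 0) ->
  (forall a b c d, W b a c d = - W a b c d) ->
  (forall a b c d, W a b d c = - W a b c d) ->
  (forall j k, \sum_i q i * W i j k i = 0) ->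
  (forall j k l, W o0 j k l = 0) -> (forall i j l, W i j o0 l = 0) ->
  forall i j k l, W i j k l = 0.
Proof.
move=> q0 s12 s34 tr0 W0 W0'.
have W0'' i k l : W i o0 k l = 0 by rewrite s12 W0 oppr0.
have W0''' i j k : W i j k o0 = 0 by rewrite s34 W0' oppr0.
have d12 a c d : W a a c d = 0 by have := s12 a a c d; lra.
have d34 a c d : W c d a a = 0 by have := s34 c d a a; lra.
have q0' i x : q i * x = 0 -> x = 0.
  by move=> /eqP; rewrite mulf_eq0 (negPf (q0 i)) => /eqP.
have t j k := tr0 j k.
have e11 := t o1 o1; have e22 := t o2 o2; have e33 := t o3 o3.
have e12 := t o1 o2; have e13 := t o1 o3; have e23 := t o2 o3.
have e21 := t o2 o1; have e31 := t o3 o1; have e32 := t o3 o2.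
move: e11 e22 e33 e12 e13 e23 e21 e31 e32.
rewrite !sum4 !W0 !d12 !d34 !(mulr0, add0r, addr0).
move=> e11 e22 e33 /q0' e12 /q0' e13 /q0' e23 /q0' e21 /q0' e31 /q0' e32.
have flip a b : W b a a b = W a b b a.
  by rewrite (s12 a b) (s34 a b b a) opprK.
rewrite (flip o1 o2) (flip o1 o3) in e11; rewrite (flip o2 o3) in e22.
(* The diagonal trace equations are linear in the components W_ijji; this
   combination isolates W_1221. *)
have z12 : W o1 o2 o2 o1 = 0.
  apply: (q0' o1); apply: (q0' o2).
  have : q o1 * (q o2 * W o1 o2 o2 o1 + q o3 * W o1 o3 o3 o1)
   + q o2 * (q o1 * W o1 o2 o2 o1 + q o3 * W o2 o3 o3 o2)
   - q o3 * (q o1 * W o1 o3 o3 o1 + q o2 * W o2 o3 o3 o2) = 0.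
    by rewrite e11 e22 e33; lra.
  by move=> h; lra.
have z13 : W o1 o3 o3 o1 = 0.
  by apply: (q0' o3); move: e11; rewrite z12 mulr0 add0r.
have z23 : W o2 o3 o3 o2 = 0.
  by apply: (q0' o3); move: e22; rewrite z12 mulr0 add0r.
have zz a b c d : W b a c d = 0 -> W a b c d = 0 by move=> h; rewrite s12 h oppr0.
have zy a b c d : W a b d c = 0 -> W a b c d = 0 by move=> h; rewrite s34 h oppr0.
move=> i j k l; move: k l.
apply: skew_eq0 => [a b||||||]; rewrite ?W0' //; move: i j;
  apply: skew_eq0 => [a b||||||]; rewrite ?W0 //.
all: try by [exact: s12|exact: zy].
all: try by apply: zz.
all: try by apply: zz; apply: zy.
Qed.

End Frames.

(** * Null frames and the commutant of a Weyl tensor of type N *)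

Section NullFrame.
Context (R : realFieldType).

(** Gram matrix of a frame l, n, u, v with l and n null, l.n = 1, and u, v
    orthogonal to each other and to l and n, with squares q2 and q3. *)
Definition null_gram (q2 q3 : R) (i j : 'I_4) : R :=
  match (i : nat), (j : nat) with
  | 0%N, 1%N | 1%N, 0%N => 1
  | 2%N, 2%N => q2
  | 3%N, 3%N => q3
  | _, _ => 0
  end.

Lemma gtr_null_gram q2 q3 B : gtr (null_gram q2 q3) B
  = B o0 o1 + B o1 o0 + q2 * B o2 o2 + q3 * B o3 o3.
Proof. rewrite /gtr !sum4 /null_gram /=; ring. Qed.

Lemma null_gramV q2 q3 : q2 != 0 -> q3 != 0 ->
  mx2 (null_gram q2^-1 q3^-1) *m mx2 (null_gram q2 q3) = 1%:M.
Proof.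
move=> h2 h3; apply/matrixP => i j; rewrite mxE sum4 !mxE; move: i j.
by apply: forall4; apply: forall4; rewrite /null_gram /=; field; rewrite ?h2 ?h3.
Qed.

Lemma det2_eq0 (a b c d x y : R) : a * d - b * c != 0 ->
  a * x + b * y = 0 -> c * x + d * y = 0 -> x = 0 /\ y = 0.
Proof.
move=> h e1 e2; split; apply/eqP; move: h; rewrite -subr_eq0 => h.
  have : (a * d - b * c) * x = 0.
    transitivity (d * (a * x + b * y) - b * (c * x + d * y)); first ring.
    by rewrite e1 e2; ring.
  by move/eqP; rewrite mulf_eq0 -[X in X || _]subr_eq0 (negPf h) /= => ->.
have : (a * d - b * c) * y = 0.
  transitivity (a * (c * x + d * y) - c * (a * x + b * y)); first ring.
  by rewrite e1 e2; ring.
by move/eqP; rewrite mulf_eq0 -[X in X || _]subr_eq0 (negPf h) /= => ->.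
Qed.

(** When the null vector e_0 is in the kernel of [W], the trace conditions leave
    only W_1212 = al, W_1213 = be and W_1313 = ga, with q2 al + q3 ga = 0. As q2
    and q3 are positive, the determinant al ga - be^2 is negative unless [W]
    vanishes, so the commutation relations of [a] with W(e_1, e_2) and
    W(e_1, e_3) are pairs of independent linear equations for the components
    of [a]. *)
Lemma type_N_commutant (W : 'I_4 -> 'I_4 -> 'I_4 -> 'I_4 -> R)
    (a : 'I_4 -> 'I_4 -> R) q2 q3 :
  0 < q2 -> 0 < q3 ->
  (forall a b c d, W b a c d = - W a b c d) ->
  (forall a b c d, W a b d c = - W a b c d) ->
  (forall a b c d, W a b c d = W c d a b) ->
  (forall j k, gtr (null_gram q2 q3) (fun l i => W i j k l) = 0) ->
  (forall j k l, W o0 j k l = 0) -> (forall i j l, W i j o0 l = 0) ->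
  (forall i j, a i j = a j i) ->
  (forall d c i j, ip (null_gram q2 q3) (W d c i) (a j)
     + ip (null_gram q2 q3) (W d c j) (a i) = 0) ->
  (exists i j k l, W i j k l != 0) ->
  [/\ a o0 o0 = 0, a o0 o2 = 0 & a o0 o3 = 0] /\
  [/\ a o1 o2 = 0, a o1 o3 = 0, a o2 o3 = 0,
      q2 * a o2 o2 = a o0 o1 & q3 * a o3 o3 = a o0 o1].
Proof.
move=> h2 h3 s12 s34 pr tr0 W0 W0' aC comm Wn0.
have W1z i k l : W i o0 k l = 0 by rewrite s12 W0 oppr0.
have W3z i j k : W i j k o0 = 0 by rewrite s34 W0' oppr0.
have d12 a' c d : W a' a' c d = 0 by have := s12 a' a' c d; lra.
have d34 a' c d : W c d a' a' = 0 by have := s34 c d a' a'; lra.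
have q20 : q2 != 0 by rewrite gt_eqF.
have q30 : q3 != 0 by rewrite gt_eqF.
have t j k := tr0 j k.
have e11 := t o1 o1; have e22 := t o2 o2.
have e12 := t o1 o2; have e13 := t o1 o3; have e21 := t o2 o1.
have e31 := t o3 o1.
move: e11 e22 e12 e13 e21 e31.
rewrite !gtr_null_gram !W0 !W3z !d12 !d34 !(mulr0, add0r, addr0).
move=> e11 /eqP; rewrite mulf_eq0 (negPf q30) => /eqP e22.
move=> /eqP; rewrite mulf_eq0 (negPf q30) => /eqP e12.
move=> /eqP; rewrite mulf_eq0 (negPf q20) => /eqP e13.
move=> /eqP; rewrite mulf_eq0 (negPf q30) => /eqP e21.
move=> /eqP; rewrite mulf_eq0 (negPf q20) => /eqP e31.
set al := W o1 o2 o1 o2; set be := W o1 o2 o1 o3; set ga := W o1 o3 o1 o3.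
have be' : W o1 o3 o1 o2 = be by rewrite pr.
have {}e11 : q2 * al + q3 * ga = 0.
  move: e11; rewrite (s12 o1 o2) (s12 o1 o3) /al /ga; lra.
have z1223 : W o1 o2 o2 o3 = 0 by rewrite pr e31.
have z1323 : W o1 o3 o2 o3 = 0 by rewrite pr s12 e21 oppr0.
have z2323 : W o2 o3 o2 o3 = 0 by rewrite s12 e22 oppr0.
(* If al = be = 0 then ga = 0 by the trace condition, and W = 0. *)
have abn0 : (al != 0) || (be != 0).
  apply/negP => /negP; rewrite negb_or !negbK => /andP[/eqP al0 /eqP be0].
  have ga0 : ga = 0 by move/eqP: e11; rewrite al0 mulr0 add0r mulf_eq0 (negPf q30) => /eqP.
  case: Wn0 => i [j] [k] [l] /eqP; apply.
  move: k l; apply: skew_eq0 => [x y||||||]; rewrite ?W0' //; move: i j;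
    apply: skew_eq0 => [x y||||||]; rewrite ?W0 //.
  all: rewrite ?be' //.
  all: try by rewrite pr.
  all: try by rewrite ?(s34, oppr0).
have det0 : al * ga - be * be != 0.
  have gaE : ga = - (q2 / q3) * al.
    by apply: (mulfI q30); rewrite mulrA mulrN mulrCA divff // mulr1; lra.
  rewrite gaE lt_eqF // -subr_gt0.
  have -> : 0 - (al * (- (q2 / q3) * al) - be * be) = q2 / q3 * al ^+ 2 + be ^+ 2 by ring.
  have hq : 0 < q2 / q3 by rewrite divr_gt0.
  case/orP: abn0 => h.
    apply: ltr_wpDr; first exact: sqr_ge0.
    by apply: mulr_gt0 => //; rewrite exprn_even_gt0.
  apply: ltr_wpDl; last by rewrite exprn_even_gt0.
  by apply: mulr_ge0; [exact: ltW|exact: sqr_ge0].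
have c2 i j := comm o1 o2 i j; have c3 i j := comm o1 o3 i j.
have w21 : W o1 o2 o2 o1 = - al by rewrite s34.
have w31 : W o1 o2 o3 o1 = - be by rewrite s34.
have v21 : W o1 o3 o2 o1 = - be by rewrite s34 be'.
have v31 : W o1 o3 o3 o1 = - ga by rewrite s34.
have w32 : W o1 o2 o3 o2 = 0 by rewrite s34 z1223 oppr0.
have v32 : W o1 o3 o3 o2 = 0 by rewrite s34 z1323 oppr0.
have simpl1 := (W0', W3z, d34, z1223, z1323, w32, v32, w21, w31, v21, v31, be').
have F2 j : ip (null_gram q2 q3) (W o1 o2 o1) (a j) = q2 * (al * a j o2) + q3 * (be * a j o3).
  by rewrite /ip gtr_null_gram !simpl1 -/al -/be; ring.
have F3 j : ip (null_gram q2 q3) (W o1 o3 o1) (a j) = q2 * (be * a j o2) + q3 * (ga * a j o3).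
  by rewrite /ip gtr_null_gram !simpl1 -/ga; ring.
have G2 j : ip (null_gram q2 q3) (W o1 o2 o2) (a j) = - al * a j o0.
  by rewrite /ip gtr_null_gram !simpl1; ring.
have G3 j : ip (null_gram q2 q3) (W o1 o3 o2) (a j) = - be * a j o0.
  by rewrite /ip gtr_null_gram !simpl1; ring.
have H2 j : ip (null_gram q2 q3) (W o1 o2 o3) (a j) = - be * a j o0.
  by rewrite /ip gtr_null_gram !simpl1; ring.
have H3 j : ip (null_gram q2 q3) (W o1 o3 o3) (a j) = - ga * a j o0.
  by rewrite /ip gtr_null_gram !simpl1; ring.
have I2 j : ip (null_gram q2 q3) (W o1 o2 o0) (a j) = 0.
  by rewrite /ip gtr_null_gram !W0'; ring.
have I3 j : ip (null_gram q2 q3) (W o1 o3 o0) (a j) = 0.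
  by rewrite /ip gtr_null_gram !W0'; ring.
have [x02 x03] : q2 * a o0 o2 = 0 /\ q3 * a o0 o3 = 0.
  apply: (det2_eq0 det0).
    by have := c2 o1 o0; rewrite F2 I2 => <-; ring.
  by have := c3 o1 o0; rewrite F3 I3 => <-; ring.
have a00 : a o0 o0 = 0.
  case/orP: abn0 => h; apply: (mulfI h); rewrite mulr0.
    by have := c2 o2 o0; rewrite G2 I2; lra.
  by have := c2 o3 o0; rewrite H2 I2; lra.
have [x12 x13] : q2 * a o1 o2 = 0 /\ q3 * a o1 o3 = 0.
  apply: (det2_eq0 det0).
    by have := c2 o1 o1; rewrite F2; lra.
  by have := c3 o1 o1; rewrite F3; lra.
have [x22 x23] : q2 * a o2 o2 - a o0 o1 = 0 /\ q3 * a o2 o3 = 0.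
  apply: (det2_eq0 det0).
    by have := c2 o1 o2; rewrite F2 G2 (aC o1 o0) => <-; ring.
  by have := c3 o1 o2; rewrite F3 G3 (aC o1 o0) => <-; ring.
have [x32 x33] : q2 * a o3 o2 = 0 /\ q3 * a o3 o3 - a o0 o1 = 0.
  apply: (det2_eq0 det0).
    by have := c2 o1 o3; rewrite F2 H2 (aC o1 o0) => <-; ring.
  by have := c3 o1 o3; rewrite F3 H3 (aC o1 o0) => <-; ring.
have q2' x : q2 * x = 0 -> x = 0 by move=> /eqP; rewrite mulf_eq0 (negPf q20) => /eqP.
have q3' x : q3 * x = 0 -> x = 0 by move=> /eqP; rewrite mulf_eq0 (negPf q30) => /eqP.
by split; split; auto; apply/eqP; rewrite -subr_eq0; apply/eqP.
Qed.

Local Notation eta :=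
  (diag_mx (\row_(k < 4) if k == 0%N :> nat then -1 else 1) : 'M[R]_4).

Lemma eta_form (u v : 'rV[R]_4) : (u *m eta *m v^T) 0 0 =
  - (u 0 o0 * v 0 o0) + u 0 o1 * v 0 o1 + u 0 o2 * v 0 o2 + u 0 o3 * v 0 o3.
Proof.
rewrite mul_mx_diag mxE sum4 !mxE /=; ring.
Qed.

Definition row4 (a b c d : R) : 'rV[R]_4 :=
  \row_i match (i : nat) with 0%N => a | 1%N => b | 2%N => c | _ => d end.

(** For x = (t, a, b, c) with t^2 = a^2 + b^2 + c^2 take n proportional to
    (-t, a, b, c). The vectors u and v have no time component and complete
    (a, b, c) to an orthogonal basis of the space of the last three coordinates;
    the choice depends on whether (a, b) is zero. *)
Lemma null_frame_exists (x : 'rV[R]_4) : x != 0 -> (x *m eta *m x^T) 0 0 = 0 ->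
  exists (Q : 'M[R]_4) (q2 q3 : R), [/\ 0 < q2, 0 < q3, row o0 Q = x &
    Q *m eta *m Q^T = mx2 (null_gram q2 q3)].
Proof.
move=> xn0; rewrite eta_form.
set t := x 0 o0; set a := x 0 o1; set b := x 0 o2; set c := x 0 o3 => hx.
have xE : x = row4 t a b c.
  by apply/rowP; apply: forall4; rewrite !mxE.
have t0 : t != 0.
  apply: contra_neq xn0 => t0.
  have ha : a = 0 by nra.
  have hb : b = 0 by nra.
  have hc : c = 0 by nra.
  by rewrite xE t0 ha hb hc; apply/rowP; apply: forall4; rewrite !mxE.
have tt : t * t = a * a + b * b + c * c by lra.
suff [u [v [q2 [q3 [h2 h3 hu hv]]]]] : exists (u v : 'rV[R]_4) (q2 q3 : R),
   [/\ 0 < q2, 0 < q3,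
     [/\ u 0 o0 = 0, (u *m eta *m x^T) 0 0 = 0 & (u *m eta *m u^T) 0 0 = q2] &
     [/\ v 0 o0 = 0, (v *m eta *m x^T) 0 0 = 0, (v *m eta *m v^T) 0 0 = q3 &
         (u *m eta *m v^T) 0 0 = 0]].
  pose n := (2 * t ^+ 2)^-1 *: row4 (- t) a b c.
  pose rw (i : 'I_4) := match (i : nat) with 0%N => x | 1%N => n | 2%N => u | _ => v end.
  exists (\matrix_i rw i), q2, q3; split => //; first by rewrite rowK.
  have rE (i j : 'I_4) : ((\matrix_i rw i) *m eta *m (\matrix_i rw i)^T) i j
      = (rw i *m eta *m (rw j)^T) 0 0.
    rewrite !mul_mx_diag !mxE; apply: eq_bigr => k _; rewrite !mxE.
    done.
  case: hu => u0 ux uu; case: hv => v0 vx vv uv.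
  have tt2 : 2 * t ^+ 2 != 0 by rewrite mulf_neq0 // ?pnatr_eq0 // expf_neq0.
  have formC (y z : 'rV[R]_4) : (y *m eta *m z^T) 0 0 = (z *m eta *m y^T) 0 0.
    by rewrite !eta_form; ring.
  have xx : (x *m eta *m x^T) 0 0 = 0 by rewrite eta_form.
  have nform (y : 'rV[R]_4) : (n *m eta *m y^T) 0 0
      = (2 * t ^+ 2)^-1 * (2 * t * y 0 o0 + (y *m eta *m x^T) 0 0).
    by rewrite !eta_form xE !mxE /=; ring.
  have nx : (n *m eta *m x^T) 0 0 = 1.
    by rewrite nform xx -/t addr0 -mulrA -expr2 mulVf.
  have nn : (n *m eta *m n^T) 0 0 = 0.
    rewrite nform nx !mxE /=.
    by field; rewrite t0.
  have nu : (n *m eta *m u^T) 0 0 = 0 by rewrite nform ux u0 mulr0 addr0 mulr0.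
  have nv : (n *m eta *m v^T) 0 0 = 0 by rewrite nform vx v0 mulr0 addr0 mulr0.
  apply/matrixP => i j; rewrite rE [RHS]mxE; move: i j.
  have xn : (x *m eta *m n^T) 0 0 = 1 by rewrite formC.
  have un : (u *m eta *m n^T) 0 0 = 0 by rewrite formC.
  have vn : (v *m eta *m n^T) 0 0 = 0 by rewrite formC.
  have xu : (x *m eta *m u^T) 0 0 = 0 by rewrite formC.
  have xv : (x *m eta *m v^T) 0 0 = 0 by rewrite formC.
  have vu : (v *m eta *m u^T) 0 0 = 0 by rewrite formC.
  apply: forall4; apply: forall4; first
    [exact: xx | exact: xn | exact: xu | exact: xv | exact: nx | exact: nn
    | exact: nu | exact: nv | exact: ux | exact: un | exact: uu | exact: uv
    | exact: vx | exact: vn | exact: vu | exact: vv].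
have [ab0|abn0] := eqVneq (a ^+ 2 + b ^+ 2) 0.
  have ha : a = 0 by nra.
  have hb : b = 0 by nra.
  exists (row4 0 1 0 0), (row4 0 0 1 0), 1, 1.
  by rewrite !eta_form xE !mxE /= ha hb; split => //; split; ring.
exists (row4 0 (- b) a 0), (row4 0 (- (a * c)) (- (b * c)) (a ^+ 2 + b ^+ 2)).
exists (a ^+ 2 + b ^+ 2), ((c ^+ 2 + (a ^+ 2 + b ^+ 2)) * (a ^+ 2 + b ^+ 2)).
have s0 : 0 < a ^+ 2 + b ^+ 2 by rewrite lt_def abn0 addr_ge0 ?sqr_ge0.
rewrite !eta_form xE !mxE /=; split => //; last 2 first.
- by split => //; ring.
- by split => //; ring.
by rewrite mulr_gt0 // ltr_wpDl ?sqr_ge0.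
Qed.

End NullFrame.

(** * The pointwise dichotomy for a Weyl tensor annihilated by a covector *)

Lemma diag_unit_inv (R : fieldType) n (N : 'M[R]_n) :
  is_diag_mx N -> N \in unitmx -> (forall i, N i i != 0) /\
  mx2 (fun i j => if i == j then (N i i)^-1 else 0) *m N = 1%:M.
Proof.
move=> dN uN.
have Nd i j : i != j -> N i j = 0 by move/is_diag_mxP: dN; apply.
have N0 i : N i i != 0.
  apply/eqP => z.
  have : delta_mx 0 i *m N = 0 :> 'rV_n.
    apply/rowP => j; rewrite -rowE !mxE.
    by have [<-//|ij] := eqVneq i j; exact: Nd.
  move/(congr1 (fun M => M *m invmx N)); rewrite mulmxK // mul0mx.
  by move/rowP/(_ i)/eqP; rewrite !mxE !eqxx oner_eq0.
split=> //; apply/matrixP => i j.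
rewrite !mxE (bigD1 i) //= big1 => [|k /negPf ki]; last first.
  by rewrite !mxE eq_sym ki mul0r.
rewrite !mxE eqxx addr0; have [<-|ij] := eqVneq i j; first by rewrite mulVf.
by rewrite (Nd _ _ ij) mulr0.
Qed.

Section PointwiseWeyl.
Context (R : realFieldType) (g gi : 'I_4 -> 'I_4 -> R) (lam : 'I_4 -> R)
  (W : 'I_4 -> 'I_4 -> 'I_4 -> 'I_4 -> R).
Hypothesis gC : forall i j, g i j = g j i.
Hypothesis giC : forall i j, gi i j = gi j i.
Hypothesis GiG : mx2 gi *m mx2 g = 1%:M.
Hypothesis W12 : forall a b c d, W b a c d = - W a b c d.
Hypothesis W34 : forall a b c d, W a b d c = - W a b c d.
Hypothesis Wpair : forall a b c d, W a b c d = W c d a b.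
Hypothesis Wtr : forall c i, gtr gi (fun p d => W d c i p) = 0.
Hypothesis Wlam : forall d c i, ip gi (W d c i) lam = 0.

(** The vector dual to [lam]. *)
Definition sharp : 'rV[R]_4 := \row_a \sum_b gi a b * lam b.

Lemma sharpE : sharp = (mx2 gi *m cv1 lam)^T.
Proof. by apply/rowP => a; rewrite !mxE; apply: eq_bigr => b _; rewrite !mxE. Qed.

Lemma sharp_norm : (sharp *m mx2 g *m sharp^T) 0 0 = ip gi lam lam.
Proof.
have GiT : (mx2 gi)^T = mx2 gi by apply/matrixP => a b; rewrite !mxE giC.
rewrite sharpE trmxK trmx_mul GiT -!mulmxA (mulmxA (mx2 g)) (mulmx1C GiG) mul1mx.
rewrite !mxE /ip /gtr; apply: eq_bigr => k _; rewrite !mxE mulr_sumr.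
by apply: eq_bigr => l _; rewrite !mxE mulrCA mulrA.
Qed.

Lemma pull_sharp (P : 'M[R]_4) X : row o0 P = sharp -> pull P X o0 = ip gi X lam.
Proof.
move=> e; rewrite /pull /ip /gtr; apply: eq_bigr => a _.
have -> : P o0 a = sharp 0 a by rewrite -e mxE.
rewrite mxE mulr_suml; apply: eq_bigr => b _; ring.
Qed.

Section Pulled.
Variable P : 'M[R]_4.
Hypothesis P0 : row o0 P = sharp.
Let WP := pull4 P W.

Lemma WP4 i j k : WP i j k o0 = 0.
Proof.
rewrite /WP /pull4 -[RHS](pull0 P i); apply: eq_pull => a.
rewrite /pull3 -[RHS](pull0 P j); apply: eq_pull => b.
rewrite /pull2 -[RHS](pull0 P k); apply: eq_pull => c.
by rewrite (pull_sharp _ P0).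
Qed.

Lemma WP3 i j l : WP i j o0 l = 0.
Proof. by rewrite /WP pull4_skew34 // -/WP WP4 oppr0. Qed.

Lemma WP1 j k l : WP o0 j k l = 0.
Proof. by rewrite /WP pull4_pair // -/WP WP3. Qed.

End Pulled.

(** The vector dual to [lam] is completed to an orthogonal frame, and
    [weyl_adapted_eq0] applies. *)
Theorem weyl_eq0_of_nonnull : ip gi lam lam != 0 -> forall a b c d, W a b c d = 0.
Proof.
rewrite -sharp_norm => nz.
have symG : (mx2 g)^T = mx2 g by apply/matrixP => i j; rewrite !mxE gC.
have [P1 [uP1 P1l [G' symG' e]]] := orthogonal_step (n := 3) symG nz.
have [P' uP' dP'] := orthogonal_basis symG'.
pose B : 'M[R]_(1 + 3) := block_mx 1%:M 0 0 P'.
pose P : 'M[R]_(1 + 3) := B *m P1.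
have uP : P \in unitmx.
  by rewrite unitmx_mul uP1 andbT unitmxE det_ublock det1 mul1r -unitmxE.
have Pl : row o0 P = sharp.
  rewrite -P1l /P /B -[X in _ *m X]vsubmxK mul_block_col mul1mx mul0mx addr0.
  apply/rowP => k; rewrite mxE.
  have -> : o0 = lshift 3 0 :> 'I_(1 + 3) by apply: val_inj.
  exact: (@col_mxEu R 1 3 4 (usubmx P1)).
pose N := P *m mx2 g *m P^T.
have dN : is_diag_mx N.
  have -> : N = B *m (P1 *m mx2 g *m P1^T) *m B^T by rewrite /N trmx_mul !mulmxA.
  rewrite e /B (tr_block_mx 1%:M 0 0 P') !mulmx_block.
  rewrite ?(mul0mx, mulmx0, trmx0, trmx1, mul1mx, mulmx1, addr0, add0r).
  rewrite -[is_diag_mx _]/(@is_diag_mx _ (1 + 3) (1 + 3) (block_mx _ _ _ _)).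
  by rewrite is_diag_block_mx // !eqxx mx11_is_diag dP'.
have uN : N \in unitmx.
  have uG : mx2 g \in unitmx by case: (mulmx1_unit GiG).
  by rewrite /N (unitmx_mul (P *m mx2 g)) (unitmx_mul P) unitmx_tr uP uG.
have [N0 NiN] := diag_unit_inv dN uN.
set ni := fun i j : 'I_4 => _ in NiN.
apply: (pull4_eq0 uP).
apply: (@weyl_adapted_eq0 _ (pull4 P W) (fun i => (N i i)^-1)) => //.
- by move=> i; rewrite invr_eq0.
- exact: pull4_skew12.
- exact: pull4_skew34.
- move=> j k; rewrite -[RHS](pull4_trace14 GiG uP NiN Wtr j k).
  apply: eq_bigr => i _; rewrite (bigD1 i) //= big1 => [|l /negPf li].
    by rewrite /ni eqxx addr0.
  by rewrite /ni eq_sym li mul0r.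
- exact: WP1.
- exact: WP3.
Qed.

Context (a : 'I_4 -> 'I_4 -> R).
Hypothesis aC : forall i j, a i j = a j i.
Hypothesis aW : forall d c i j, ip gi (W d c i) (a j) + ip gi (W d c j) (a i) = 0.

(** In a null frame starting with the vector dual to [lam], [type_N_commutant]
    leaves of the trace-free part [b] of [a] only the component b_11, and [lam]
    has only the component lam_1. *)
Theorem null_commutant_rank1 (P0 : 'M[R]_4) : P0 \in unitmx ->
  P0 *m mx2 g *m P0^T = diag_mx (\row_(k < 4) if k == 0%N :> nat then -1 else 1) ->
  ip gi lam lam = 0 -> (exists i, lam i != 0) ->
  (exists i j k l, W i j k l != 0) ->
  let b i j := 4%:R * a i j - gtr gi a * g i j in
  forall i j k, b i j * lam k = b k j * lam i.
Proof.
move=> uP0 eP0 null [i0 li0] [w1 [w2 [w3 [w4 wn0]]]] b.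
pose x := sharp *m invmx P0.
have xP0 : x *m P0 = sharp by rewrite mulmxKV.
have lamE i : lam i = (sharp *m mx2 g) 0 i.
  have GT : (mx2 g)^T = mx2 g by apply/matrixP => s t; rewrite !mxE gC.
  have -> : sharp *m mx2 g = (cv1 lam)^T.
    rewrite sharpE -[X in _ *m X]GT -trmx_mul mulmxA (mulmx1C GiG) mul1mx //.
  by rewrite !mxE.
have xn0 : x != 0.
  by apply: contraNneq li0 => x0; rewrite lamE -xP0 x0 !mul0mx mxE.
have xx : (x *m diag_mx (\row_(k < 4) if k == 0%N :> nat then -1 else 1) *m x^T) 0 0 = 0.
  by rewrite -eP0 -null -sharp_norm -xP0 (trmx_mul x P0) !mulmxA.
have [Q [q2 [q3 [h2 h3 Qx QN]]]] := null_frame_exists xn0 xx.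
have q20 : q2 != 0 by rewrite gt_eqF.
have q30 : q3 != 0 by rewrite gt_eqF.
pose P := Q *m P0.
have NE : P *m mx2 g *m P^T = mx2 (null_gram q2 q3).
  by rewrite -QN -eP0 /P trmx_mul !mulmxA.
have NiN : mx2 (null_gram q2^-1 q3^-1) *m (P *m mx2 g *m P^T) = 1%:M.
  by rewrite NE null_gramV.
have uP : P \in unitmx.
  have [_] := mulmx1_unit NiN; by rewrite !unitmx_mul => /andP[/andP[]].
have Pl : row o0 P = sharp by rewrite /P row_mul Qx.
have gP i j : pull2 P g i j = null_gram q2 q3 i j.
  have /matrixP/(_ i j) := NE; rewrite [in X in _ = X]mxE => <-.
  rewrite mxE /pull2 pullC; apply: eq_bigr => l _.
  by rewrite !mxE mulrC; congr (_ * _); apply: eq_bigr => k _; rewrite !mxE.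
have lamP k : pull P lam k = null_gram q2 q3 o0 k.
  rewrite -gP /pull2 pullC /pull; apply: eq_bigr => c _; congr (_ * _).
  rewrite lamE -Pl mxE; apply: eq_bigr => d _; rewrite !mxE.
  by [].
have Wn0 : exists i j k l, pull4 P W i j k l != 0.
  apply: contra_neqP wn0 => h; apply: (pull4_eq0 uP) => i j k l.
  by apply/eqP; apply: contra_notT h => h; exists i, j, k, l.
have aPC i j : pull2 P a i j = pull2 P a j i.
  by rewrite /pull2 pullC; apply: eq_pull => s; apply: eq_pull => t; rewrite aC.
have h2' : 0 < q2^-1 by rewrite invr_gt0.
have h3' : 0 < q3^-1 by rewrite invr_gt0.
have [[z00 z02 z03] [z12 z13 z23 z22 z33]] :=
  type_N_commutant h2' h3' (pull4_skew12 P W12) (pull4_skew34 P W34) (pull4_pair P Wpair)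
    (pull4_trace14 GiG uP NiN Wtr) (WP1 Pl) (WP3 Pl) aPC
    (pull4_commutator GiG uP NiN aW) Wn0.
have tra : gtr gi a = 4%:R * pull2 P a o0 o1.
  rewrite (gtr_frame GiG uP NiN) gtr_null_gram z22 z33 (aPC o1 o0); ring.
have z22' : pull2 P a o2 o2 = q2 * pull2 P a o0 o1 by rewrite -z22 mulVKf.
have z33' : pull2 P a o3 o3 = q3 * pull2 P a o0 o1 by rewrite -z33 mulVKf.
have bE i j : pull2 P b i j = 4%:R * pull2 P a i j
    - 4%:R * pull2 P a o0 o1 * null_gram q2 q3 i j.
  rewrite -gP -tra /pull2 -!pullZ -pullN -pullD; apply: eq_pull => s.
  by rewrite -!pullZ -pullN -pullD; apply: eq_pull => t.
have rank i j k : pull2 P b i j * pull P lam k - pull2 P b k j * pull P lam i = 0.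
  rewrite !bE !lamP; move: i j k.
  apply: forall4; apply: forall4; apply: forall4; rewrite /null_gram /=
   ?(aPC o1 o0) ?(aPC o2 o0) ?(aPC o3 o0) ?(aPC o2 o1) ?(aPC o3 o1) ?(aPC o3 o2)
   ?z00 ?z02 ?z03 ?z12 ?z13 ?z23 ?z22' ?z33'; ring.
move=> i j k; apply/eqP; rewrite -subr_eq0; apply/eqP.
move: i j k; apply: (pull3_eq0 uP) => i j k; rewrite -(rank i j k).
have pB X Y s : pull P (fun x => X x - Y x) s = pull P X s - pull P Y s.
  by rewrite pullD pullN.
transitivity (pull3 P (fun i j k => b i j * lam k) i j k
   - pull3 P (fun i j k => b k j * lam i) i j k).
  rewrite /pull3 -pB; apply: eq_pull => s; rewrite /pull2 -pB.
  by apply: eq_pull => t; rewrite -pB.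
congr (_ - _); rewrite /pull3 /pull2.
  rewrite -pullZr; apply: eq_pull => s; rewrite -pullZr; apply: eq_pull => t.
  by rewrite pullZ.
rewrite -pullZr (eq_pull _ _ (fun s => pullC _ _ _ _)) pullC.
apply: eq_pull => s; rewrite -pullZr pullC; apply: eq_pull => t.
by rewrite pullZ.
Qed.

End PointwiseWeyl.

(** * Symmetric tensors whose associated quadratic map is radial *)

Section ProjectiveTensor.
Context (R : realFieldType) (n : nat) (T : 'I_n -> 'I_n -> 'I_n -> R).
Hypothesis TC : forall p i m, T p i m = T i p m.

Definition quad (v : 'rV[R]_n) k := \sum_a \sum_b T a b k * v 0 a * v 0 b.

Hypothesis radial : forall (v : 'rV[R]_n) j k, v 0 j * quad v k = v 0 k * quad v j.

Lemma quad2 (a b : 'I_n) (t : R) k :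
  quad (\row_i ((a == i)%:R + t * (b == i)%:R)) k
  = T a a k + 2 * t * T a b k + t ^+ 2 * T b b k.
Proof.
have sd (F : 'I_n -> R) c : \sum_x (c == x)%:R * F x = F c.
  rewrite (bigD1 c) //= eqxx mul1r big1 ?addr0 // => x /negPf.
  by rewrite eq_sym => ->; rewrite mul0r.
have s1 (F : 'I_n -> R) : \sum_x ((a == x)%:R + t * (b == x)%:R) * F x = F a + t * F b.
  rewrite -(sd F a) -(sd F b) mulr_sumr -big_split.
  by apply: eq_bigr => x _ /=; ring.
rewrite /quad; transitivity (\sum_x ((a == x)%:R + t * (b == x)%:R)
   * \sum_y ((a == y)%:R + t * (b == y)%:R) * T x y k).
  apply: eq_bigr => x _; rewrite mulr_sumr; apply: eq_bigr => y _; rewrite !mxE; ring.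
by rewrite s1 !s1 (TC b a); ring.
Qed.

Lemma radial_diag a k : a != k -> T a a k = 0.
Proof.
move=> /negPf ak.
have := radial (\row_i ((a == i)%:R + 0 * (a == i)%:R)) a k.
rewrite !quad2 !mxE eqxx ak !expr2 /=; lra.
Qed.

Lemma radial_pair a b t : a != b ->
  2 * t * T a b b + t ^+ 2 * T b b b = t * (T a a a + 2 * t * T a b a).
Proof.
move=> ab; have ba : b != a by rewrite eq_sym.
have := radial (\row_i ((a == i)%:R + t * (b == i)%:R)) a b.
rewrite !quad2 !mxE !eqxx (negPf ab) (negPf ba) (radial_diag ab) (radial_diag ba).
rewrite /= !expr2; lra.
Qed.

(** The vectors e_a + t e_b with t = 1 and t = -1 suffice: they give two equations
    that are linear in the coefficients of t and of t^2. *)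
Theorem radial_tensor p i m :
  T p i m = T i i i / 2 * (p == m)%:R + T p p p / 2 * (i == m)%:R.
Proof.
have [<-|pi] := eqVneq p i.
  have [<-|pm] := eqVneq p m; first by rewrite /=; lra.
  by rewrite radial_diag //=; lra.
have h1 := radial_pair 1 pi; have h2 := radial_pair (-1) pi.
rewrite !expr2 in h1 h2.
have [<-|pm] := eqVneq p m.
  by rewrite eq_sym (negPf pi) /=; lra.
have [<-|im] := eqVneq i m; first by rewrite /=; lra.
have h := radial (\row_x ((p == x)%:R + 1 * (i == x)%:R)) p m.
move: h; rewrite !quad2 !mxE eqxx (negPf pm) (negPf im) eq_sym (negPf pi).
by rewrite (radial_diag pm) (radial_diag im) /= !expr2; lra.
Qed.

End ProjectiveTensor.

(** * Derivatives in epsilon-delta form *)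

Local Open Scope classical_set_scope.

Section EpsilonDelta.
Context {R : realType}.

Lemma continuous_epsP (V W : normedModType R) (f : V -> W) (x : V) :
  {for x, continuous f} <->
  forall e, 0 < e -> exists2 d, 0 < d & forall y, `|y - x| < d -> `|f y - f x| < e.
Proof.
split.
  move=> /cvgrPdist_lt h e e0; have /nbhs_normP [d /= d0 hd] := h e e0.
  by exists d => // y yx; rewrite distrC; apply: hd; rewrite /= distrC.
move=> h; apply/cvgrPdist_lt => e e0; have [d d0 hd] := h e e0.
apply/nbhs_normP; exists d => //= y yx; rewrite distrC; apply: hd.
by rewrite distrC.
Qed.

Lemma is_derive_epsP (f : R -> R) (t l : R) :
  is_derive (t : R) 1 f l <->
  forall e, 0 < e -> exists2 d, 0 < d &
    forall s, `|s - t| < d -> `|f s - f t - (s - t) * l| <= e * `|s - t|.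
Proof.
have E : is_derive (t : R) 1 f l <->
    (fun h => h^-1 *: ((f \o shift t) (h *: (1 : R)) - f t)) @ 0^' --> l.
  split; first by move=> [/cvgP]; rewrite /derive => h <-.
  by move=> h; split; [apply/cvg_ex; exists l|apply: cvg_lim].
rewrite E; split.
  move=> /cvgrPdist_lt h e e0; have := h e e0; rewrite near_withinE.
  move=> /nbhs_normP [d /= d0 hd]; exists d => // s st.
  have [->|sn] := eqVneq s t; first by rewrite !subrr mul0r subr0 normr0 mulr0.
  have st0 : s - t != 0 by rewrite subr_eq0.
  have := hd (s - t); rewrite /= sub0r normrN => /(_ st st0).
  rewrite /= [(s - t)%:A]mulr1 subrK /GRing.scale /= => h1.
  have -> : f s - f t - (s - t) * l = (s - t) * ((s - t)^-1 * (f s - f t) - l).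
    by rewrite mulrBr mulVKf.
  by rewrite normrM mulrC ler_wpM2r // distrC ltW.
move=> h; apply/cvgrPdist_lt => e e0; have [|d d0 hd] := h (e / 2).
  by rewrite divr_gt0.
rewrite near_withinE; apply/nbhs_normP; exists d => //= s.
rewrite /= sub0r normrN => sd s0.
have := hd (s + t); rewrite addrK => /(_ sd); rewrite [s%:A]mulr1 => h1.
rewrite /GRing.scale /= distrC.
have -> : s^-1 * (f (s + t) - f t) - l = s^-1 * (f (s + t) - f t - s * l).
  by rewrite [RHS]mulrBr mulKf.
rewrite normrM normfV mulrC ltr_pdivrMr ?normr_gt0 //.
apply: le_lt_trans h1 _; rewrite ltr_pM2r ?normr_gt0 //; lra.
Qed.

(** A directional derivative is an ordinary derivative along a line. *)
Lemma is_derive_line (V : normedModType R) (F : V -> R) (x v : V) (l : R) :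
  is_derive x v F l <-> is_derive (0 : R) 1 (fun h : R => F (h *: v + x)) l.
Proof.
pose L := fun h : R => F (h *: v + x).
have e : (fun h : R => h^-1 *: ((F \o shift x) (h *: v) - F x))
   = (fun h : R => h^-1 *: ((L \o shift 0) (h *: (1 : R)) - L 0)).
  apply/funext => h /=.
  by rewrite /L addr0 scale0r add0r [h%:A]mulr1.
have e1 : derivable F x v = derivable L 0 1.
  by exact: (congr1 (fun u : R -> R => cvg (u @ (0 : R)^')) e).
have e2 : 'D_v F x = 'D_1 L 0.
  by exact: (congr1 (fun u : R -> R => lim (u @ (0 : R)^')) e).
by split => -[]; rewrite ?e1 ?e2 => h1 h2; split; rewrite ?e1 ?e2.
Qed.

Lemma is_derive_line_at (V : normedModType R) (F : V -> R) (x v : V) (s l : R) :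
  is_derive (s *: v + x) v F l <-> is_derive s 1 (fun h : R => F (h *: v + x)) l.
Proof.
rewrite is_derive_line !is_derive_epsP; split => h e e0; have [d d0 hd] := h e e0;
  exists d => // r rs.
  have := hd (r - s); rewrite subr0 !scale0r !add0r scalerBl => /(_ rs).
  by rewrite addrA subrK.
rewrite subr0 in rs *.
have := hd (r + s); rewrite addrK => /(_ rs).
by rewrite scalerDl scale0r add0r -(addrA (r *: v)).
Qed.

Lemma is_derive_continuous (f : R -> R) (t l : R) :
  is_derive (t : R) 1 f l -> {for t, continuous f}.
Proof. by case=> df _; apply: differentiable_continuous; apply/derivable1_diffP. Qed.

(** Caratheodory's form of differentiability, which turns the chain rule into a
    statement on continuous functions. *)
Lemma caratheodory_is_derive (f phi : R -> R) (t d : R) : 0 < d ->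
  {for t, continuous phi} -> (forall s, `|s - t| < d -> f s - f t = (s - t) * phi s) ->
  is_derive (t : R) 1 f (phi t).
Proof.
move=> d0 /continuous_epsP cphi hf; apply/is_derive_epsP => e e0.
have [d' d'0 hd'] := cphi e e0.
exists (Num.min d d'); first by rewrite lt_min d0.
move=> s; rewrite lt_min => /andP[sd sd'].
by rewrite hf // -mulrBr normrM mulrC ler_wpM2r // ltW // hd'.
Qed.

Lemma is_derive_caratheodory (f : R -> R) (t l : R) : is_derive (t : R) 1 f l ->
  exists phi, [/\ {for t, continuous phi}, phi t = l &
    forall s, f s - f t = (s - t) * phi s].
Proof.
move=> /is_derive_epsP df.
pose phi s := if s == t then l else (f s - f t) / (s - t).
have phit : phi t = l by rewrite /phi eqxx.
have phiE s : f s - f t = (s - t) * phi s.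
  rewrite /phi; have [->|st] := eqVneq s t; first by rewrite !subrr mul0r.
  by rewrite mulrC divfK // subr_eq0.
exists phi; split => //; apply/continuous_epsP => e e0.
have [|d d0 hd] := df (e / 2); first by rewrite divr_gt0.
exists d => // s sd; rewrite phit.
have [->|st] := eqVneq s t; first by rewrite phit subrr normr0.
have := hd s sd; rewrite phiE -mulrBr normrM mulrC ler_pM2r ?normr_gt0 ?subr_eq0 //.
move=> h; apply: le_lt_trans h _; lra.
Qed.

(** The bound by the absolute value of [s] covers both orientations of the segment. *)
Lemma MVT_line (V : normedModType R) (F : V -> R) (DF : V -> R) (x v : V) (s : R) :
  (forall t, `|t| <= `|s| -> is_derive (t *: v + x) v F (DF (t *: v + x))) ->
  exists2 t, `|t| <= `|s| & F (s *: v + x) - F x = s * DF (t *: v + x).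
Proof.
move=> h; pose f (t : R) := F (t *: v + x).
have df t : `|t| <= `|s| -> is_derive (t : R) 1 f (DF (t *: v + x)).
  by move=> ts; apply (is_derive_line_at F x v t (DF (t *: v + x))); apply h.
have cf (a b : R) : (forall t, t \in `[a, b]%R -> `|t| <= `|s|) ->
    {within `[a, b], continuous f}.
  move=> hab; apply: continuous_in_subspaceT => t; rewrite inE /= => tab.
  exact: is_derive_continuous (df t (hab t tab)).
have [s0|s0] := leP 0 s.
  have hs t : t \in `[0, s]%R -> `|t| <= `|s|.
    by rewrite in_itv /= => /andP[t0 ts]; rewrite !ger0_norm.
  have h1 t : t \in `]0, s[%R -> is_derive t 1 f (DF (t *: v + x)).
    by move=> ts; apply: df; apply: hs; apply: subset_itv_oo_cc ts.
  have [c cs e] := MVT_segment s0 h1 (cf 0 s hs).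
  exists c; first exact: hs.
  by move: e; rewrite /f scale0r add0r subr0 => ->; rewrite mulrC.
have hs t : t \in `[s, 0]%R -> `|t| <= `|s|.
  by rewrite in_itv /= => /andP[st t0]; rewrite !ler0_norm // ?lerN2 // ltW.
have h1 t : t \in `]s, 0[%R -> is_derive t 1 f (DF (t *: v + x)).
  by move=> ts; apply: df; apply: hs; apply: subset_itv_oo_cc ts.
have [c cs e] := MVT_segment (ltW s0) h1 (cf s 0 hs).
exists c; first exact: hs.
move: e; rewrite /f scale0r add0r sub0r => e.
by rewrite -opprB e mulrN opprK mulrC.
Qed.

End EpsilonDelta.

(** * The chain rule and the symmetry of second derivatives *)

Section Hadamard.
Context {R : realType}.

Local Notation e_ a := (delta_mx 0 a : 'rV[R]_ _).

Lemma rV_norm_le n (y : 'rV[R]_n) d : 0 <= d -> (forall a, `|y 0 a| <= d) -> `|y| <= d.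
Proof.
move=> d0 h; rewrite /Num.norm /= mx_normrE; apply/bigmax_leP; split => // -[i j] _ /=.
by rewrite ord1; exact: h.
Qed.

Lemma rV_coord_le n (y : 'rV[R]_n) a : `|y 0 a| <= `|y|.
Proof.
rewrite [leRHS]/Num.norm /= mx_normrE; apply/bigmax_geP; right => /=.
by exists (0, a).
Qed.

Lemma rV_norm_lt n (y : 'rV[R]_n) d : 0 < d -> (forall a, `|y 0 a| < d) -> `|y| < d.
Proof.
move=> d0 h; rewrite /Num.norm /= mx_normrE; apply/bigmax_ltP; split => // -[i j] _ /=.
by rewrite ord1; exact: h.
Qed.

Lemma norm_delta_le n (k : R) (a : 'I_n) : `|k *: e_ a| <= `|k|.
Proof.
apply: rV_norm_le => // i; rewrite !mxE eqxx /=.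
by case: (i == a); rewrite ?mulr1 ?mulr0 ?normr0.
Qed.

(** Near [x] only the existence of the partial derivatives is required; their
    continuity is needed at [x] alone. *)
Definition C1_at n (F : 'rV[R]_n -> R) (x : 'rV[R]_n) :=
  (exists2 d, 0 < d & forall y, `|y - x| < d -> forall a, derivable F y (delta_mx 0 a))
  /\ forall a, {for x, continuous (partial a F)}.

(** The increment is split into steps parallel to the axes; the mean value theorem
    on each step gives the value of a partial derivative at some point [q] which
    is not further from [x] than [y]. *)
Lemma hadamard n (F : 'rV[R]_n -> R) x : C1_at F x ->
  exists G : 'I_n -> 'rV[R]_n -> R, exists2 d, 0 < d &
  (forall a, {for x, continuous (G a)} /\ G a x = partial a F x) /\
  forall y, `|y - x| < d -> F y - F x = \sum_a (y 0 a - x 0 a) * G a y.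
Proof.
move=> [[d d0 dF] cF].
(* p k y has the first k coordinates of y and the others of x *)
pose p (k : nat) (y : 'rV[R]_n) := \row_i (if (i < k)%N then y 0 i else x 0 i).
have pS (a : 'I_n) y : p a.+1 y = (y 0 a - x 0 a) *: delta_mx 0 a + p a y.
  apply/rowP => i; rewrite !mxE eqxx /= ltnS.
  have [->|ia] := eqVneq i a; first by rewrite leqnn ltnn mulr1 subrK.
  rewrite mulr0 add0r leq_eqVlt.
  by have /negPf -> : (i != a :> nat) by [].
have q_ex (ay : 'I_n * 'rV[R]_n) : exists q : 'rV[R]_n, `|q - x| <= `|ay.2 - x| /\
    (`|ay.2 - x| < d -> F (p ay.1.+1 ay.2) - F (p ay.1 ay.2)
       = (ay.2 0 ay.1 - x 0 ay.1) * partial ay.1 F q).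
  case: ay => a y /=.
  have near_x t : `|t| <= `|y 0 a - x 0 a| ->
      `|t *: delta_mx 0 a + p a y - x| <= `|y - x|.
    move=> ht; apply: rV_norm_le => // i; rewrite !mxE eqxx /=.
    have yx j : `|y 0 j - x 0 j| <= `|y - x|.
      by have := rV_coord_le (y - x) j; rewrite !mxE.
    have [->|ia] := eqVneq i a.
      by rewrite ltnn mulr1 addrK; apply: le_trans ht (yx a).
    rewrite mulr0 add0r; case: ifP => _; first exact: yx.
    by rewrite subrr normr0.
  have [yd|yd] := ltP `|y - x| d; last first.
    by exists x; rewrite subrr normr0; split => //; rewrite ltNge yd.
  have dl t : `|t| <= `|y 0 a - x 0 a| -> is_derive (t *: delta_mx 0 a + p a y)
      (delta_mx 0 a) F (partial a F (t *: delta_mx 0 a + p a y)).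
    move=> ht; apply: derivableP; apply: dF.
    exact: le_lt_trans (near_x t ht) yd.
  have [t ts e] := MVT_line dl.
  exists (t *: delta_mx 0 a + p a y); split; first exact: near_x.
  by move=> _; rewrite pS.
have [q hq] := choice q_ex.
exists (fun a y => partial a F (q (a, y))), d => //; split; last first.
  move=> y yd.
  transitivity (\sum_(a < n) (F (p a.+1 y) - F (p a y))).
    rewrite -(big_mkord xpredT (fun a => F (p a.+1 y) - F (p a y))) telescope_sumr //.
    congr (F _ - F _); apply/rowP => i; rewrite mxE ?ltn_ord //.
  apply: eq_bigr => a _; exact: (hq (a, y)).2.
move=> a.
have qx : q (a, x) = x.
  have := (hq (a, x)).1; rewrite /= subrr normr0 => h.
  by apply/eqP; rewrite -subr_eq0 -normr_le0.
split; last by rewrite qx.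
apply/continuous_epsP => e e0; have /continuous_epsP/(_ e e0) [d' d'0 hd'] := cF a.
exists d' => // y yd; rewrite qx; apply: hd'.
exact: le_lt_trans (hq (a, y)).1 yd.
Qed.

Lemma eq_continuous_at (V W : normedModType R) (f g : V -> W) x :
  (forall y, f y = g y) -> {for x, continuous f} -> {for x, continuous g}.
Proof. by move=> /funext ->. Qed.

Lemma continuous_cst_at (V W : normedModType R) (c : W) (x : V) :
  {for x, continuous (fun=> c)}.
Proof. by apply/continuous_epsP => e e0; exists 1 => // y _; rewrite subrr normr0. Qed.

Lemma continuousD_at (V W : normedModType R) (f g : V -> W) (x : V) :
  {for x, continuous f} -> {for x, continuous g} ->
  {for x, continuous (fun y => f y + g y)}.
Proof. exact: continuousD. Qed.

Lemma continuousM_at (V : normedModType R) (f g : V -> R) (x : V) :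
  {for x, continuous f} -> {for x, continuous g} ->
  {for x, continuous (fun y => f y * g y)}.
Proof. exact: continuousM. Qed.

Lemma continuous_sum_at (V : normedModType R) (I : finType) (f : I -> V -> R) (x : V) :
  (forall i, {for x, continuous (f i)}) ->
  {for x, continuous (fun y => \sum_i f i y)}.
Proof.
move=> h.
suff H (s : seq I) : {for x, continuous (fun y => \sum_(i <- s) f i y)} by exact: H.
elim: s => [|i s IH].
  by apply: (eq_continuous_at (f := cst 0)); [move=> y; rewrite big_nil|exact: continuous_cst_at].
apply: (eq_continuous_at (f := fun y => f i y + \sum_(j <- s) f j y)).
  by move=> y; rewrite big_cons.
by apply: continuousD; [exact: h|exact: IH].
Qed.

Lemma chain_curve n (F : 'rV[R]_n -> R) (c : R -> 'rV[R]_n) (t : R) (dc : 'I_n -> R) :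
  C1_at F (c t) -> (forall a, is_derive t 1 (fun s => c s 0 a) (dc a)) ->
  is_derive t 1 (F \o c) (\sum_a dc a * partial a F (c t)).
Proof.
move=> /hadamard [G [d d0 [hG hF]]] hc.
have [phi hphi] := choice (fun a => is_derive_caratheodory (hc a)).
have cc : {for t, continuous c}.
  apply/continuous_epsP => e e0.
  have h a : exists d', 0 < d' /\ forall s, `|s - t| < d' -> `|c s 0 a - c t 0 a| < e.
    have /continuous_epsP/(_ e e0) [d' d'0 hd'] := is_derive_continuous (hc a).
    by exists d'.
  have [D hD] := choice h.
  exists (\big[Num.min/1]_a D a).
    by apply/bigmin_gtP; split => // a _; exact: (hD a).1.
  move=> s /bigmin_gtP [_ hs]; apply: rV_norm_lt => // a.
  by rewrite !mxE; apply: (hD a).2; exact: hs.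
have -> : \sum_a dc a * partial a F (c t) = \sum_a phi a t * G a (c t).
  by apply: eq_bigr => a _; have [_ -> _] := hphi a; rewrite (hG a).2.
have /continuous_epsP/(_ d d0) [d' d'0 hd'] := cc.
apply: (@caratheodory_is_derive _ _ (fun s => \sum_a phi a s * G a (c s)) t d') => //.
  apply: (@continuous_sum_at R^o) => a; apply: continuousM_at.
    by have [h _ _] := hphi a; exact: h.
  by apply: (@continuous_comp _ _ _ c (G a)) => //; exact: (hG a).1.
move=> s sd; rewrite /= hF ?mulr_sumr; last exact: hd'.
by apply: eq_bigr => a _; have [_ _ ->] := hphi a; rewrite mulrA.
Qed.

Lemma chain_partial m n (F : 'rV[R]_n -> R) (tau : 'rV[R]_m -> 'rV[R]_n) x a
    (dt : 'I_n -> R) :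
  C1_at F (tau x) -> (forall b, is_derive x (delta_mx 0 a) (fun y => tau y 0 b) (dt b)) ->
  is_derive x (delta_mx 0 a) (F \o tau) (\sum_b dt b * partial b F (tau x)).
Proof.
move=> hF ht; apply is_derive_line.
have e : tau (0 *: delta_mx 0 a + x) = tau x by rewrite scale0r add0r.
rewrite -e; apply: (@chain_curve _ F (fun h => tau (h *: delta_mx 0 a + x))).
  by rewrite e.
by move=> b; apply (is_derive_line (fun y => tau y 0 b)); exact: ht.
Qed.

Lemma dist_le_mid (A B C e : R) :
  `|C - A| < e / 2 -> `|C - B| < e / 2 -> `|A - B| <= e.
Proof. have := ler_distD C A B; rewrite (distrC A C); lra. Qed.

Lemma sub_sub_swap (X Y Z T : R) : X - Y - (Z - T) = X - Z - (Y - T).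
Proof. ring. Qed.

(** The second difference of [f] on a small square, computed by two applications
    of the mean value theorem, is s^2 times either mixed derivative at a nearby
    point. *)
Lemma schwarz n (f : 'rV[R]_n -> R) (x : 'rV[R]_n) (a b : 'I_n) d : 0 < d ->
  (forall y, `|y - x| < d -> [/\ derivable f y (delta_mx 0 a),
     derivable f y (delta_mx 0 b), derivable (partial a f) y (delta_mx 0 b) &
     derivable (partial b f) y (delta_mx 0 a)]) ->
  {for x, continuous (partial b (partial a f))} ->
  {for x, continuous (partial a (partial b f))} ->
  partial b (partial a f) x = partial a (partial b f) x.
Proof.
move=> d0 df c1 c2.
have key (a' b' : 'I_n) s : 0 < s -> 2 * s < d ->
   (forall y, `|y - x| < d -> [/\ derivable f y (delta_mx 0 a'),
     derivable (partial a' f) y (delta_mx 0 b') & True]) ->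
   exists2 q, `|q - x| <= 2 * s &
   f (s *: delta_mx 0 b' + (s *: delta_mx 0 a' + x)) - f (s *: delta_mx 0 a' + x)
   - (f (s *: delta_mx 0 b' + x) - f x) = s * (s * partial b' (partial a' f) q).
  move=> s0 sd h.
  have nn (t t' : R) : `|t| <= s -> `|t'| <= s ->
      `|t *: (delta_mx 0 b' : 'rV[R]_n) + (t' *: delta_mx 0 a' + x) - x| <= 2 * s.
    move=> ht ht'; rewrite addrA addrK; apply: le_trans (ler_normD _ _) _.
    have := norm_delta_le t b'; have := norm_delta_le t' a'; lra.
  have ns : `|s| = s by rewrite ger0_norm // ltW.
  pose H (y : 'rV[R]_n) := f (s *: delta_mx 0 b' + y) - f y.
  pose DH (y : 'rV[R]_n) := partial a' f (s *: delta_mx 0 b' + y) - partial a' f y.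
  have n0 t : `|t| <= s -> `|t *: (delta_mx 0 a' : 'rV[R]_n) + x - x| <= 2 * s.
    move=> ht; have := nn 0 t; rewrite scale0r add0r; apply => //.
    by rewrite normr0 ltW.
  have dH t : `|t| <= `|s| -> is_derive (t *: delta_mx 0 a' + x) (delta_mx 0 a') H
      (DH (t *: delta_mx 0 a' + x)).
    rewrite ns => ht; apply: is_deriveB.
      have [h1 _ _] := h _ (le_lt_trans (nn s t (eq_ind _ (fun z => z <= s) (lexx s) _ (esym ns)) ht) sd).
      have h2 := derivableP h1; apply is_derive_line.
      have := (is_derive_line _ _ _ _).1 h2.
      congr is_derive; apply/funext => r; congr f.
      by rewrite addrCA.
    have [h1 _ _] := h _ (le_lt_trans (n0 t ht) sd).
    exact: derivableP.
  have [t ht e] := MVT_line dH.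
  rewrite ns in ht.
  have dP t' : `|t'| <= `|s| -> is_derive (t' *: delta_mx 0 b' + (t *: delta_mx 0 a' + x))
      (delta_mx 0 b') (partial a' f)
      (partial b' (partial a' f) (t' *: delta_mx 0 b' + (t *: delta_mx 0 a' + x))).
    rewrite ns => ht'; apply: derivableP.
    by have [_ h1 _] := h _ (le_lt_trans (nn t' t ht' ht) sd).
  have [t' ht' e'] := MVT_line dP.
  rewrite ns in ht'.
  exists (t' *: delta_mx 0 b' + (t *: delta_mx 0 a' + x)); first exact: nn.
  by rewrite -e' -e.
apply/eqP; rewrite -subr_eq0 -normr_le0; apply/ler_addgt0Pl => e e0; rewrite addr0.
have e2 : 0 < e / 2 by rewrite divr_gt0.
have /continuous_epsP/(_ _ e2) [d1 d10 h1] := c1.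
have /continuous_epsP/(_ _ e2) [d2 d20 h2] := c2.
pose s := Num.min d (Num.min d1 d2) / 4.
have m0 : 0 < Num.min d (Num.min d1 d2) by rewrite !lt_min d0 d10.
have s0 : 0 < s by rewrite divr_gt0.
have sm : 2 * s < Num.min d (Num.min d1 d2) by rewrite /s; lra.
have [sd sd1 sd2] : [/\ 2 * s < d, 2 * s < d1 & 2 * s < d2].
  by move: sm; rewrite !lt_min => /andP[-> /andP[-> ->]].
have [q hq eq] := key a b s s0 sd (fun y hy => let: And4 A _ C _ := df y hy in And3 A C I).
have [q' hq' eq'] := key b a s s0 sd (fun y hy => let: And4 _ B _ D := df y hy in And3 B D I).
have E : partial b (partial a f) q = partial a (partial b f) q'.
  have sn : s != 0 by rewrite gt_eqF.
  apply: (fun h => mulfI sn (mulfI sn h)).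
  have e3 : f (s *: delta_mx 0 b + (s *: delta_mx 0 a + x))
     = f (s *: delta_mx 0 a + (s *: delta_mx 0 b + x)) by rewrite addrCA.
  apply: etrans (esym eq) (etrans _ eq'); rewrite e3.
  exact: sub_sub_swap.
have := h1 q (le_lt_trans hq sd1); have := h2 q' (le_lt_trans hq' sd2).
by rewrite E => k1 k2; exact: dist_le_mid k2 k1.
Qed.

End Hadamard.

(** * Smooth functions on an open set *)

Lemma norm_ball_open {R : realType} (V : normedModType R) (x0 : V) r :
  open [set y | `|y - x0| < r].
Proof.
rewrite openE => y yr; apply/nbhs_normP; exists (r - `|y - x0|) => /=; first by rewrite subr_gt0.
move=> z /= yz; have := ler_distD y z x0; rewrite (distrC z y) => h.
by apply: le_lt_trans h _; rewrite -ltrBrDr.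
Qed.

Section SmoothClosure.
Context {R : realType} {n : nat}.
Implicit Types (U : set 'rV[R]_n) (f g : 'rV[R]_n -> R).

Lemma open_ball U x : open U -> U x ->
  exists2 d, 0 < d & forall y, `|y - x| < d -> U y.
Proof.
move=> oU Ux; have /nbhs_normP [d /= d0 hd] : nbhs x U by exact: open_nbhs_nbhs.
by exists d => // y yx; apply: hd; rewrite /= distrC.
Qed.

Lemma near_eq_open U f g x : open U -> U x -> (forall y, U y -> f y = g y) ->
  \near x, f x = g x.
Proof. by move=> oU Ux h; apply: filterS (open_nbhs_nbhs (conj oU Ux)) => y /h. Qed.

Lemma eq_partial U f g a x : open U -> U x -> (forall y, U y -> f y = g y) ->
  partial a f x = partial a g x.
Proof. by move=> oU Ux h; apply: near_eq_derive; exact: near_eq_open h. Qed.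

Lemma eq_partials U f g s x : open U -> U x -> (forall y, U y -> f y = g y) ->
  partials s f x = partials s g x.
Proof.
by move=> oU Ux h; elim: s x Ux => [|a s IH] x Ux /=; [exact: h|exact: eq_partial IH].
Qed.

Lemma eq_continuous_open U f g x : open U -> U x -> (forall y, U y -> f y = g y) ->
  {for x, continuous f} -> {for x, continuous g}.
Proof.
move=> oU Ux h /continuous_epsP cf; apply/continuous_epsP => e e0.
have [d d0 hd] := cf e e0; have [d' d'0 hd'] := open_ball oU Ux.
exists (Num.min d d'); first by rewrite lt_min d0.
by move=> y; rewrite lt_min => /andP[yd yd']; rewrite -!h //; [exact: hd|exact: hd'].
Qed.

Lemma smooth_on_ext U f g : open U -> (forall y, U y -> f y = g y) ->
  smooth_on U f -> smooth_on U g.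
Proof.
move=> oU h sf s x Ux; have [c d] := sf s x Ux.
have h' y : U y -> partials s f y = partials s g y.
  by move=> Uy; exact: eq_partials h.
split; first exact: eq_continuous_open h' c.
by move=> a; apply: near_eq_derivable (d a); exact: near_eq_open h'.
Qed.

Lemma partials_rcons s a f : partials (rcons s a) f = partials s (partial a f).
Proof. by elim: s => //= b s ->. Qed.

Lemma smooth_on_partial U f a : smooth_on U f -> smooth_on U (partial a f).
Proof. by move=> sf s x Ux; rewrite -partials_rcons; exact: sf. Qed.

Lemma smooth_on_sub U V f : V `<=` U -> smooth_on U f -> smooth_on V f.
Proof. by move=> VU sf s x Vx; apply: sf; exact: VU. Qed.

Lemma smooth_on_continuous U f x : smooth_on U f -> U x -> {for x, continuous f}.
Proof. by move=> sf Ux; have [] := sf [::] x Ux. Qed.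

Lemma smooth_on_derivable U f x a : smooth_on U f -> U x -> derivable f x (delta_mx 0 a).
Proof. by move=> sf Ux; have [_] := sf [::] x Ux; exact. Qed.

Lemma smooth_on_is_derive U f x a : smooth_on U f -> U x ->
  is_derive x (delta_mx 0 a) f (partial a f x).
Proof. by move=> sf Ux; apply: derivableP; exact: smooth_on_derivable sf Ux. Qed.

Lemma smooth_on_C1 U f x : open U -> smooth_on U f -> U x -> C1_at f x.
Proof.
move=> oU sf Ux; have [d d0 hd] := open_ball oU Ux; split.
  by exists d => // y yd a; apply: smooth_on_derivable sf _; exact: hd.
by move=> a; apply: smooth_on_continuous (smooth_on_partial a sf) Ux.
Qed.

Lemma partialC U f a b x : open U -> smooth_on U f -> U x ->
  partial a (partial b f) x = partial b (partial a f) x.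
Proof.
move=> oU sf Ux; have [d d0 hd] := open_ball oU Ux.
apply: (schwarz d0).
- move=> y yd; have Uy := hd y yd.
  have d1 c : derivable f y (delta_mx 0 c) by exact: smooth_on_derivable sf Uy.
  have d2 c e : derivable (partial e f) y (delta_mx 0 c).
    by exact: smooth_on_derivable (smooth_on_partial e sf) Uy.
  by split; [exact: d1|exact: d1|exact: d2|exact: d2].
- exact: smooth_on_continuous (smooth_on_partial _ (smooth_on_partial _ sf)) Ux.
- exact: smooth_on_continuous (smooth_on_partial _ (smooth_on_partial _ sf)) Ux.
Qed.

(** A class of continuous functions that is closed under partial derivatives,
    up to equality on [U], consists of smooth functions. *)
Lemma smooth_on_coind U (P : ('rV[R]_n -> R) -> Prop) : open U ->
  (forall f, P f -> forall x, U x -> {for x, continuous f}) ->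
  (forall f, P f -> forall a, exists2 g, P g &
     forall x, U x -> is_derive x (delta_mx 0 a) f (g x)) ->
  forall f, P f -> smooth_on U f.
Proof.
move=> oU Pc Pd f Pf s; elim/last_ind: s f Pf => [|s a IH] f Pf x Ux.
  split; first exact: Pc.
  by move=> a; have [g _ h] := Pd f Pf a; have [] := h x Ux.
rewrite partials_rcons; have [g Pg h] := Pd f Pf a.
have h' y : U y -> g y = partial a f y by move=> /h [_ <-].
have [c d] := IH g Pg x Ux.
have h'' y : U y -> partials s g y = partials s (partial a f) y.
  by move=> Uy; exact: eq_partials h'.
split; first exact: eq_continuous_open h'' c.
by move=> b; apply: near_eq_derivable (d b); exact: near_eq_open h''.
Qed.

(** Closure of the smooth functions under the operations used below. As an
    inductive predicate it is closed under derivatives, hence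
    [smooth_on_coind] applies to all operations at once. *)
Inductive smooth_expr U : ('rV[R]_n -> R) -> Prop :=
| SmoothAtom f : smooth_on U f -> smooth_expr U f
| SmoothCst c : smooth_expr U (fun=> c)
| SmoothAdd f g : smooth_expr U f -> smooth_expr U g ->
    smooth_expr U (fun x => f x + g x)
| SmoothMul f g : smooth_expr U f -> smooth_expr U g ->
    smooth_expr U (fun x => f x * g x)
| SmoothInv f : smooth_expr U f -> (forall x, U x -> f x != 0) ->
    smooth_expr U (fun x => (f x)^-1)
| SmoothExp f : smooth_expr U f -> smooth_expr U (fun x => expR (f x))
| SmoothLn f : smooth_expr U f -> (forall x, U x -> 0 < f x) ->
    smooth_expr U (fun x => ln (f x)).

Lemma is_derive_comp_outer (V : normedModType R) (h : R -> R) (f : V -> R)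
    (x v : V) (l m : R) :
  is_derive (f x) 1 h m -> is_derive x v f l ->
  is_derive x v (fun y => h (f y)) (m * l).
Proof.
move=> dh df; apply (is_derive_line (fun y => h (f y))).
have df' := (is_derive_line f x v l).1 df.
apply: (@is_derive1_comp _ h (fun s => f (s *: v + x))) => //.
by rewrite scale0r add0r.
Qed.

Lemma smooth_expr_derive U : open U -> forall f, smooth_expr U f ->
  forall a, exists2 g, smooth_expr U g &
     forall x, U x -> is_derive x (delta_mx 0 a) f (g x).
Proof.
move=> oU f ef a; elim: ef => {f}.
- move=> f sf; exists (partial a f); first exact/SmoothAtom/smooth_on_partial.
  by move=> x; exact: smooth_on_is_derive.
- move=> c; exists (fun=> 0); first exact: SmoothCst.
  by move=> x _; exact: is_derive_cst.
- move=> f g ef [f' ef' hf] eg [g' eg' hg]; exists (fun x => f' x + g' x).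
    exact: SmoothAdd.
  by move=> x Ux; apply: is_deriveD; [exact: hf|exact: hg].
- move=> f g ef [f' ef' hf] eg [g' eg' hg].
  exists (fun x => f x * g' x + g x * f' x).
    by apply: SmoothAdd; exact: SmoothMul.
  by move=> x Ux; apply: is_deriveM; [exact: hf|exact: hg].
- move=> f ef [f' ef' hf] nf; exists (fun x => -1 * ((f x)^-1 * (f x)^-1) * f' x).
    apply: SmoothMul => //; apply: SmoothMul; first exact: SmoothCst.
    by apply: SmoothMul; exact: SmoothInv.
  move=> x Ux; have := hf x Ux; apply: (@is_derive_comp_outer _ (fun y : R => y^-1)).
  have fx := nf x Ux.
  split; first exact: (@derivableV _ _ id).
  rewrite (@deriveV _ _ id) //= derive_id /GRing.scale /=; field.
  by [].
- move=> f ef [f' ef' hf]; exists (fun x => expR (f x) * f' x).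
    by apply: SmoothMul => //; exact: SmoothExp.
  by move=> x Ux; have := hf x Ux; apply: is_derive_comp_outer.
- move=> f ef [f' ef' hf] pf; exists (fun x => (f x)^-1 * f' x).
    apply: SmoothMul => //; apply: SmoothInv => // x Ux.
    by rewrite gt_eqF // pf.
  move=> x Ux; have := hf x Ux; apply: is_derive_comp_outer.
  exact: is_derive1_ln (pf x Ux).
Qed.

Lemma smooth_expr_continuous U : open U -> forall f, smooth_expr U f ->
  forall x, U x -> {for x, continuous f}.
Proof.
move=> oU f ef x Ux; elim: ef => {f}.
- by move=> f sf; exact: smooth_on_continuous Ux.
- by move=> c; exact: continuous_cst_at.
- by move=> f g _ cf _ cg; exact: continuousD_at.
- by move=> f g _ cf _ cg; exact: continuousM_at.
- move=> f _ cf nf; apply: (@continuous_comp _ _ _ f (fun y : R => y^-1)) => //.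
  exact: inv_continuous (nf x Ux).
- move=> f _ cf; apply: (@continuous_comp _ _ _ f expR) => //.
  exact: continuous_expR.
- move=> f _ cf pf; apply: (@continuous_comp _ _ _ f (@ln R)) => //.
  exact: continuous_ln (pf x Ux).
Qed.

Lemma smooth_exprP U f : open U -> smooth_expr U f -> smooth_on U f.
Proof.
move=> oU; apply: smooth_on_coind => //; first exact: smooth_expr_continuous.
exact: smooth_expr_derive.
Qed.

End SmoothClosure.

(** * The ring of smooth functions on an open set *)

(** A nonempty open set; a point is required for 1 and 0 to be different in its
    ring of smooth functions. *)
Record region (R : realType) (n : nat) := Region {
  rset :> 'rV[R]_n -> Prop;
  region_open : open (rset : set 'rV[R]_n);
  region_point : exists x, rset x
}.

Definition region_set (R : realType) (n : nat) (V : region R n) : set 'rV[R]_n := V.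
Coercion region_set : region >-> set.

(** Functions are required to vanish off [V], so that equality in the ring is
    equality on [V]. *)
Record sfun (R : realType) (n : nat) (V : region R n) := SFun {
  sval_ : 'rV[R]_n -> R;
  sfun_smooth : smooth_on V sval_;
  sfun_off : forall x, ~ V x -> sval_ x = 0
}.

Section SmoothRing.
Context {R : realType} {n : nat} (V : region R n).
Implicit Types (f g h : sfun V) (x : 'rV[R]_n).

Let oV : open (region_set V) := @region_open _ _ V.

Lemma sfunP f g : (forall x, V x -> sval_ f x = sval_ g x) -> f = g.
Proof.
case: f g => [f sf of_] [g sg og] /= h.
have e : f = g.
  by apply/funext => x; have [/h//|Vx] := pselect (V x); rewrite of_ // og.
by subst g; congr SFun; exact: Prop_irrelevance.
Qed.

Definition cut (F : 'rV[R]_n -> R) x := if pselect (V x) then F x else 0.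

Lemma cutE F x : V x -> cut F x = F x.
Proof. by rewrite /cut; case: pselect. Qed.

Lemma cut_off F x : ~ V x -> cut F x = 0.
Proof. by rewrite /cut; case: pselect. Qed.

Lemma cut_smooth F : smooth_on V F -> smooth_on V (cut F).
Proof.
apply: smooth_on_ext; first exact: region_open.
by move=> y Vy; rewrite cutE.
Qed.

Definition mksfun F (sF : smooth_on V F) : sfun V :=
  SFun (cut_smooth sF) (@cut_off F).

Lemma mksfunE F (sF : smooth_on V F) x : V x -> sval_ (mksfun sF) x = F x.
Proof. exact: cutE. Qed.

HB.instance Definition _ := gen_eqMixin (sfun V).
HB.instance Definition _ := gen_choiceMixin (sfun V).

Lemma smooth_atom f : smooth_expr V (sval_ f).
Proof. exact/SmoothAtom/sfun_smooth. Qed.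

Lemma smoothP F : smooth_expr V F -> smooth_on V F.
Proof. by move=> h; apply: smooth_exprP h; exact: region_open. Qed.

Definition scst (c : R) := mksfun (smoothP (SmoothCst V c)).
Definition sadd f g := mksfun (smoothP (SmoothAdd (smooth_atom f) (smooth_atom g))).
Definition smul f g := mksfun (smoothP (SmoothMul (smooth_atom f) (smooth_atom g))).
Definition sopp f := smul (scst (-1)) f.

Let sE := (mksfunE).

Lemma saddA : associative sadd.
Proof. by move=> f g h; apply: sfunP => x Vx; rewrite !sE // addrA. Qed.
Lemma saddC : commutative sadd.
Proof. by move=> f g; apply: sfunP => x Vx; rewrite !sE // addrC. Qed.
Lemma sadd0 : left_id (scst 0) sadd.
Proof. by move=> f; apply: sfunP => x Vx; rewrite !sE // add0r. Qed.
Lemma saddN : left_inverse (scst 0) sopp sadd.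
Proof. by move=> f; apply: sfunP => x Vx; rewrite !sE // mulN1r addNr. Qed.

HB.instance Definition _ := GRing.isZmodule.Build (sfun V) saddA saddC sadd0 saddN.

Lemma smulA : associative smul.
Proof. by move=> f g h; apply: sfunP => x Vx; rewrite !sE // mulrA. Qed.
Lemma smulC : commutative smul.
Proof. by move=> f g; apply: sfunP => x Vx; rewrite !sE // mulrC. Qed.
Lemma smul1 : left_id (scst 1) smul.
Proof. by move=> f; apply: sfunP => x Vx; rewrite !sE // mul1r. Qed.
Lemma smulD : left_distributive smul sadd.
Proof. by move=> f g h; apply: sfunP => x Vx; rewrite !sE // mulrDl. Qed.
Lemma scst1_neq0 : scst 1 != scst 0.
Proof.
have [x Vx] := region_point V; apply/eqP => /(congr1 (fun f => sval_ f x)).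
by rewrite !sE // => /eqP; rewrite oner_eq0.
Qed.

HB.instance Definition _ :=
  GRing.Zmodule_isComNzRing.Build (sfun V) smulA smulC smul1 smulD scst1_neq0.

Section Evaluation.
Variables (x : 'rV[R]_n) (Vx : V x).

Lemma evD f g : sval_ (f + g) x = sval_ f x + sval_ g x.
Proof. exact: sE. Qed.
Lemma evM f g : sval_ (f * g) x = sval_ f x * sval_ g x.
Proof. exact: sE. Qed.
Lemma ev_cst c : sval_ (scst c) x = c.
Proof. exact: sE. Qed.
Lemma ev0 : sval_ (0 : sfun V) x = 0.
Proof. exact: sE. Qed.
Lemma ev1 : sval_ (1 : sfun V) x = 1.
Proof. exact: sE. Qed.
Lemma evN f : sval_ (- f) x = - sval_ f x.
Proof. by apply/eqP; rewrite -addr_eq0 -evD addNr ev0. Qed.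
Lemma evB f g : sval_ (f - g) x = sval_ f x - sval_ g x.
Proof. by rewrite evD evN. Qed.
Lemma ev_sum (I : finType) (F : I -> sfun V) :
  sval_ (\sum_i F i) x = \sum_i sval_ (F i) x.
Proof. by apply: (big_morph (fun f => sval_ f x)); [exact: evD|exact: ev0]. Qed.
Lemma evMn f k : sval_ (f *+ k) x = sval_ f x *+ k.
Proof. by elim: k => [|k IH]; rewrite ?mulr0n ?ev0 // !mulrS evD IH. Qed.
Lemma ev_nat k : sval_ (k%:R : sfun V) x = k%:R.
Proof. by rewrite evMn ev1. Qed.
Lemma ev_delta (b : bool) : sval_ (b%:R : sfun V) x = b%:R.
Proof. exact: ev_nat. Qed.
End Evaluation.

Definition sderiv (a : 'I_n) f : sfun V :=
  mksfun (smooth_on_partial a (@sfun_smooth _ _ _ f)).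

Lemma ev_sderiv a f x : V x -> sval_ (sderiv a f) x = partial a (sval_ f) x.
Proof. exact: sE. Qed.

Lemma sfun_is_derive a f x : V x ->
  is_derive x (delta_mx 0 a) (sval_ f) (sval_ (sderiv a f) x).
Proof. by move=> Vx; rewrite ev_sderiv //; exact: smooth_on_is_derive (@sfun_smooth _ _ _ f) Vx. Qed.

Lemma sderiv_eq a f F l x : V x -> (forall y, V y -> sval_ f y = F y) ->
  is_derive x (delta_mx 0 a) F l -> sval_ (sderiv a f) x = l.
Proof.
move=> Vx h [_ <-]; rewrite ev_sderiv //.
exact: eq_partial oV Vx h.
Qed.

Lemma sderiv_mk a F (sF : smooth_on V F) x : V x ->
  sval_ (sderiv a (mksfun sF)) x = partial a F x.
Proof.
move=> Vx; rewrite ev_sderiv //; apply: eq_partial oV Vx _.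
by move=> y Vy; rewrite mksfunE.
Qed.

(** Smooth functions with the partial derivatives are an instance of the abstract
    calculus. *)
Lemma sderiv_commuting : commuting_derivations sderiv.
Proof.
split=> [a f g|a f g|a b f]; apply: sfunP => x Vx.
- rewrite evD //; apply: (sderiv_eq Vx (fun y Vy => evD Vy f g)).
  by apply: is_deriveD; exact: sfun_is_derive.
- rewrite evD // !evM //; apply: (sderiv_eq Vx (fun y Vy => evM Vy f g)).
  have := is_deriveM (sfun_is_derive a f Vx) (sfun_is_derive a g Vx).
  rewrite /GRing.scale /= => h; apply: is_derive_eq h _.
  by rewrite addrC; congr (_ + _); rewrite mulrC.
- have e c d : sval_ (sderiv c (sderiv d f)) x = partial c (partial d (sval_ f)) x.
    exact: sderiv_mk.
  have pC := partialC a b oV (@sfun_smooth _ _ _ f) Vx.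
  exact: (etrans (e a b) (etrans pC (esym (e b a)))).
Qed.

Lemma sderiv_cst a c : sderiv a (scst c) = 0.
Proof.
apply: sfunP => x Vx; rewrite (ev0 Vx) (sderiv_mk _ _ Vx).
by rewrite /partial derive_cst.
Qed.

Lemma sfun_torsion_free m f : f *+ m.+1 = 0 -> f = 0.
Proof.
move=> h; apply: sfunP => x Vx; have := congr1 (fun f => sval_ f x) h.
by rewrite evMn // ev0 // => /eqP; rewrite mulrn_eq0 /= => /eqP.
Qed.

Lemma sfun_inv f : (forall x, V x -> sval_ f x != 0) ->
  exists2 f', f' * f = 1 & forall x, V x -> sval_ f' x = (sval_ f x)^-1.
Proof.
move=> nz; exists (mksfun (smoothP (SmoothInv (smooth_atom f) nz))).
  by apply: sfunP => x Vx; rewrite evM // ev1 // mksfunE // mulVf // nz.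
by move=> x Vx; rewrite mksfunE.
Qed.

Definition sexp f := mksfun (smoothP (SmoothExp (smooth_atom f))).

Lemma ev_sexp f x : V x -> sval_ (sexp f) x = expR (sval_ f x).
Proof. exact: sE. Qed.

Lemma sderiv_exp a f : sderiv a (sexp f) = sderiv a f * sexp f.
Proof.
apply: sfunP => x Vx; rewrite evM // mulrC ev_sexp //.
apply: (sderiv_eq Vx (F := fun y => expR (sval_ f y))).
  by move=> y Vy; rewrite ev_sexp.
exact: is_derive_comp_outer (is_derive_expR _) (sfun_is_derive a f Vx).
Qed.

(** The logarithm is only needed through its derivatives. *)
Lemma sfun_ln f : (forall x, V x -> 0 < sval_ f x) ->
  exists w, forall a, sderiv a f = sderiv a w * f.
Proof.
move=> pos; exists (mksfun (smoothP (SmoothLn (smooth_atom f) pos))) => a.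
apply: sfunP => x Vx; have fx := pos x Vx.
rewrite evM // sderiv_mk //.
have h := is_derive_comp_outer (is_derive1_ln fx) (sfun_is_derive a f Vx).
rewrite /partial (@derive_val _ _ _ _ _ _ _ h) mulrC mulrA divff ?mul1r //.
by rewrite gt_eqF.
Qed.

End SmoothRing.

(* Unification must not unfold ring elements into functions. *)
Global Opaque sderiv mksfun sexp scst sadd smul sopp.

(** * Local solutions of Lipschitz differential equations *)

Section Picard.
Context {R : realType}.

(** The values are only used on ]-1, 1[, where the fundamental theorem of calculus
    applies to the integral from -1. *)
Lemma primitive_exists (f : R -> R) : continuous f ->
  exists P : R -> R, P 0 = 0 /\ forall t : R, `|t| < 1 -> is_derive t 1 P (f t).
Proof.
move=> cf.
pose F x := (\int[lebesgue_measure]_(t in [set` `[(-1)%R, x]]) (f t))%R.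
have intf : lebesgue_measure.-integrable `[(-1)%R, 1] (EFin \o f).
  apply: continuous_compact_integrable; first exact: segment_compact.
  exact: continuous_subspaceT.
have dF (t : R) : `|t| < 1 -> is_derive t 1 F (f t).
  rewrite ltr_norml => /andP[t1 t2].
  have [d e] := @continuous_FTC1_closed R f (-1) t 1 t2 intf t1 (cf t).
  by split; [exact: d|rewrite -derive1E].
exists (fun t => F t - F 0); split; first by rewrite subrr.
move=> t t1; rewrite -[f t]subr0; apply: is_deriveB; first exact: dF.
Qed.

(** The error bound is explicit, so that the limit of Picard's iteration can be
    estimated without uniform convergence. *)
Lemma geometric_limit (u : nat -> R) C :
  (forall k, `|u k.+1 - u k| <= C / 2 ^+ k) ->
  exists l, forall k, `|u k - l| <= 2 * C / 2 ^+ k.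
Proof.
move=> hu; pose e k := 2 * C / 2 ^+ k.
have eS k : e k - e k.+1 = C / 2 ^+ k.
  rewrite /e exprS; field; by rewrite expf_neq0.
have C0 : 0 <= C by have := hu 0%N; rewrite expr0 divr1; apply: le_trans.
have e0 k : 0 <= e k by rewrite /e divr_ge0 ?mulr_ge0 // exprn_ge0.
have up j k : u j - e j <= u (j + k)%N - e (j + k)%N.
  elim: k => [|k IH]; first by rewrite addn0.
  apply: le_trans IH _; rewrite addnS; have := hu (j + k)%N; rewrite -eS ler_norml; lra.
have dn j k : u (j + k)%N + e (j + k)%N <= u j + e j.
  elim: k => [|k IH]; first by rewrite addn0.
  apply: le_trans _ IH; rewrite addnS; have := hu (j + k)%N; rewrite -eS ler_norml; lra.
have ab j k : u j - e j <= u k + e k.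
  have h1 := up j k; have h2 := dn k j; rewrite addnC in h2.
  have := e0 (j + k)%N; lra.
pose A := [set u k - e k | k in setT].
have hA : has_sup A.
  split; first by exists (u 0%N - e 0%N), 0%N.
  by exists (u 0%N + e 0%N) => _ [k _ <-].
exists (sup A) => k; rewrite ler_norml; apply/andP; split.
  have : sup A <= u k + e k by apply: ge_sup; [exact: hA.1|move=> _ [j _ <-]].
  rewrite -/(e k); lra.
have : u k - e k <= sup A by apply: ub_le_sup; [exact: hA.2|exists k].
rewrite -/(e k); lra.
Qed.

(** The retraction of the line to [a - r, a + r]; precomposition with it turns a
    locally Lipschitz vector field into a globally Lipschitz one. *)
Definition clamp (a r x : R) := Num.max (a - r) (Num.min x (a + r)).

Lemma clamp_near a r x : 0 <= r -> `|clamp a r x - a| <= r.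
Proof.
move=> r0; rewrite /clamp ler_norml.
case: (leP x (a + r)) => h1.
  by case: (leP (a - r) x) => h2; apply/andP; split; lra.
by case: (leP (a - r) (a + r)) => h2; apply/andP; split; lra.
Qed.

Lemma clamp_id a r x : `|x - a| <= r -> clamp a r x = x.
Proof.
rewrite ler_norml => /andP[h1 h2]; rewrite /clamp.
have -> : Num.min x (a + r) = x by apply/min_idPl; lra.
by apply/max_idPr; lra.
Qed.

Lemma clamp_lip a r x y : 0 <= r -> `|clamp a r x - clamp a r y| <= `|x - y|.
Proof.
move=> r0; rewrite /clamp ler_norml.
have k1 := ler_norm (x - y); have k2 := ler_norm (y - x); rewrite distrC in k2.
case: (leP x (a + r)) => h1; case: (leP y (a + r)) => h2;
  case: (leP (a - r) x) => h3; case: (leP (a - r) y) => h4;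
  case: (leP (a - r) (a + r)) => h5; apply/andP; split; lra.
Qed.

Lemma four_point_split (V : zmodType) (X Y Z T : V) :
  X - Y = (T - Y) - (Z - X) + (Z - T).
Proof.
rewrite opprB -addrA [X - Z + _]addrA subrK [X - T]addrC addrA.
by rewrite [T - Y]addrC -[_ + T - T]addrA subrr addr0 addrC.
Qed.

Section Global.
Context (m : nat) (F : 'rV[R]_m -> 'rV[R]_m) (L : R) (w0 : 'rV[R]_m).
Hypothesis L0 : 0 < L.
Hypothesis FL : forall w w', `|F w - F w'| <= L * `|w - w'|.

Let cF (i : 'I_m) (u : R -> 'rV[R]_m) : continuous u -> continuous (fun t => F (u t) 0 i).
Proof.
move=> cu t; apply/continuous_epsP => e e0.
have e0' : 0 < e / L by rewrite divr_gt0.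
have /continuous_epsP/(_ _ e0') [d d0 hd] := cu t.
exists d => // s sd.
have := rV_coord_le (F (u s) - F (u t)) i; rewrite !mxE => h.
apply: le_lt_trans h _; apply: le_lt_trans (FL _ _) _.
by rewrite mulrC -ltr_pdivlMr //; exact: hd.
Qed.

(** Picard iteration. The iterates are frozen outside [-del, del] by [clamp], so
    that they are continuous on the whole line, and del is small enough for the
    iteration to contract distances by one half. *)
Lemma picard_global : exists2 del, 0 < del &
  exists w : R -> 'rV[R]_m, w 0 = w0 /\
    forall t : R, `|t| < del -> forall i, is_derive t 1 (fun s => w s 0 i) (F (w t) 0 i).
Proof.
(* A primitive is chosen for every function, so that Phi is defined on all curves. *)
have prim_ex (f : R -> R) : exists P : R -> R, continuous f ->
    P 0 = 0 /\ forall t : R, `|t| < 1 -> is_derive t 1 P (f t).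
  have [cf|ncf] := pselect (continuous f); last by exists (fun=> 0).
  by have [P hP] := primitive_exists cf; exists P.
have [prim hprim] := choice prim_ex.
pose del : R := Num.min (1 / 2) (1 / (2 * L)).
have del0 : 0 < del by rewrite lt_min !divr_gt0 // mulr_gt0.
have del1 : del < 1 by rewrite /del gt_min; apply/orP; left; lra.
have delL : del * L <= 1 / 2.
  apply: le_trans (_ : 1 / (2 * L) * L <= _).
    by rewrite ler_wpM2r ?(ltW L0) // /del ge_min lexx orbT.
  rewrite le_eqVlt; apply/orP; left; apply/eqP; field; by rewrite gt_eqF.
pose cl t := clamp 0 del t.
have cl_le t : `|cl t| <= del by have := clamp_near 0 t (ltW del0); rewrite subr0.
have cl_lip s t : `|cl s - cl t| <= `|s - t| by exact: clamp_lip (ltW del0).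
have cl_id t : `|t| <= del -> cl t = t by move=> h; apply: clamp_id; rewrite subr0.
pose Fi i (u : R -> 'rV[R]_m) t := F (u t) 0 i.
pose Phi (u : R -> 'rV[R]_m) t := w0 + \row_i prim (Fi i u) (cl t).
have prim0 i u : continuous u -> prim (Fi i u) 0 = 0.
  by move=> cu; have [h _] := hprim (Fi i u) (cF cu).
have dprim i u (t : R) : continuous u -> `|t| <= del -> is_derive t 1 (prim (Fi i u)) (Fi i u t).
  move=> cu td; have [_ h] := hprim (Fi i u) (cF cu); apply: h.
  exact: le_lt_trans td del1.
have Phi_cont u : continuous u -> continuous (Phi u).
  move=> cu t; apply/continuous_epsP => e e0.
  have h i : exists d, 0 < d /\ forall s, `|s - t| < d ->
      `|prim (Fi i u) (cl s) - prim (Fi i u) (cl t)| < e.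
    have /continuous_epsP/(_ e e0) [d d0 hd] :=
      is_derive_continuous (dprim i u (cl t) cu (cl_le t)).
    exists d; split => // s sd; apply: hd; exact: le_lt_trans (cl_lip s t) sd.
  have [d hd] := choice h.
  exists (\big[Num.min/1]_i d i).
    by apply/bigmin_gtP; split => // i _; exact: (hd i).1.
  move=> s /bigmin_gtP [_ hs]; apply: rV_norm_lt => // i.
  rewrite !mxE opprD addrACA subrr add0r; apply: (hd i).2; exact: hs.
have Phi_contr u v c : continuous u -> continuous v -> 0 <= c ->
    (forall t, `|u t - v t| <= c) -> forall t, `|Phi u t - Phi v t| <= c / 2.
  move=> cu cv c0 huv t; apply: rV_norm_le => [|i]; first by rewrite divr_ge0.
  rewrite !mxE opprD addrACA subrr add0r.
  pose f (s : R) := prim (Fi i u) s - prim (Fi i v) s.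
  have df (s : R) : `|s| <= `|cl t| -> is_derive (s *: (1 : R) + 0) 1 f
      (Fi i u (s *: (1 : R) + 0) - Fi i v (s *: (1 : R) + 0)).
    move=> hs; rewrite [s%:A]mulr1 addr0.
    by apply: is_deriveB; apply: dprim => //; exact: le_trans hs (cl_le t).
  have [s hs] := MVT_line (DF := fun z => Fi i u z - Fi i v z) df.
  rewrite [(cl t)%:A]mulr1 addr0 /f (prim0 i _ cu) (prim0 i _ cv).
  rewrite subrr subr0 => ->; rewrite normrM.
  have k1 := rV_coord_le (F (u (s *: (1 : R) + 0)) - F (v (s *: (1 : R) + 0))) i.
  rewrite !mxE in k1.
  have k2 := le_trans k1 (FL _ _).
  have k3 := le_trans k2 (ler_wpM2l (ltW L0) (huv _)).
  apply: le_trans (ler_pM _ _ (cl_le t) k3) _ => //.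
  rewrite mulrA; have := ler_wpM2r c0 delL; lra.
pose w k := iter k Phi (fun=> w0).
have wc k : continuous (w k).
  elim: k => [|k IH]; last exact: Phi_cont.
  by move=> t; exact: continuous_cst_at.
pose C := `|F w0|.
have C0 : 0 <= C by exact: normr_ge0.
have w1 t : `|w 1%N t - w 0%N t| <= C.
  apply: rV_norm_le => // i; rewrite /w /= /Phi !mxE addrAC subrr add0r.
  have c0 : continuous ((fun=> w0) : R -> 'rV[R]_m).
    by move=> t'; exact: continuous_cst_at.
  have df (s : R) : `|s| <= `|cl t| -> is_derive (s *: (1 : R) + 0) 1 (prim (Fi i (fun=> w0)))
      (Fi i (fun=> w0) (s *: (1 : R) + 0)).
    move=> hs; rewrite [s%:A]mulr1 addr0.
    apply: dprim; first exact: c0.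
    exact: le_trans hs (cl_le t).
  have [s hs] := MVT_line (DF := Fi i (fun=> w0)) df.
  rewrite [(cl t)%:A]mulr1 addr0 (prim0 i _ c0) subr0 => ->.
  rewrite normrM -[C]mul1r; apply: ler_pM => //.
    by apply: le_trans (cl_le t) (ltW del1).
  exact: rV_coord_le.
have wS k t : `|w k.+1 t - w k t| <= C / 2 ^+ k.
  elim: k t => [|k IH] t; first by rewrite expr0 divr1.
  have := Phi_contr _ _ (C / 2 ^+ k) (wc k.+1) (wc k) _ IH t.
  rewrite -mulrA -invfM -exprSr; apply.
  by rewrite divr_ge0 // exprn_ge0.
have lim_ex (ti : R * 'I_m) : exists l, forall k,
    `|w k ti.1 0 ti.2 - l| <= 2 * C / 2 ^+ k.
  apply: geometric_limit => k; apply: le_trans (wS k ti.1).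
  by have := rV_coord_le (w k.+1 ti.1 - w k ti.1) ti.2; rewrite !mxE.
have [l hl] := choice lim_ex.
pose W t := \row_i l (t, i).
have ek0 k : 0 <= 2 * C / 2 ^+ k by rewrite divr_ge0 ?mulr_ge0 // exprn_ge0.
have hW k t : `|w k t - W t| <= 2 * C / 2 ^+ k.
  apply: rV_norm_le => // i; rewrite !mxE; exact: (hl (t, i) k).
have small e : 0 < e -> exists k, 2 * C / 2 ^+ k < e.
  move=> e0; have := @cvg_geometric R (2 * C) (1 / 2).
  have h2 : `|1 / 2 : R| < 1 by rewrite ger0_norm //; lra.
  move=> /(_ h2) /cvgrPdist_lt /(_ e e0) [k _ /(_ k (leqnn k))] /= h.
  exists k; move: h; rewrite sub0r normrN /geometric /= ger0_norm.
    by rewrite expr_div_n expr1n mul1r.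
  by rewrite mulr_ge0 ?mulr_ge0 // exprn_ge0.
have cW : continuous W.
  move=> t; apply/continuous_epsP => e e0.
  have e3 : 0 < e / 3 by rewrite divr_gt0.
  have [k hk] := small _ e3.
  have /continuous_epsP/(_ _ e3) [d d0 hd] := wc k t.
  exists d => // s sd; have a1 := hW k s; have a2 := hW k t; have a3 := hd s sd.
  have -> : W s - W t = (w k t - W t) - (w k s - W s) + (w k s - w k t).
    move: (W s) (W t) (w k s) (w k t) => X Y Z T.
    exact: four_point_split.
  have b1 := ler_normD ((w k t - W t) - (w k s - W s)) (w k s - w k t).
  have b2 := ler_normB (w k t - W t) (w k s - W s).
  lra.
have fixW t : Phi W t = W t.
  apply/eqP; rewrite -subr_eq0 -normr_le0; apply/ler_addgt0Pl => e e0; rewrite addr0.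
  have e2 : 0 < e / 2 by rewrite divr_gt0.
  have [k hk] := small _ e2.
  have a1 := Phi_contr _ _ _ (wc k) cW (ek0 k) (hW k) t.
  have a2 := hW k.+1 t; rewrite -/(Phi (w k) t) in a2.
  have a3 : 2 * C / 2 ^+ k.+1 <= 2 * C / 2 ^+ k.
    rewrite ler_wpM2l ?mulr_ge0 // lef_pV2 ?posrE ?exprn_gt0 //.
    by rewrite exprS ler_peMl ?exprn_ge0 //; lra.
  have a4 := ler_distD (Phi (w k) t) (Phi W t) (W t).
  rewrite (distrC (Phi W t) (Phi (w k) t)) in a4.
  have a5 : `|Phi (w k) t - W t| <= 2 * C / 2 ^+ k by exact: le_trans a2 a3.
  lra.
exists del => //; exists W; split.
  rewrite -fixW /Phi cl_id ?normr0 ?(ltW del0) //.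
  apply/rowP => i; rewrite !mxE (prim0 i _ cW) addr0 //.
move=> t td i.
have e : \near t, w0 0 i + prim (Fi i W) t = W t 0 i.
  have : \forall s \near t, `|s| < del.
    have dt : 0 < del - `|t| by rewrite subr_gt0.
    apply/nbhs_normP; exists (del - `|t|) => //= s st.
    have := ler_distD t s 0; rewrite !subr0 (distrC s) => h.
    move: st; rewrite /= => st; apply: le_lt_trans h _; rewrite -ltrBrDr; exact: st.
  apply: filterS => s sd.
  by rewrite -fixW /Phi !mxE cl_id // ltW.
apply: (near_eq_is_derive e).
rewrite -[F (W t) 0 i]add0r; apply: is_deriveD.
by apply: dprim => //; exact: ltW.
Qed.

End Global.

End Picard.

(** * Solving the geodesic equation in a chart *)

Lemma rV_addE (R : nmodType) m (M N : 'rV[R]_m) i : (M + N) 0 i = M 0 i + N 0 i.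
Proof. by rewrite mxE. Qed.
Lemma rV_oppE (R : zmodType) m (M : 'rV[R]_m) i : (- M) 0 i = - M 0 i.
Proof. by rewrite mxE. Qed.

Section LipschitzBounded.
Context {R : realType}.

(** Lipschitz and bounded on [S]; unlike the Lipschitz property alone, the
    conjunction is stable under products. *)
Definition lipb m (S : set 'rV[R]_m) (f : 'rV[R]_m -> R) :=
  exists L B, [/\ 0 <= L, 0 <= B,
    forall w w', S w -> S w' -> `|f w - f w'| <= L * `|w - w'| &
    forall w, S w -> `|f w| <= B].

Lemma lipb_cst m (S : set 'rV[R]_m) c : lipb S (fun=> c).
Proof.
exists 0, `|c|; split => // [w w' _ _]; by rewrite subrr normr0 mul0r.
Qed.

Lemma lipb_add m (S : set 'rV[R]_m) f g :
  lipb S f -> lipb S g -> lipb S (fun w => f w + g w).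
Proof.
move=> [L [B [L0 B0 hL hB]]] [L' [B' [L0' B0' hL' hB']]].
exists (L + L'), (B + B'); split => [||w w' Sw Sw'|w Sw]; rewrite ?addr_ge0 //.
  rewrite opprD addrACA mulrDl; apply: le_trans (ler_normD _ _) _.
  by apply: lerD; [exact: hL|exact: hL'].
by apply: le_trans (ler_normD _ _) _; apply: lerD; [exact: hB|exact: hB'].
Qed.

Lemma lipb_mul m (S : set 'rV[R]_m) f g :
  lipb S f -> lipb S g -> lipb S (fun w => f w * g w).
Proof.
move=> [L [B [L0 B0 hL hB]]] [L' [B' [L0' B0' hL' hB']]].
exists (B * L' + L * B'), (B * B'); split => [||w w' Sw Sw'|w Sw].
- by rewrite addr_ge0 ?mulr_ge0.
- by rewrite mulr_ge0.
- have -> : f w * g w - f w' * g w' = f w * (g w - g w') + (f w - f w') * g w' by ring.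
  apply: le_trans (ler_normD _ _) _; rewrite !normrM mulrDl.
  apply: lerD; first by rewrite -mulrA; apply: ler_pM => //; [exact: hB|exact: hL'].
  by rewrite mulrAC; apply: ler_pM => //; [exact: hL|exact: hB'].
- by rewrite normrM; apply: ler_pM => //; [exact: hB|exact: hB'].
Qed.

Lemma lipb_sum m (S : set 'rV[R]_m) (I : finType) (f : I -> 'rV[R]_m -> R) :
  (forall i, lipb S (f i)) -> lipb S (fun w => \sum_i f i w).
Proof.
move=> h; suff H (s : seq I) : lipb S (fun w => \sum_(i <- s) f i w) by exact: H.
elim: s => [|i s IH].
  have -> : (fun w => \sum_(i <- [::]) f i w) = (fun=> 0).
    by apply/funext => w; rewrite big_nil.
  exact: lipb_cst.
have -> : (fun w => \sum_(j <- i :: s) f j w) = (fun w => f i w + \sum_(j <- s) f j w).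
  by apply/funext => w; rewrite big_cons.
exact: lipb_add.
Qed.

Lemma lipb_comp m k (S : set 'rV[R]_m) (T : set 'rV[R]_k) (h : 'rV[R]_m -> 'rV[R]_k) f :
  (forall w, S w -> T (h w)) -> (forall w w', `|h w - h w'| <= `|w - w'|) ->
  lipb T f -> lipb S (fun w => f (h w)).
Proof.
move=> ST hh [L [B [L0 B0 hL hB]]]; exists L, B; split => // [w w' Sw Sw'|w Sw].
  by apply: le_trans (hL _ _ (ST _ Sw) (ST _ Sw')) _; exact: ler_wpM2l.
exact: hB (ST _ Sw).
Qed.

Lemma lipb_sub m (S T : set 'rV[R]_m) f : S `<=` T -> lipb T f -> lipb S f.
Proof.
move=> ST [L [B [L0 B0 hL hB]]]; exists L, B; split => // [w w' /ST h /ST h'|w /ST h].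
  exact: hL.
exact: hB.
Qed.

Lemma lipb_coord m (w0 : 'rV[R]_m) r i : lipb [set w | `|w - w0| <= r] (fun w => w 0 i).
Proof.
exists 1, (`|w0| + `|r|); split => [//||w w' _ _|w h]; first exact: addr_ge0.
  by rewrite mul1r; have := rV_coord_le (w - w') i; rewrite !mxE.
apply: le_trans (rV_coord_le _ _) _.
rewrite -[w](subrK w0) addrC; apply: le_trans (ler_normD _ _) _.
by rewrite lerD2l; apply: le_trans h (ler_norm r).
Qed.

(** On a small ball the partial derivatives are bounded by continuity, and the mean
    value theorem along segments applies. *)
Lemma smooth_lipb n (U : set 'rV[R]_n) (f : 'rV[R]_n -> R) x0 : open U ->
  smooth_on U f -> U x0 -> exists2 r, 0 < r &
  (forall y, `|y - x0| <= r -> U y) /\ lipb [set y | `|y - x0| <= r] f.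
Proof.
move=> oU sf Ux; have [d d0 hd] := open_ball oU Ux.
have near_bound a : exists2 e, 0 < e &
    forall y, `|y - x0| < e -> `|partial a f y| <= `|partial a f x0| + 1.
  have /continuous_epsP/(_ 1 ltr01) [e e0 he] :=
    smooth_on_continuous (smooth_on_partial a sf) Ux.
  exists e => // y ye; have := he y ye.
  have := ler_distD (partial a f x0) (partial a f y) 0; rewrite !subr0; lra.
have h2 : forall a, exists e, 0 < e /\
    forall y, `|y - x0| < e -> `|partial a f y| <= `|partial a f x0| + 1.
  by move=> a; have [e e0 he] := near_bound a; exists e.
have [e he] := choice h2.
pose r := Num.min d (\big[Num.min/1]_a e a) / 2.
have m0 : 0 < Num.min d (\big[Num.min/1]_a e a).
  rewrite lt_min d0 /=; apply/bigmin_gtP; split => // a _; exact: (he a).1.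
have r0 : 0 < r by rewrite divr_gt0.
have rm : r < Num.min d (\big[Num.min/1]_a e a) by rewrite /r; lra.
have [rd re] : r < d /\ forall a, r < e a.
  by move: rm; rewrite lt_min => /andP[-> /bigmin_gtP [_ h]]; split => // a; exact: h.
have inU y : `|y - x0| <= r -> U y by move=> h; apply: hd; exact: le_lt_trans h rd.
exists r => //; split => //.
pose M := \sum_a (`|partial a f x0| + 1).
have M0 : 0 <= M by apply: sumr_ge0 => a _; rewrite addr_ge0.
have lip w w' : `|w - x0| <= r -> `|w' - x0| <= r -> `|f w - f w'| <= M * `|w - w'|.
  move=> hw hw'; pose c (t : R) := t *: (w - w') + w'.
  have cr t : 0 <= t <= 1 -> `|c t - x0| <= r.
    move=> /andP[t0 t1].
    have -> : c t - x0 = t *: (w - x0) + (1 - t) *: (w' - x0).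
      by apply/rowP => i; rewrite !mxE; ring.
    apply: le_trans (ler_normD _ _) _; rewrite !normrZ (ger0_norm t0) ger0_norm ?subr_ge0 //.
    have k1 := ler_wpM2l t0 hw.
    have t1' : 0 <= 1 - t by rewrite subr_ge0.
    have k2 := ler_wpM2l t1' hw'.
    lra.
  have dc (t : R) a : is_derive t 1 (fun s => c s 0 a) ((w - w') 0 a).
    rewrite /c; apply is_derive_epsP => e' e'0; exists 1 => // s _.
    rewrite !mxE; have -> : s * (w 0 a - w' 0 a) + w' 0 a - (t * (w 0 a - w' 0 a) + w' 0 a)
      - (s - t) * (w 0 a - w' 0 a) = 0 by ring.
    by rewrite normr0; apply: mulr_ge0 => //; exact: ltW.
  pose df t := \sum_a (w - w') 0 a * partial a f (c t).
  have dfc (t : R) : 0 <= t <= 1 -> is_derive t 1 (f \o c) (df t).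
    move=> ht; apply: chain_curve (dc t).
    exact: smooth_on_C1 oU sf (inU _ (cr t ht)).
  have cont : {within `[0, 1], continuous (f \o c)}.
    apply: continuous_in_subspaceT => t; rewrite inE /= in_itv /= => ht.
    exact: is_derive_continuous (dfc t ht).
  have dfc' (t : R) : t \in `]0, 1[%R -> is_derive t 1 (f \o c) (df t).
    by rewrite in_itv /= => /andP[a b]; apply: dfc; rewrite !ltW.
  have [t ht] := MVT_segment ler01 dfc' cont.
  rewrite /= /c scale1r subrK scale0r add0r subr0 mulr1 => ->.
  apply: le_trans (ler_norm_sum _ _ _) _; rewrite /M mulr_suml.
  apply: ler_sum => a _; rewrite normrM mulrC; apply: ler_pM => //.
    apply: (he a).2; apply: le_lt_trans (cr t _) (re a).
    by move: ht; rewrite in_itv.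
  exact: rV_coord_le.
exists M, (`|f x0| + M * r); split => //.
  by rewrite addr_ge0 // mulr_ge0 // ltW.
move=> w /= hw.
have x0r : `|x0 - x0| <= r by rewrite subrr normr0 ltW.
have k := lip w x0 hw x0r.
have k2 := ler_wpM2l M0 hw.
have := ler_distD (f x0) (f w) 0; rewrite !subr0; lra.
Qed.

End LipschitzBounded.

Section GeodesicODE.
Context {R : realType} {n : nat}.
Variables (U : set 'rV[R]_n) (Gam : 'I_n -> 'I_n -> 'I_n -> 'rV[R]_n -> R).
Hypothesis oU : open U.
Hypothesis sG : forall k a b, smooth_on U (Gam k a b).

(** The equation is written as a first order system for the pair (x, v), whose
    vector field is made globally Lipschitz by retracting to a cube around the
    initial condition. For small times the solution stays in the cube, where
    the retraction is the identity. *)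
Lemma geodesic_ode (x0 v0 : 'rV[R]_n) : U x0 -> exists2 del, 0 < del &
  exists x v : R -> 'rV[R]_n, [/\ x 0 = x0, v 0 = v0 &
    forall t : R, `|t| < del -> [/\ U (x t),
      forall k, is_derive t 1 (fun s => x s 0 k) (v t 0 k) &
      forall k, is_derive t 1 (fun s => v s 0 k)
        (- \sum_a \sum_b Gam k a b (x t) * v t 0 a * v t 0 b)]].
Proof.
move=> Ux.
have [r [r0 hrU hrL]] : exists r, [/\ 0 < r, forall y, `|y - x0| <= r -> U y &
    forall k a b, lipb [set y | `|y - x0| <= r] (Gam k a b)].
  have h (kab : 'I_n * 'I_n * 'I_n) : exists r, 0 < r /\
      ((forall y, `|y - x0| <= r -> U y) /\
       lipb [set y | `|y - x0| <= r] (Gam kab.1.1 kab.1.2 kab.2)).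
    by have [r r0 hr] := smooth_lipb oU (sG kab.1.1 kab.1.2 kab.2) Ux; exists r.
  have [rr hrr] := choice h.
  have [d d0 hd] := open_ball oU Ux.
  have m0 : 0 < \big[Num.min/d]_p rr p.
    by apply/bigmin_gtP; split => // p _; exact: (hrr p).1.
  exists (\big[Num.min/d]_p rr p / 2); split; first by rewrite divr_gt0.
    move=> y hy; apply: hd; apply: le_lt_trans hy _.
    have : \big[Num.min/d]_p rr p <= d by apply: bigmin_le_id.
    lra.
  move=> k a b; apply: lipb_sub (hrr (k, a, b)).2.2 => y /= hy.
  apply: le_trans hy _.
  have : \big[Num.min/d]_p rr p <= rr (k, a, b) by apply: bigmin_le.
  lra.
pose w0 : 'rV[R]_(n + n) := row_mx x0 v0.
pose S : set 'rV[R]_(n + n) := [set w | `|w - w0| <= r].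
pose f (w : 'rV[R]_(n + n)) : 'rV[R]_(n + n) := row_mx (rsubmx w)
  (\row_k - \sum_a \sum_b Gam k a b (lsubmx w) * rsubmx w 0 a * rsubmx w 0 b).
have lsub_lip (w w' : 'rV[R]_(n + n)) : `|lsubmx w - lsubmx w'| <= `|w - w'|.
  apply: rV_norm_le => // i; rewrite !mxE.
  by have := rV_coord_le (w - w') (lshift n i); rewrite !mxE.
have lipf i : lipb S (fun w => f w 0 i).
  have rs a : lipb S (fun w => rsubmx w 0 a).
    have -> : (fun w : 'rV[R]_(n + n) => rsubmx w 0 a) = (fun w => w 0 (rshift n a)).
      by apply/funext => w; rewrite mxE.
    exact: lipb_coord.
  case: (split_ordP i) => k ->.
    have -> : (fun w => f w 0 (lshift n k)) = (fun w => rsubmx w 0 k).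
      by apply/funext => w; rewrite /f row_mxEl.
    exact: rs.
  have -> : (fun w => f w 0 (rshift n k)) = (fun w => -1 * \sum_a \sum_b
      Gam k a b (lsubmx w) * rsubmx w 0 a * rsubmx w 0 b).
    by apply/funext => w; rewrite /f row_mxEr mxE mulN1r.
  apply: lipb_mul; first exact: lipb_cst.
  apply: lipb_sum => a; apply: lipb_sum => b.
  apply: lipb_mul; last exact: rs.
  apply: lipb_mul; last exact: rs.
  apply: (lipb_comp _ lsub_lip (hrL k a b)) => w /= hw.
  have -> : x0 = lsubmx w0 by rewrite row_mxKl.
  exact: le_trans (lsub_lip w w0) hw.
have [L hL] := choice lipf.
pose cl (w : 'rV[R]_(n + n)) : 'rV[R]_(n + n) := \row_i clamp (w0 0 i) r (w 0 i).
have clE w i : cl w 0 i = clamp (w0 0 i) r (w 0 i) by rewrite [LHS]mxE.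
have clS w : S (cl w).
  apply: rV_norm_le => [|i]; first exact: ltW.
  by rewrite rV_addE rV_oppE clE clamp_near // ltW.
have cl_lip w w' : `|cl w - cl w'| <= `|w - w'|.
  apply: rV_norm_le => // i; rewrite rV_addE rV_oppE !clE.
  apply: le_trans (clamp_lip _ _ _ (ltW r0)) _.
  by have := rV_coord_le (w - w') i; rewrite !mxE.
have L0 i : 0 <= L i by have [B []] := hL i.
pose LL := 1 + \sum_i L i.
have LL0 : 0 < LL by rewrite ltr_wpDr // sumr_ge0.
have LLi i : L i <= LL.
  by rewrite /LL (bigD1 i) //= addrCA lerDl addr_ge0 // sumr_ge0.
have FL w w' : `|f (cl w) - f (cl w')| <= LL * `|w - w'|.
  apply: rV_norm_le => [|i]; first by rewrite mulr_ge0 // ltW.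
  have [B [_ _ h _]] := hL i; have := h _ _ (clS w) (clS w').
  rewrite !rV_addE !rV_oppE => k; apply: le_trans k _.
  by apply: ler_pM => //; exact: cl_lip.
have [d d0 [w [w00 dw]]] := picard_global w0 LL0 FL.
have wc i : {for 0, continuous (fun s => w s 0 i)}.
  by apply: is_derive_continuous (dw 0 _ i); rewrite normr0.
have h i : exists e, 0 < e /\ forall s, `|s| < e -> `|w s 0 i - w0 0 i| < r.
  have /continuous_epsP/(_ r r0) [e e0 he] := wc i.
  exists e; split => // s se; have := he s; rewrite subr0 w00; exact.
have [e he] := choice h.
pose del := Num.min d (\big[Num.min/1]_i e i).
have del0 : 0 < del.
  by rewrite lt_min d0; apply/bigmin_gtP; split => // i _; exact: (he i).1.
exists del => //; exists (fun t => lsubmx (w t)), (fun t => rsubmx (w t)).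
split; [by rewrite w00 row_mxKl|by rewrite w00 row_mxKr|] => t.
rewrite lt_min => /andP[td /bigmin_gtP [_ te]].
have wt i : `|w t 0 i - w0 0 i| < r by apply: (he i).2; exact: te.
have cw : cl (w t) = w t by apply/rowP => i; rewrite clE clamp_id // ltW.
have := dw t td; rewrite cw => dwt.
split.
- apply: hrU; have -> : x0 = lsubmx w0 by rewrite row_mxKl.
  apply: le_trans (lsub_lip _ _) _; apply: rV_norm_le => [|i]; first exact: ltW.
  by rewrite !rV_addE !rV_oppE ltW.
- move=> k; have := dwt (lshift n k); rewrite /f row_mxEl.
  suff -> : (fun s => lsubmx (w s) 0 k) = (fun s => w s 0 (lshift n k)) by [].
  by apply/funext => s; rewrite mxE.
- move=> k; have := dwt (rshift n k); rewrite /f row_mxEr [X in is_derive _ _ _ X]mxE.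
  suff -> : (fun s => rsubmx (w s) 0 k) = (fun s => w s 0 (rshift n k)) by [].
  by apply/funext => s; rewrite mxE.
Qed.

End GeodesicODE.

(** * Smooth functions along a geodesic, and the transformation law of Christoffel symbols *)

Section LineSmooth.
Context {R : realType}.
Implicit Types (J : set R) (f g : R -> R).

Lemma near_eq_open1 J f g (t : R) : open J -> J t -> (forall s, J s -> f s = g s) ->
  \near t, f t = g t.
Proof. by move=> oJ Jt h; apply: filterS (open_nbhs_nbhs (conj oJ Jt)) => y /h. Qed.

Lemma derive1n_eq J f g k : open J -> (forall s, J s -> f s = g s) ->
  forall s, J s -> derive1n k f s = derive1n k g s.
Proof.
move=> oJ h; elim: k => [|k IH] s Js; first by rewrite !derive1n0 h.
rewrite !derive1nS !derive1E; apply: near_eq_derive.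
exact: near_eq_open1 oJ Js IH.
Qed.

Lemma smooth_on_line_coind J (P : (R -> R) -> Prop) : open J ->
  (forall f, P f -> exists2 g, P g & forall t, J t -> is_derive t 1 f (g t)) ->
  forall f, P f -> smooth_on_line J f.
Proof.
move=> oJ Pd f Pf k; elim: k f Pf => [|k IH] f Pf t Jt.
  by have [g _ h] := Pd f Pf; have [] := h t Jt.
have [g Pg h] := Pd f Pf; have d := IH g Pg t Jt.
rewrite derive1Sn.
have e : forall s, J s -> g s = f^`()%classic s.
  by move=> s Js; have [_ <-] := h s Js; rewrite derive1E.
apply: near_eq_derivable d; apply: (near_eq_open1 oJ Jt).
exact: derive1n_eq oJ e.
Qed.

Lemma is_derive_addf (V : normedModType R) (f g : V -> R) (x v : V) df dg :
  is_derive x v f df -> is_derive x v g dg -> is_derive x v (fun y => f y + g y) (df + dg).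
Proof. exact: is_deriveD. Qed.

Lemma is_derive_mulf (V : normedModType R) (f g : V -> R) (x v : V) df dg :
  is_derive x v f df -> is_derive x v g dg ->
  is_derive x v (fun y => f y * g y) (df * g x + f x * dg).
Proof.
move=> hf hg; have := is_deriveM hf hg; rewrite /GRing.scale /= => h.
by apply: is_derive_eq h _; rewrite addrC; congr (_ + _); rewrite mulrC.
Qed.

Lemma is_derive_sumf (V : normedModType R) (I : finType) (f : I -> V -> R) (x v : V)
    (df : I -> R) :
  (forall i, is_derive x v (f i) (df i)) ->
  is_derive x v (fun y => \sum_i f i y) (\sum_i df i).
Proof.
move=> h; suff H (s : seq I) :
  is_derive x v (fun y => \sum_(i <- s) f i y) (\sum_(i <- s) df i) by exact: H.
elim: s => [|i s IH].
  rewrite big_nil; have -> : (fun y => \sum_(i <- [::]) f i y) = cst 0.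
    by apply/funext => y; rewrite big_nil.
  exact: is_derive_cst.
rewrite big_cons; have -> : (fun y => \sum_(j <- i :: s) f j y)
   = (fun y => f i y + \sum_(j <- s) f j y).
  by apply/funext => y; rewrite big_cons.
by apply: is_derive_addf.
Qed.

Section GeodesicExpr.
Context {n : nat} (J : set R) (U : set 'rV[R]_n).
Context (x v : R -> 'rV[R]_n) (Gam : 'I_n -> 'I_n -> 'I_n -> 'rV[R]_n -> R).
Hypotheses (oJ : open J) (oU : open U).
Hypothesis xU : forall t, J t -> U (x t).
Hypothesis sG : forall k a b, smooth_on U (Gam k a b).
Hypothesis dx : forall t : R, J t -> forall k, is_derive t 1 (fun s => x s 0 k) (v t 0 k).
Hypothesis dv : forall t : R, J t -> forall k, is_derive t 1 (fun s => v s 0 k)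
        (- \sum_a \sum_b Gam k a b (x t) * v t 0 a * v t 0 b).

(** Functions of the time built from the position, the velocity and smooth
    functions of the position: by the geodesic equation this class is closed under
    derivatives, hence consists of smooth functions. *)
Inductive curve_expr : (R -> R) -> Prop :=
| CurveAtom F : smooth_on U F -> curve_expr (fun t => F (x t))
| CurveVel k : curve_expr (fun t => v t 0 k)
| CurveCst c : curve_expr (fun=> c)
| CurveAdd f g : curve_expr f -> curve_expr g -> curve_expr (fun t => f t + g t)
| CurveMul f g : curve_expr f -> curve_expr g -> curve_expr (fun t => f t * g t).

Lemma curve_expr_sum (I : finType) (F : I -> R -> R) :
  (forall i, curve_expr (F i)) -> curve_expr (fun t => \sum_i F i t).
Proof.
move=> h; suff H (s : seq I) : curve_expr (fun t => \sum_(i <- s) F i t) by exact: H.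
elim: s => [|i s IH].
  have -> : (fun t => \sum_(i <- [::]) F i t) = (fun=> 0).
    by apply/funext => t; rewrite big_nil.
  exact: CurveCst.
have -> : (fun t => \sum_(j <- i :: s) F j t) = (fun t => F i t + \sum_(j <- s) F j t).
  by apply/funext => t; rewrite big_cons.
exact: CurveAdd.
Qed.

Lemma curve_chain F t : smooth_on U F -> J t ->
  is_derive (t : R) 1 (fun s => F (x s)) (\sum_a v t 0 a * partial a F (x t)).
Proof.
move=> sF Jt; apply: (chain_curve (c := x)) (dx Jt).
exact: smooth_on_C1 oU sF (xU Jt).
Qed.

Lemma curve_expr_smooth f : curve_expr f -> smooth_on_line J f.
Proof.
apply: smooth_on_line_coind => // {}f; elim => {f}.
- move=> F sF; exists (fun t => \sum_a v t 0 a * partial a F (x t)).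
    apply: curve_expr_sum => a; apply: CurveMul; first exact: CurveVel.
    exact/CurveAtom/smooth_on_partial.
  by move=> t; exact: curve_chain.
- move=> k; exists (fun t => -1 * \sum_a \sum_b Gam k a b (x t) * v t 0 a * v t 0 b).
    apply: CurveMul; first exact: CurveCst.
    apply: curve_expr_sum => a; apply: curve_expr_sum => b.
    apply: CurveMul; last exact: CurveVel.
    by apply: CurveMul; [exact: CurveAtom|exact: CurveVel].
  by move=> t Jt; rewrite mulN1r; exact: dv.
- move=> c; exists (fun=> 0); first exact: CurveCst.
  by move=> t _; exact: is_derive_cst.
- move=> f g _ [f' ef hf] _ [g' eg hg]; exists (fun t => f' t + g' t).
    exact: CurveAdd.
  by move=> t Jt; apply: is_derive_addf; [exact: hf|exact: hg].
- move=> f g ef [f' ef' hf] eg [g' eg' hg]; exists (fun t => f' t * g t + f t * g' t).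
    by apply: CurveAdd; exact: CurveMul.
  by move=> t Jt; apply: is_derive_mulf; [exact: hf|exact: hg].
Qed.

(** The second derivative of a function along a geodesic is its Hessian evaluated
    on the velocity. *)
Lemma curve_second F t : smooth_on U F -> J t ->
  is_derive (t : R) 1 (fun s => \sum_a v s 0 a * partial a F (x s))
   (\sum_a \sum_b (partial b (partial a F) (x t)
       - \sum_m Gam m a b (x t) * partial m F (x t)) * v t 0 a * v t 0 b).
Proof.
move=> sF Jt.
have h := is_derive_sumf (fun a =>
  is_derive_mulf (dv Jt a) (curve_chain (smooth_on_partial a sF) Jt)).
apply: is_derive_eq h _.
pose Q a b := v t 0 a * v t 0 b.
transitivity (\sum_a \sum_b (partial b (partial a F) (x t) * Q a b)
   - \sum_a \sum_b (\sum_m Gam m a b (x t) * partial m F (x t)) * Q a b).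
  rewrite big_split /= addrC; congr (_ + _).
    apply: eq_bigr => a _; rewrite mulr_sumr; apply: eq_bigr => b _; rewrite /Q; ring.
  rewrite -sumrN.
  transitivity (\sum_m \sum_a \sum_b - (Gam m a b (x t) * partial m F (x t) * Q a b)).
    apply: eq_bigr => m _; rewrite mulNr mulr_suml -sumrN; apply: eq_bigr => a _.
    rewrite mulr_suml -sumrN; apply: eq_bigr => b _; rewrite /Q; ring.
  rewrite exchange_big; apply: eq_bigr => a _ /=.
  rewrite exchange_big -sumrN; apply: eq_bigr => b _ /=.
  by rewrite mulr_suml -sumrN.
rewrite -sumrB; apply: eq_bigr => a _; rewrite -sumrB; apply: eq_bigr => b _.
rewrite /Q; ring.
Qed.

End GeodesicExpr.

End LineSmooth.

Section ChristoffelAlgebra.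
Context (R : realFieldType) (n : nat).

(** The formula for the Christoffel symbols as an algebraic function of the inverse
    metric and of the first derivatives of the metric. *)
Definition chr (Gi : 'M[R]_n) (dG : 'I_n -> 'I_n -> 'I_n -> R) (k a b : 'I_n) : R :=
  2^-1 * \sum_(l < n) Gi k l * (dG a b l + dG b a l - dG l a b).

Lemma chr_lower (G : 'M[R]_n) dG l a b : G \in unitmx ->
  \sum_k G l k * chr (invmx G) dG k a b = 2^-1 * (dG a b l + dG b a l - dG l a b).
Proof.
move=> uG; pose X := \col_l (dG a b l + dG b a l - dG l a b).
have e k : chr (invmx G) dG k a b = 2^-1 * (invmx G *m X) k 0.
  by rewrite /chr mxE; congr (_ * _); apply: eq_bigr => i _; rewrite mxE.
rewrite (eq_bigr (fun k => 2^-1 * (G l k * (invmx G *m X) k 0))); last first.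
  by move=> k _; rewrite e mulrCA.
rewrite -mulr_sumr; congr (_ * _).
have -> : \sum_k G l k * (invmx G *m X) k 0 = (G *m (invmx G *m X)) l 0 by rewrite [RHS]mxE.
by rewrite mulmxA mulmxV // mul1mx mxE.
Qed.

Context (G Gt Jm : 'M[R]_n) (dG dGt : 'I_n -> 'I_n -> 'I_n -> R)
  (H : 'I_n -> 'I_n -> 'I_n -> R).
Hypothesis (uG : G \in unitmx) (uGt : Gt \in unitmx).
Hypothesis symGt : Gt^T = Gt.
Hypothesis GE : G = Jm *m Gt *m Jm^T.
Hypothesis HC : forall a b p, H a b p = H b a p.
Hypothesis dGE : forall c a b, dG c a b = \sum_p \sum_q
   (H c a p * Gt p q * Jm b q + Jm a p * (\sum_r Jm c r * dGt r p q) * Jm b q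
    + Jm a p * Gt p q * H c b q).

Let B (u v : 'I_n -> R) := \sum_p \sum_q u p * Gt p q * v q.
Let dB (c a b : 'I_n) := \sum_p \sum_q Jm a p * (\sum_r Jm c r * dGt r p q) * Jm b q.

Let BC u v : B u v = B v u.
Proof.
rewrite /B exchange_big; apply: eq_bigr => q _; apply: eq_bigr => p _.
have -> : Gt p q = Gt q p by rewrite -{1}symGt mxE.
ring.
Qed.

(** The transformation law of the Christoffel symbols as pure algebra: [Jm] is the
    Jacobian, [H] the second derivatives of the change of coordinates, and
    [dGE] the derivative of the transformation law of the metric. Both sides are
    compared after lowering the free index, where [chr_lower] applies. *)
Lemma chr_transform a b k :
  \sum_m chr (invmx G) dG m a b * Jm m k
  = H a b k + \sum_c \sum_d chr (invmx Gt) dGt k c d * Jm a c * Jm b d.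
Proof.
have uJ : Jm \in unitmx by move: uG; rewrite GE !unitmx_mul => /andP[/andP[]].
pose X k := \sum_m chr (invmx G) dG m a b * Jm m k - H a b k
   - \sum_c \sum_d chr (invmx Gt) dGt k c d * Jm a c * Jm b d.
suff X0 : forall k, X k = 0 by have := X0 k; rewrite /X; lra.
have key l : B X (Jm l) = 0.
  have Bsum (I : finType) (F : I -> 'I_n -> R) (cf : I -> R) w :
      B (fun k => \sum_i cf i * F i k) w = \sum_i cf i * B (F i) w.
    rewrite /B; under eq_bigr do under eq_bigr do rewrite -mulrA mulr_suml.
    under [RHS]eq_bigr do rewrite mulr_sumr.
    rewrite [RHS]exchange_big /=; apply: eq_bigr => p _.
    under [RHS]eq_bigr do rewrite mulr_sumr.
    rewrite [RHS]exchange_big /=; apply: eq_bigr => q _.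
    apply: eq_bigr => i _; ring.
  pose X1 k := \sum_m chr (invmx G) dG m a b * Jm m k.
  pose X3 k := \sum_c \sum_d chr (invmx Gt) dGt k c d * Jm a c * Jm b d.
  have BX : B X (Jm l) = B X1 (Jm l) - B (H a b) (Jm l) - B X3 (Jm l).
    rewrite /B -!sumrB; apply: eq_bigr => p _; rewrite -!sumrB.
    apply: eq_bigr => q _; rewrite /X -/(X1 p) -/(X3 p); ring.
  have dG' c s t : dG c s t = B (H c s) (Jm t) + dB c s t + B (Jm s) (H c t).
    rewrite dGE /B /dB -!big_split; apply: eq_bigr => p _ /=.
    by rewrite -!big_split; apply: eq_bigr => q _ /=.
  have GB s t : G s t = B (Jm s) (Jm t).
    rewrite GE /B mxE [RHS]exchange_big; apply: eq_bigr => q _.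
    by rewrite [Jm^T _ _]mxE [(Jm *m Gt) _ _]mxE mulr_suml.
  have B1 : B X1 (Jm l) = 2^-1 * (dG a b l + dG b a l - dG l a b).
    rewrite /X1 Bsum -(chr_lower dG l a b uG).
    by apply: eq_bigr => m _; rewrite GB BC mulrC.
  have B3 : B X3 (Jm l) = 2^-1 * (dB a b l + dB b a l - dB l a b).
    pose T c d q (z : R) := Jm a c * Jm b d * Jm l q * z.
    have -> : B X3 (Jm l) = \sum_c \sum_d \sum_q
       T c d q (2^-1 * (dGt c d q + dGt d c q - dGt q c d)).
      transitivity (\sum_c \sum_d \sum_q \sum_p
         T c d q (Gt q p * chr (invmx Gt) dGt p c d)).
        rewrite /B /X3.
        transitivity (\sum_p \sum_q \sum_c \sum_d
           T c d q (Gt q p * chr (invmx Gt) dGt p c d)).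
          apply: eq_bigr => p _; apply: eq_bigr => q _.
          rewrite !mulr_suml; apply: eq_bigr => c _.
          rewrite !mulr_suml; apply: eq_bigr => d _; rewrite /T.
          have -> : Gt p q = Gt q p by rewrite -{1}symGt mxE.
          ring.
        transitivity (\sum_p \sum_c \sum_q \sum_d
           T c d q (Gt q p * chr (invmx Gt) dGt p c d)).
          by apply: eq_bigr => p _; rewrite exchange_big.
        rewrite exchange_big; apply: eq_bigr => c _ /=.
        transitivity (\sum_p \sum_d \sum_q
           T c d q (Gt q p * chr (invmx Gt) dGt p c d)).
          by apply: eq_bigr => p _; rewrite exchange_big.
        rewrite exchange_big; apply: eq_bigr => d _ /=.
        by rewrite exchange_big.
      apply: eq_bigr => c _; apply: eq_bigr => d _; apply: eq_bigr => q _.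
      by rewrite -(chr_lower dGt q c d uGt) /T mulr_sumr.
    have e1 : dB a b l = \sum_c \sum_d \sum_q T c d q (dGt c d q).
      transitivity (\sum_d \sum_q \sum_c T c d q (dGt c d q)).
        rewrite /dB; apply: eq_bigr => d _; apply: eq_bigr => q _.
        rewrite mulr_sumr mulr_suml; apply: eq_bigr => c _; rewrite /T; ring.
      rewrite [RHS]exchange_big; apply: eq_bigr => d _ /=.
      by rewrite [RHS]exchange_big.
    have e2 : dB b a l = \sum_c \sum_d \sum_q T c d q (dGt d c q).
      rewrite /dB; apply: eq_bigr => c _.
      rewrite [RHS]exchange_big; apply: eq_bigr => q _ /=.
      rewrite mulr_sumr mulr_suml; apply: eq_bigr => d _; rewrite /T; ring.
    have e3 : dB l a b = \sum_c \sum_d \sum_q T c d q (dGt q c d).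
      rewrite /dB; apply: eq_bigr => c _; apply: eq_bigr => d _.
      rewrite mulr_sumr mulr_suml; apply: eq_bigr => q _; rewrite /T; ring.
    rewrite e1 e2 e3 -sumrN -!big_split /= mulr_sumr; apply: eq_bigr => c _.
    rewrite -sumrN -!big_split /= mulr_sumr; apply: eq_bigr => d _.
    rewrite -sumrN -!big_split /= mulr_sumr; apply: eq_bigr => q _.
    rewrite /T; ring.
  rewrite BX B1 B3 !dG' (BC (Jm b) (H a l)) (BC (Jm a) (H b l)) (BC (Jm a) (H l b)).
  have hc1 : B (H l a) (Jm b) = B (H a l) (Jm b).
    by congr (B _ _); apply/funext => p; rewrite HC.
  have hc2 : B (H l b) (Jm a) = B (H b l) (Jm a).
    by congr (B _ _); apply/funext => p; rewrite HC.
  have hc3 : B (H b a) (Jm l) = B (H a b) (Jm l).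
    by congr (B _ _); apply/funext => p; rewrite HC.
  rewrite hc1 hc2 hc3; lra.
have e0 : (\row_k X k) *m (Gt *m Jm^T) = 0.
  apply/rowP => l; rewrite [RHS]mxE -[RHS](key l) mulmxA mxE /B.
  rewrite exchange_big; apply: eq_bigr => q _.
  rewrite !mxE mulr_suml; apply: eq_bigr => p _; by rewrite !mxE.
have uGJ : Gt *m Jm^T \in unitmx by rewrite unitmx_mul uGt unitmx_tr.
move=> s; have := congr1 (fun M => M *m invmx (Gt *m Jm^T)) e0.
by rewrite mulmxK // mul0mx => /rowP/(_ s); rewrite !mxE.
Qed.

End ChristoffelAlgebra.

(** * Change of chart *)

Section Charts.
Context {R : realType} {n : nat} (M : manifold R n).
Implicit Types (i j : atlas M).

Definition overlap i j : set 'rV[R]_n := chart i @` (dom i `&` dom j).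
Definition transition i j (x : 'rV[R]_n) := chart j (chart_inv i x).

Lemma chart_image_mem i p : dom i p -> chart_image i (chart i p).
Proof. by exists p. Qed.

Lemma chart_invK i x : chart_image i x -> dom i (chart_inv i x) /\ chart i (chart_inv i x) = x.
Proof. by case=> p dp <-; rewrite chartK. Qed.

Lemma chart_inv_continuous_at i x : chart_image i x ->
  {for x, continuous (chart_inv i : 'rV[R]_n -> M)}.
Proof.
move=> ix; have := @chart_inv_continuous _ _ M i.
rewrite continuous_open_subspace; last exact: chart_image_open.
by apply; rewrite inE.
Qed.

Lemma chart_continuous_at i p : dom i p -> {for p, continuous (chart i)}.
Proof.
move=> ip; have := @chart_continuous _ _ M i.
rewrite continuous_open_subspace; last exact: dom_open.
by apply; rewrite inE.
Qed.

Lemma overlapP i j x : overlap i j x <-> chart_image i x /\ dom j (chart_inv i x).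
Proof.
split; first by case=> p [ip jp] <-; split; [exact: chart_image_mem|rewrite chartK].
by move=> [ix jx]; have [h e] := chart_invK ix; exists (chart_inv i x).
Qed.

Lemma overlap_open i j : open (overlap i j).
Proof.
rewrite openE => x /overlapP [ix jx].
have h1 : nbhs x (chart_image i) by apply: open_nbhs_nbhs; split => //; exact: chart_image_open.
have h2 : nbhs x (chart_inv i @^-1` dom j).
  apply: chart_inv_continuous_at => //; apply: open_nbhs_nbhs; split => //.
  exact: dom_open.
by apply: filterS (filterI h1 h2) => y [iy jy]; apply/overlapP.
Qed.

Lemma transition_smooth_on i j k : smooth_on (overlap i j) (fun x => transition i j x 0 k).
Proof. exact: transition_smooth. Qed.

Lemma transition_image i j x : overlap i j x -> chart_image j (transition i j x).
Proof. by move=> /overlapP [_ jx]; exact: chart_image_mem. Qed.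

Context (g : metric M).

Lemma metric_transitionE i j x : overlap i j x ->
  g i x = transition_jacobian i j x *m g j (transition i j x)
        *m (transition_jacobian i j x)^T.
Proof.
case=> p [ip jp] <-; rewrite /transition chartK //; exact: metric_transition.
Qed.

Lemma transition_jacobian_unit i j x : overlap i j x -> transition_jacobian i j x \in unitmx.
Proof.
move=> h; have [ix _] := (overlapP i j x).1 h.
have := metric_nondegenerate g ix; rewrite (metric_transitionE h).
by rewrite !unitmx_mul => /andP[/andP[]].
Qed.

Theorem christoffel_transition i j k a b x : overlap i j x ->
  \sum_m christoffel (g i) m a b x * partial m (fun y => transition i j y 0 k) x
  = partial a (partial b (fun y => transition i j y 0 k)) x
   + \sum_c \sum_d christoffel (g j) k c d (transition i j x)
        * partial a (fun y => transition i j y 0 c) x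
        * partial b (fun y => transition i j y 0 d) x.
Proof.
move=> ov; have [ix _] := (overlapP i j x).1 ov.
have jx := transition_image ov.
have oU : open (overlap i j) by exact: overlap_open.
have oj : open (chart_image j) by exact: chart_image_open.
pose Jm := transition_jacobian i j x.
have JE c d : Jm c d = partial c (fun y => transition i j y 0 d) x by rewrite mxE.
pose H (c a p : 'I_n) := partial c (partial a (fun y => transition i j y 0 p)) x.
have HC a' b' p : H a' b' p = H b' a' p.
  by apply: (partialC a' b' oU _ ov); exact: transition_smooth_on.
have := @chr_transform R n (g i x) (g j (transition i j x)) Jm
  (fun c a b => partial c (fun y => g i y a b) x)
  (fun c a b => partial c (fun y => g j y a b) (transition i j x)) H
  (metric_nondegenerate g ix) (metric_nondegenerate g jx)
  (metric_sym g jx) (metric_transitionE ov) HC.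
have dG c s t : partial c (fun y => g i y s t) x = \sum_p \sum_q
   (H c s p * g j (transition i j x) p q * Jm t q
    + Jm s p * (\sum_r Jm c r * partial r (fun y => g j y p q) (transition i j x)) * Jm t q
    + Jm s p * g j (transition i j x) p q * H c t q).
  pose tr_ p := fun y => transition i j y 0 p.
  pose F y := \sum_p \sum_q (partial s (tr_ p) y * g j (transition i j y) p q
      * partial t (tr_ q) y).
  have e y : overlap i j y -> F y = g i y s t.
    move=> oy; rewrite (metric_transitionE oy) mxE /F exchange_big.
    apply: eq_bigr => q _; rewrite [(_ ^T) _ _]mxE [transition_jacobian _ _ _ t q]mxE.
    rewrite [(_ *m _) s q]mxE mulr_suml; apply: eq_bigr => p _.
    by rewrite [transition_jacobian _ _ _ _ _]mxE.
  have dF : is_derive x (delta_mx 0 c) F (\sum_p \sum_q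
     ((partial c (partial s (tr_ p)) x * g j (transition i j x) p q
       + partial s (tr_ p) x * (\sum_r partial c (tr_ r) x *
            partial r (fun y => g j y p q) (transition i j x))) * partial t (tr_ q) x
      + partial s (tr_ p) x * g j (transition i j x) p q * partial c (partial t (tr_ q)) x)).
    apply: is_derive_sumf => p; apply: is_derive_sumf => q.
    apply: is_derive_mulf; last first.
      apply: (smooth_on_is_derive (U := overlap i j)) => //.
      by apply: smooth_on_partial; exact: transition_smooth_on.
    apply: is_derive_mulf.
      apply: (smooth_on_is_derive (U := overlap i j)) => //.
      by apply: smooth_on_partial; exact: transition_smooth_on.
    apply: (@chain_partial _ _ _ (fun y => g j y p q) (transition i j)).
      apply: (smooth_on_C1 oj _ jx); exact: metric_smooth.
    move=> r; apply: (smooth_on_is_derive (U := overlap i j)) => //.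
    exact: transition_smooth_on.
  have -> : partial c (fun y => g i y s t) x = partial c F x.
    by apply: eq_partial oU ov _ => y oy; rewrite e.
  rewrite /partial (@derive_val _ _ _ _ _ _ _ dF).
  apply: eq_bigr => p _; apply: eq_bigr => q _; rewrite !JE /H.
  have -> : \sum_r Jm c r * partial r (fun y => g j y p q) (transition i j x)
    = \sum_r partial c (tr_ r) x * partial r (fun y => g j y p q) (transition i j x).
    by apply: eq_bigr => r _; rewrite JE.
  by rewrite -!/(partial _ _ _) /tr_; ring.
move=> /(_ dG a b k) h.
rewrite (eq_bigr (fun m => christoffel (g i) m a b x * Jm m k)) => [|m _]; last by rewrite JE.
rewrite [LHS]h; congr (_ + _); apply: eq_bigr => c _; apply: eq_bigr => d _.
by rewrite !JE.
Qed.

End Charts.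

Section AffineInvariance.
Context {R : realType} {n : nat} (M : manifold R n) (g h : metric M).

(** In the difference of two transformation laws the second derivatives of the
    change of coordinates cancel, so the difference of two connections is a tensor. *)
Lemma affine_at_transition (i j : atlas M) x : overlap i j x ->
  (forall k a b, christoffel (g i) k a b x = christoffel (h i) k a b x) ->
  forall k a b, christoffel (g j) k a b (transition i j x)
    = christoffel (h j) k a b (transition i j x).
Proof.
move=> ov e k; pose Jm := transition_jacobian i j x.
have uJ : Jm \in unitmx by exact: transition_jacobian_unit g _ _ _ ov.
pose X : 'M[R]_n := \matrix_(c, d) (christoffel (g j) k c d (transition i j x)
   - christoffel (h j) k c d (transition i j x)).
have X0 : Jm *m X *m Jm^T = 0.
  apply/matrixP => a b; rewrite [RHS]mxE.
  have hg := christoffel_transition g k a b ov.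
  have hh := christoffel_transition h k a b ov.
  have : \sum_c \sum_d christoffel (g j) k c d (transition i j x)
        * partial a (fun y => transition i j y 0 c) x
        * partial b (fun y => transition i j y 0 d) x
     - \sum_c \sum_d christoffel (h j) k c d (transition i j x)
        * partial a (fun y => transition i j y 0 c) x
        * partial b (fun y => transition i j y 0 d) x = 0.
    apply/eqP; rewrite subr_eq0; apply/eqP.
    apply: (addrI (partial a (partial b (fun y => transition i j y 0 k)) x)).
    by rewrite -hg -hh; apply: eq_bigr => m _; rewrite e.
  move=> <-; rewrite -sumrB mxE.
  rewrite (eq_bigr (fun d => \sum_c Jm a c * X c d * Jm b d)); last first.
    by move=> d _; rewrite [Jm^T _ _]mxE [(_ *m X) _ _]mxE mulr_suml.
  rewrite exchange_big; apply: eq_bigr => c _; rewrite -sumrB; apply: eq_bigr => d _.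
  rewrite [X _ _]mxE [Jm a c]mxE [Jm b d]mxE; ring.
have : X = 0.
  have uJT : Jm^T \in unitmx by rewrite unitmx_tr.
  have := congr1 (fun N => invmx Jm *m N *m invmx Jm^T) X0.
  by rewrite -!mulmxA mulmxV // mulmx1 mulKmx // mul0mx mulmx0.
by move=> X00 c d; move/matrixP/(_ c d)/eqP: X00; rewrite !mxE subr_eq0 => /eqP.
Qed.

End AffineInvariance.

(** * Smoothness of inverse matrices and Christoffel symbols *)

Section SmoothInverse.
Context {R : realType} {n : nat} (U : set 'rV[R]_n).
Hypothesis oU : open U.

Lemma smooth_expr_sum (I : finType) (F : I -> 'rV[R]_n -> R) :
  (forall i, smooth_expr U (F i)) -> smooth_expr U (fun x => \sum_i F i x).
Proof.
move=> h; suff H (s : seq I) : smooth_expr U (fun x => \sum_(i <- s) F i x) by exact: H.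
elim: s => [|i s IH].
  have -> : (fun x => \sum_(i <- [::]) F i x) = (fun=> 0).
    by apply/funext => x; rewrite big_nil.
  exact: SmoothCst.
have -> : (fun x => \sum_(j <- i :: s) F j x) = (fun x => F i x + \sum_(j <- s) F j x).
  by apply/funext => x; rewrite big_cons.
exact: SmoothAdd.
Qed.

Lemma smooth_expr_prod (I : finType) (F : I -> 'rV[R]_n -> R) :
  (forall i, smooth_expr U (F i)) -> smooth_expr U (fun x => \prod_i F i x).
Proof.
move=> h; suff H (s : seq I) : smooth_expr U (fun x => \prod_(i <- s) F i x) by exact: H.
elim: s => [|i s IH].
  have -> : (fun x => \prod_(i <- [::]) F i x) = (fun=> 1).
    by apply/funext => x; rewrite big_nil.
  exact: SmoothCst.
have -> : (fun x => \prod_(j <- i :: s) F j x) = (fun x => F i x * \prod_(j <- s) F j x).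
  by apply/funext => x; rewrite big_cons.
exact: SmoothMul.
Qed.

Lemma smooth_expr_det m (F : 'rV[R]_n -> 'M[R]_m) :
  (forall i j, smooth_expr U (fun x => F x i j)) -> smooth_expr U (fun x => \det (F x)).
Proof.
move=> h; rewrite /determinant.
apply: smooth_expr_sum => s; apply: SmoothMul; first exact: SmoothCst.
by apply: smooth_expr_prod.
Qed.

(** By Cramer's rule. *)
Lemma smooth_invmx m (F : 'rV[R]_n -> 'M[R]_m) i j :
  (forall i j, smooth_on U (fun x => F x i j)) -> (forall x, U x -> F x \in unitmx) ->
  smooth_on U (fun x => invmx (F x) i j).
Proof.
move=> sF uF.
have eF a b : smooth_expr U (fun x => F x a b) by exact/SmoothAtom/sF.
apply: (@smooth_on_ext _ _ U (fun x => (\det (F x))^-1 * \adj (F x) i j)) => //.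
  by move=> x Ux; rewrite /invmx (uF x Ux) [RHS]mxE.
apply: smooth_exprP => //; apply: SmoothMul.
  apply: SmoothInv; first exact: smooth_expr_det.
  by move=> x Ux; have := uF x Ux; rewrite unitmxE unitfE.
have -> : (fun x => \adj (F x) i j) = (fun x => (-1) ^+ (j + i) * \det (row' j (col' i (F x)))).
  by apply/funext => x; rewrite mxE.
apply: SmoothMul; first exact: SmoothCst.
apply: smooth_expr_det => a b.
have -> : (fun x => row' j (col' i (F x)) a b) = (fun x => F x (lift j a) (lift i b)).
  by apply/funext => x; rewrite !mxE.
exact: eF.
Qed.

Lemma smooth_christoffel (G : 'rV[R]_n -> 'M[R]_n) k a b :
  (forall i j, smooth_on U (fun x => G x i j)) -> (forall x, U x -> G x \in unitmx) ->
  smooth_on U (christoffel G k a b).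
Proof.
move=> sG uG; rewrite /christoffel; apply: smooth_exprP => //.
apply: SmoothMul; first exact: SmoothCst.
apply: smooth_expr_sum => l; apply: SmoothMul.
  by apply: SmoothAtom; exact: smooth_invmx.
have sp c s t : smooth_expr U (partial c (fun y => G y s t)).
  by apply: SmoothAtom; exact/smooth_on_partial/sG.
have -> : (fun x => partial a (fun y => G y b l) x + partial b (fun y => G y a l) x -
    partial l (fun y => G y a b) x) = (fun x => (partial a (fun y => G y b l) x +
    partial b (fun y => G y a l) x) + -1 * partial l (fun y => G y a b) x).
  by apply/funext => x; rewrite mulN1r.
apply: SmoothAdd; first exact: SmoothAdd (sp _ _ _) (sp _ _ _).
exact: SmoothMul (SmoothCst _ _) (sp _ _ _).
Qed.

End SmoothInverse.

(** * Geodesics from solutions in a chart *)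

Section GeodesicCurve.
Context {R : realType} {n : nat} (M : manifold R n) (g : metric M) (i : atlas M).
Context (x v : R -> 'rV[R]_n) (del : R).
Hypothesis del0 : 0 < del.
Hypothesis xU : forall t : R, `|t| < del -> chart_image i (x t).
Hypothesis dx : forall t : R, `|t| < del -> forall k, is_derive t 1 (fun s => x s 0 k) (v t 0 k).
Hypothesis dv : forall t : R, `|t| < del -> forall k, is_derive t 1 (fun s => v s 0 k)
        (- \sum_a \sum_b christoffel (g i) k a b (x t) * v t 0 a * v t 0 b).
Hypothesis vn0 : forall t : R, `|t| < del -> v t != 0.

Definition open_itv : set R := [set t | `|t| < del].
Definition geo_curve (t : R) : M := chart_inv i (x t).

Lemma open_itv_open : open open_itv.
Proof.
have -> : open_itv = [set t : R | `|t - 0| < del] by apply/seteqP; split => t; rewrite /open_itv /= subr0.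
exact: (@norm_ball_open R R^o).
Qed.

Lemma open_itv_interval : is_interval open_itv.
Proof.
move=> a b ha hb c /andP[ac cb]; move: ha hb; rewrite /open_itv /= !ltr_norml.
move=> /andP[a1 a2] /andP[b1 b2]; apply/andP; split.
  exact: lt_le_trans a1 ac.
exact: le_lt_trans cb b2.
Qed.

Lemma geo_continuous t : open_itv t -> {for t, continuous x}.
Proof.
move=> td; apply/continuous_epsP => e e0.
have h a : exists d', 0 < d' /\ forall s, `|s - t| < d' -> `|x s 0 a - x t 0 a| < e.
  have /continuous_epsP/(_ e e0) [d' d'0 hd'] := is_derive_continuous (dx td a).
  by exists d'.
have [D hD] := choice h.
exists (\big[Num.min/1]_a D a).
  by apply/bigmin_gtP; split => // a _; exact: (hD a).1.
move=> s /bigmin_gtP [_ hs]; apply: rV_norm_lt => // a.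
by rewrite rV_addE rV_oppE; apply: (hD a).2; exact: hs.
Qed.

Lemma geo_overlap j t : open_itv t -> dom j (geo_curve t) -> overlap i j (x t).
Proof. by move=> td jt; apply/overlapP; split; [exact: xU|]. Qed.

Let J' j : set R := open_itv `&` geo_curve @^-1` dom j.

Lemma J'_open j : open (J' j).
Proof.
rewrite openE => t [td jt].
have h1 : nbhs t open_itv by apply: open_nbhs_nbhs; split => //; exact: open_itv_open.
have h2 : nbhs t (x @^-1` overlap i j).
  apply: (geo_continuous td); apply: open_nbhs_nbhs; split; first exact: overlap_open.
  exact: geo_overlap.
by apply: filterS (filterI h1 h2) => s [sd /overlapP [_ js]].
Qed.

Let sG j k a b : smooth_on (overlap i j) (christoffel (g i) k a b).
Proof.
apply: (@smooth_on_sub _ _ (chart_image i)); first by move=> y /overlapP [].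
apply: smooth_christoffel; first exact: chart_image_open.
  exact: metric_smooth.
by move=> y; exact: metric_nondegenerate.
Qed.

Lemma coordE j k : coord j geo_curve k = fun t => transition i j (x t) 0 k.
Proof. by []. Qed.

Lemma geo_smooth_curve : smooth_curve open_itv geo_curve.
Proof.
split.
  move=> t td; apply: (@continuous_comp _ _ _ x (chart_inv i)).
    exact: geo_continuous.
  exact: chart_inv_continuous_at (xU td).
move=> j k; rewrite coordE.
apply: (@curve_expr_smooth _ _ (J' j) (overlap i j) x v (christoffel (g i))).
- exact: J'_open.
- exact: overlap_open.
- by move=> t [td jt]; exact: geo_overlap.
- exact: sG.
- by move=> t [td _]; exact: dx.
- by move=> t [td _]; exact: dv.
- by apply: (@CurveAtom _ _ _ x v (fun y => transition i j y 0 k)); exact: transition_smooth_on.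
Qed.

Let tau j k (y : 'rV[R]_n) := transition i j y 0 k.

Lemma geo_derive1 j k t : J' j t ->
  is_derive (t : R) 1 (coord j geo_curve k) (\sum_a v t 0 a * partial a (tau j k) (x t)).
Proof.
move=> Jt; rewrite coordE.
have oo : open (overlap i j) by exact: overlap_open.
exact: (@curve_chain _ _ (J' j) (overlap i j) x v oo
  (fun s hs => @geo_overlap j s hs.1 hs.2) (fun s hs => dx hs.1)
  (tau j k) t (transition_smooth_on k) Jt).
Qed.

Lemma geo_derive2 j k t : J' j t ->
  is_derive (t : R) 1 (derive1 (coord j geo_curve k))
   (\sum_a \sum_b (partial b (partial a (tau j k)) (x t)
       - \sum_m christoffel (g i) m a b (x t) * partial m (tau j k) (x t))
          * v t 0 a * v t 0 b).
Proof.
move=> Jt.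
have oo : open (overlap i j) by exact: overlap_open.
have h := @curve_second _ _ (J' j) (overlap i j) x v (christoffel (g i)) oo
  (fun s hs => @geo_overlap j s hs.1 hs.2) (fun s hs => dx hs.1) (fun s hs => dv hs.1)
  (tau j k) t (transition_smooth_on k) Jt.
apply: near_eq_is_derive h; apply: near_eq_open1 (@J'_open j) Jt _ => s Js.
by have [_ e] := geo_derive1 k Js; rewrite derive1E -e.
Qed.

(** In the chart [i] this is the equation satisfied by [x] and [v]. In the other
    charts the second derivative is computed with [geo_derive2] and the second
    derivatives of the transition map are eliminated through
    [christoffel_transition]. *)
Lemma geo_geodesic : geodesic g open_itv geo_curve.
Proof.
split; first exact: geo_smooth_curve.
move=> t j td jt; have Jt : J' j t by [].
have ov := geo_overlap td jt.
have oo : open (overlap i j) by exact: overlap_open.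
have d1 k : derive1 (coord j geo_curve k) t = \sum_a v t 0 a * partial a (tau j k) (x t).
  by have [_ e] := geo_derive1 k Jt; rewrite derive1E e.
split.
  apply/not_existsP => h.
  have z k : derive1 (coord j geo_curve k) t = 0.
    by apply/eqP; apply: contra_notT (h k).
  have := vn0 td; apply/negP; rewrite negbK.
  have uJ := transition_jacobian_unit g ov.
  apply/eqP; apply: (can_inj (mulmxK uJ)); rewrite mul0mx.
  apply/rowP => k; rewrite [RHS]mxE -(z k) d1 mxE; apply: eq_bigr => a _.
  by rewrite mxE.
move=> k.
have -> : derive1n 2 (coord j geo_curve k) t = \sum_a \sum_b
   (partial b (partial a (tau j k)) (x t)
       - \sum_m christoffel (g i) m a b (x t) * partial m (tau j k) (x t))
          * v t 0 a * v t 0 b.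
  by have [_ <-] := geo_derive2 k Jt; rewrite derive1nS derive1n1 derive1E.
have -> : chart j (geo_curve t) = transition i j (x t) by [].
pose Q c d a b := christoffel (g j) k c d (transition i j (x t))
        * partial a (tau j c) (x t) * partial b (tau j d) (x t) * v t 0 a * v t 0 b.
have -> : \sum_a \sum_b (partial b (partial a (tau j k)) (x t)
       - \sum_m christoffel (g i) m a b (x t) * partial m (tau j k) (x t))
          * v t 0 a * v t 0 b = - \sum_a \sum_b \sum_c \sum_d Q c d a b.
  rewrite -sumrN; apply: eq_bigr => a _; rewrite -sumrN; apply: eq_bigr => b _.
  rewrite (christoffel_transition g k a b ov).
  have -> : partial b (partial a (tau j k)) (x t) = partial a (partial b (tau j k)) (x t).
    by apply: (partialC b a oo _ ov); exact: transition_smooth_on.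
  rewrite opprD addrA subrr add0r mulNr mulNr; congr (- _).
  rewrite !mulr_suml; apply: eq_bigr => c _; rewrite !mulr_suml; apply: eq_bigr => d _.
  by [].
rewrite addrC; apply/eqP; rewrite subr_eq0; apply/eqP.
transitivity (\sum_c \sum_d \sum_a \sum_b Q c d a b).
  apply: eq_bigr => c _; apply: eq_bigr => d _; rewrite !d1.
  rewrite -mulrA mulr_suml mulr_sumr; apply: eq_bigr => a _.
  rewrite !mulr_sumr; apply: eq_bigr => b _; rewrite /Q; ring.
rewrite (eq_bigr (fun c => \sum_a \sum_d \sum_b Q c d a b)); last first.
  by move=> c _; rewrite exchange_big.
rewrite exchange_big /=; apply: eq_bigr => a _.
rewrite (eq_bigr (fun c => \sum_b \sum_d Q c d a b)); last first.
  by move=> c _; rewrite exchange_big.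
by rewrite exchange_big.
Qed.

End GeodesicCurve.

(** * Projectively equivalent metrics have projectively related connections *)

Section GeodesicExistence.
Context {R : realType} {n : nat} (M : manifold R n) (g : metric M) (i : atlas M).

Lemma smooth_christoffel_metric k a b : smooth_on (chart_image i) (christoffel (g i) k a b).
Proof.
apply: smooth_christoffel; first exact: chart_image_open.
  exact: metric_smooth.
by move=> y; exact: metric_nondegenerate.
Qed.

(** The velocity does not vanish near the initial time, by continuity; constant
    curves are not geodesics. *)
Lemma geodesic_exists (x0 v0 : 'rV[R]_n) : chart_image i x0 -> v0 != 0 ->
  exists2 J : set R, [/\ open J, is_interval J & J 0] &
  exists2 c : R -> M, geodesic g J c &
  exists x v : R -> 'rV[R]_n, [/\ x 0 = x0, v 0 = v0 & forall t : R, J t ->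
    [/\ dom i (c t), chart i (c t) = x t,
      forall k, is_derive t 1 (fun s => x s 0 k) (v t 0 k) &
      forall k, is_derive t 1 (fun s => v s 0 k)
        (- \sum_a \sum_b christoffel (g i) k a b (x t) * v t 0 a * v t 0 b)]].
Proof.
move=> ix0 v0n.
have oi : open (chart_image i) by exact: chart_image_open.
have [d d0 [x [v [x0E v0E h]]]] := geodesic_ode oi smooth_christoffel_metric v0 ix0.
have [k vk] : exists k, v 0 0 k != 0.
  apply/not_existsP => z; move: v0n; rewrite -v0E => /negP; apply; apply/eqP/rowP => k.
  by rewrite mxE; apply/eqP; apply: contra_notT (z k).
have [d1 d10 hd1] : exists2 d1, 0 < d1 & forall t : R, `|t| < d1 -> v t 0 k != 0.
  have hz : `|0 : R| < d by rewrite normr0.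
  have [_ _ /(_ k) dvk] := h 0 hz.
  have vk0 : 0 < `|v 0 0 k| by rewrite normr_gt0.
  have /continuous_epsP/(_ _ vk0) [d1 d10 hd1] := is_derive_continuous dvk.
  exists d1 => // t td; have := hd1 t; rewrite subr0 => /(_ td).
  by apply: contraTneq => ->; rewrite sub0r normrN ltxx.
pose e := Num.min d d1.
have e0 : 0 < e by rewrite lt_min d0.
have ed (t : R) : `|t| < e -> `|t| < d by rewrite lt_min => /andP[].
have h1 (t : R) (te : `|t| < e) : chart_image i (x t) by have [] := h t (ed t te).
have h2 (t : R) (te : `|t| < e) : forall k, is_derive t 1 (fun s => x s 0 k) (v t 0 k).
  by have [] := h t (ed t te).
have h3 (t : R) (te : `|t| < e) : forall k, is_derive t 1 (fun s => v s 0 k)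
        (- \sum_a \sum_b christoffel (g i) k a b (x t) * v t 0 a * v t 0 b).
  by have [] := h t (ed t te).
have h4 (t : R) (te : `|t| < e) : v t != 0.
  have te1 : `|t| < d1 by move: te; rewrite lt_min => /andP[].
  by apply: contraNneq (hd1 t te1) => ->; rewrite mxE.
exists (open_itv e).
  split; [exact: open_itv_open|exact: open_itv_interval|by rewrite /open_itv /= normr0].
exists (geo_curve i x); first exact: (@geo_geodesic _ _ _ _ _ x v e).
exists x, v; split => // t te; have [di ci] := chart_invK (h1 t te).
by split; [exact: di|exact: ci|exact: h2|exact: h3].
Qed.

End GeodesicExistence.

Section Projective.
Context {R : realType} {n : nat} (M : manifold R n) (g h : metric M).
Hypothesis hproj : projectively_equivalent g h.

Lemma is_derive_comp1 (f th : R -> R) (t l m : R) :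
  is_derive (th t) 1 f m -> is_derive t 1 th l -> is_derive t 1 (fun s => f (th s)) (m * l).
Proof. exact: is_derive_comp_outer. Qed.

(** The geodesic of [g] with initial velocity [v0] is c0 o theta for a geodesic c0
    of [h]. At the initial time the two geodesic equations differ by the second
    derivative of theta, which contributes a multiple of the velocity. *)
Theorem christoffel_radial i x0 (v0 : 'rV[R]_n) j k : chart_image i x0 ->
  let T a b k := christoffel (h i) k a b x0 - christoffel (g i) k a b x0 in
  v0 0 j * quad T v0 k = v0 0 k * quad T v0 j.
Proof.
move=> ix0 T.
have [->|v0n] := eqVneq v0 0; first by rewrite !mxE !mul0r.
have [J [oJ iJ J0] [c gc [x [v [x0E v0E hx]]]]] := geodesic_exists g ix0 v0n.
have ug : unparametrized_geodesic g J c.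
  exists J, c, id; split => //.
  - split; last by move=> t _; rewrite derive1E derive_id oner_eq0.
    have smc := @smooth_on_line_coind R J (fun f => f = id \/ exists a, f = cst a) oJ.
    apply: smc; last by left.
    move=> f [->|[a ->]].
      by exists (cst 1); [right; exists 1|move=> t _; exact: is_derive_id].
    by exists (cst 0); [right; exists 0|move=> t _; exact: is_derive_cst].
  - by rewrite image_id.
have [I [c0 [th [[oI _] [[_ smc0] geo] [sth _] thJ cth]]]] := (hproj c oJ iJ).1 ug.
have thI t : J t -> I (th t) by move=> Jt; rewrite -thJ; exists t.
have dth t (Jt : J t) : is_derive (t : R) 1 th (derive1 th t).
  by rewrite derive1E; apply: derivableP; exact: sth 0%N t Jt.
have ddth t (Jt : J t) : is_derive (t : R) 1 (derive1 th) (derive1n 2 th t).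
  by rewrite derive1nS derive1n1 derive1E; apply: derivableP; have := sth 1%N t Jt; rewrite derive1n1.
pose y k := coord i c0 k.
have Ji t (Jt : J t) : dom i (c0 (th t)) by rewrite -cth //; have [] := hx t Jt.
have dy t (Jt : J t) k' : is_derive (th t) 1 (y k') (derive1 (y k') (th t)).
  by rewrite derive1E; apply: derivableP; apply: (smc0 i k' 0%N); split; [exact: thI|exact: Ji].
have ddy t (Jt : J t) k' : is_derive (th t) 1 (derive1 (y k')) (derive1n 2 (y k') (th t)).
  rewrite derive1nS derive1n1 derive1E; apply: derivableP; rewrite -[derive1 (y k')]derive1n1.
  by apply: (smc0 i k' 1%N); split; [exact: thI|exact: Ji].
have xy t (Jt : J t) k' : x t 0 k' = y k' (th t).
  by rewrite /y /coord -cth //; have [_ -> _ _] := hx t Jt.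
have vy t (Jt : J t) k' : v t 0 k' = derive1 (y k') (th t) * derive1 th t.
  have [_ _ dxk _] := hx t Jt.
  have [_ <-] := dxk k'.
  have dk := is_derive_comp1 (dy t Jt k') (dth t Jt).
  have [_ <-] := near_eq_is_derive (near_eq_open1 oJ Jt (fun s Js => esym (xy s Js k'))) dk.
  by [].
(* The geodesic equation of g at time 0, with the chain rule on the right. *)
have ay k' : - \sum_a \sum_b christoffel (g i) k' a b x0 * v0 0 a * v0 0 b
   = derive1n 2 (y k') (th 0) * derive1 th 0 * derive1 th 0
     + derive1 (y k') (th 0) * derive1n 2 th 0.
  have [_ _ _ /(_ k') [_ dvk]] := hx 0 J0.
  rewrite -x0E -v0E -dvk.
  have dk := is_derive_mulf (is_derive_comp1 (ddy 0 J0 k') (dth 0 J0)) (ddth 0 J0).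
  by have [_ <-] := near_eq_is_derive (near_eq_open1 oJ J0 (fun s Js => esym (vy s Js k'))) dk.
have gy k' : derive1n 2 (y k') (th 0) = - \sum_a \sum_b christoffel (h i) k' a b x0
    * derive1 (y a) (th 0) * derive1 (y b) (th 0).
  have [_ /(_ k') /eqP] := geo (th 0) i (thI 0 J0) (Ji 0 J0).
  rewrite addr_eq0 => /eqP ->; rewrite -(cth 0 J0).
  by have [_ -> _ _] := hx 0 J0; rewrite x0E.
have Q k' : quad T v0 k' = derive1 (y k') (th 0) * derive1n 2 th 0.
  have -> : quad T v0 k' = \sum_a \sum_b christoffel (h i) k' a b x0 * v0 0 a * v0 0 b
     - \sum_a \sum_b christoffel (g i) k' a b x0 * v0 0 a * v0 0 b.
    rewrite -sumrB; apply: eq_bigr => a _; rewrite -sumrB; apply: eq_bigr => b _.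
    by rewrite /T; ring.
  rewrite ay gy.
  have -> : \sum_a \sum_b christoffel (h i) k' a b x0 * v0 0 a * v0 0 b =
     (\sum_a \sum_b christoffel (h i) k' a b x0 * derive1 (y a) (th 0) * derive1 (y b) (th 0))
       * derive1 th 0 * derive1 th 0.
    rewrite !mulr_suml; apply: eq_bigr => a _; rewrite !mulr_suml; apply: eq_bigr => b _.
    by rewrite -v0E !(vy 0 J0); ring.
  by ring.
by rewrite !Q -v0E !(vy 0 J0); ring.
Qed.

Corollary christoffel_projective i x0 p a m : chart_image i x0 ->
  let phi c := (christoffel (h i) c c c x0 - christoffel (g i) c c c x0) / 2 in
  christoffel (h i) m p a x0 = christoffel (g i) m p a x0
     + phi a * (p == m)%:R + phi p * (a == m)%:R.
Proof.
move=> ix0 phi; pose T a b k := christoffel (h i) k a b x0 - christoffel (g i) k a b x0.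
have symC (k : metric M) q c d : christoffel (k i) q c d x0 = christoffel (k i) q d c x0.
  rewrite /christoffel; congr (_ * _); apply: eq_bigr => l _; congr (_ * (_ - _)).
    by rewrite addrC.
  have oi : open (chart_image i) by exact: chart_image_open.
  apply: (eq_partial l oi ix0) => z iz.
  by rewrite -[in LHS](metric_sym k iz) mxE.
have TC c d q : T c d q = T d c q by rewrite /T !(symC _ q c d).
have := radial_tensor TC (fun v0 j k => christoffel_radial v0 j k ix0) p a m.
by rewrite /T /phi => /eqP; rewrite subr_eq => /eqP ->; ring.
Qed.

End Projective.

(** * Local geometry over the ring of smooth functions *)

Section LocalMetric.
Context {R : realType} {n : nat} (M : manifold R n) (i : atlas M) (V : region R n).
Hypothesis VU : forall x, V x -> chart_image i x.

Section OneMetric.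
Context (g : metric M).

Let subV F : smooth_on (chart_image i) F -> smooth_on V F.
Proof. by apply: smooth_on_sub => x; exact: VU. Qed.

Let s_metric a b : smooth_on V (fun x => g i x a b).
Proof. exact/subV/metric_smooth. Qed.

Let s_inv a b : smooth_on V (fun x => invmx (g i x) a b).
Proof.
apply: smooth_invmx; first exact: region_open.
  exact: s_metric.
by move=> x Vx; exact/metric_nondegenerate/VU.
Qed.

Let s_chr p a m : smooth_on V (christoffel (g i) m p a).
Proof. exact/subV/smooth_christoffel_metric. Qed.

Definition gS a b : sfun V := mksfun (s_metric a b).
Definition giS a b : sfun V := mksfun (s_inv a b).
Definition GamS p a m : sfun V := mksfun (s_chr p a m).

Lemma ev_gS a b x : V x -> sval_ (gS a b) x = g i x a b.
Proof. exact: mksfunE. Qed.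
Lemma ev_giS a b x : V x -> sval_ (giS a b) x = invmx (g i x) a b.
Proof. exact: mksfunE. Qed.
Lemma ev_GamS p a m x : V x -> sval_ (GamS p a m) x = christoffel (g i) m p a x.
Proof. exact: mksfunE. Qed.

Lemma ev_sderiv_gS q a b x : V x ->
  sval_ (sderiv q (gS a b)) x = partial q (fun y => g i y a b) x.
Proof. exact: sderiv_mk. Qed.

Lemma ev_sderiv_GamS q p a m x : V x ->
  sval_ (sderiv q (GamS p a m)) x = partial q (christoffel (g i) m p a) x.
Proof. exact: sderiv_mk. Qed.

Opaque gS giS GamS.

Lemma metric_symE x a b : chart_image i x -> g i x a b = g i x b a.
Proof. by move=> ix; rewrite -[in LHS](metric_sym g ix) mxE. Qed.

Lemma partial_metricC c a b x : chart_image i x ->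
  partial c (fun y => g i y a b) x = partial c (fun y => g i y b a) x.
Proof.
move=> ix; have oi : open (chart_image i) by exact: chart_image_open.
by apply: (eq_partial c oi ix) => y; exact: metric_symE.
Qed.

Lemma christoffelC k a b x : chart_image i x ->
  christoffel (g i) k a b x = christoffel (g i) k b a x.
Proof.
move=> ix; rewrite /christoffel; congr (_ * _); apply: eq_bigr => l _; congr (_ * (_ - _)).
  by rewrite addrC.
exact: partial_metricC.
Qed.

(** The Christoffel symbols of the metric satisfy the axioms of the abstract
    calculus. *)
Lemma levi_civita_sfun : levi_civita (@sderiv _ _ V) gS giS GamS.
Proof.
split=> [a b|a b|a b|p a m|p a b]; apply: sfunP => x Vx; have ix := VU Vx.
- by rewrite !ev_gS // metric_symE.
- by rewrite !ev_giS // -[in LHS](metric_sym g ix) -trmx_inv mxE.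
- rewrite ev_sum // ev_delta //.
  have := mulVmx (metric_nondegenerate g ix) => /matrixP/(_ a b).
  by rewrite !mxE => <-; apply: eq_bigr => m _; rewrite evM // ev_giS // ev_gS.
- by rewrite !ev_GamS // christoffelC.
- rewrite (evD Vx) !(ev_sum Vx) (ev_sderiv_gS _ _ _ Vx).
  have uG := metric_nondegenerate g ix.
  pose dG c s t := partial c (fun y => g i y s t) x.
  have h1 := chr_lower dG b p a uG; have h2 := chr_lower dG a p b uG.
  have -> : \sum_m sval_ (GamS p a m * gS m b) x
      = 2^-1 * (dG p a b + dG a p b - dG b p a).
    rewrite -h1; apply: eq_bigr => m _.
    by rewrite evM // ev_GamS // ev_gS // mulrC (metric_symE m).
  have -> : \sum_m sval_ (GamS p b m * gS a m) x
      = 2^-1 * (dG p b a + dG b p a - dG a p b).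
    rewrite -h2; apply: eq_bigr => m _.
    by rewrite evM // ev_GamS // ev_gS // mulrC.
  have -> : dG p b a = dG p a b by exact: partial_metricC.
  by rewrite -/(dG p a b); field.
Qed.

Lemma ev_riem d c a l x : V x ->
  sval_ (riem (@sderiv _ _ V) GamS d c a l) x = riemann (g i) l a d c x.
Proof.
move=> Vx; rewrite /riem.
rewrite (evD Vx).
rewrite (evB Vx).
rewrite (ev_sum Vx).
have e1 := ev_sderiv_GamS d c a l Vx.
have e2 := ev_sderiv_GamS c d a l Vx.
apply: (@etrans _ _ (partial d (christoffel (g i) l c a) x - partial c (christoffel (g i) l d a) x + \sum_(m < n) sval_ (GamS d m l * GamS c a m - GamS c m l * GamS d a m) x)).
  exact: (congr2 +%R (congr2 (fun u v => u - v) e1 e2) erefl).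
rewrite /riemann.
congr (_ + _).
apply: eq_bigr => m _; rewrite (evB Vx) !(evM Vx).
by rewrite !(ev_GamS _ _ _ Vx).
Qed.

End OneMetric.

Section TwoMetrics.
Context (g h : metric M).
Hypothesis hproj : projectively_equivalent g h.
Local Notation D := (@sderiv _ _ V).
Let HD := sderiv_commuting V.
Context (gs gis hs his : 'I_n -> 'I_n -> sfun V) (Gg Gh : 'I_n -> 'I_n -> 'I_n -> sfun V).
Hypotheses (HG : levi_civita D gs gis Gg) (HH : levi_civita D hs his Gh).
Hypothesis ev_Gg : forall p a m x, V x -> sval_ (Gg p a m) x = christoffel (g i) m p a x.
Hypothesis ev_Gh : forall p a m x, V x -> sval_ (Gh p a m) x = christoffel (h i) m p a x.

Definition phiS a : sfun V := scst V 2^-1 * (Gh a a a - Gg a a a).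

Lemma Gam_phi p a m : Gh p a m = Gg p a m + phiS a * (p == m)%:R + phiS p * (a == m)%:R.
Proof.
apply: sfunP => x Vx.
rewrite (evD Vx) (evD Vx).
rewrite !(evM Vx).
rewrite !(evB Vx).
rewrite !(ev_delta Vx).
rewrite !(ev_cst Vx).
rewrite !(ev_Gg _ _ _ Vx) !(ev_Gh _ _ _ Vx).
rewrite (christoffel_projective hproj p a m (VU Vx)).
by congr (_ + _ * _ + _ * _); rewrite mulrC.
Qed.

Lemma trace_Gam p : \sum_m Gh p m m = \sum_m Gg p m m + n.+1%:R * phiS p.
Proof.
rewrite (eq_bigr _ (fun m _ => Gam_phi p m m)) !big_split /= -addrA; congr (_ + _).
rewrite (eq_bigr (fun m => (p == m)%:R * phiS m)); last by move=> m _; rewrite mulrC.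
rewrite sum_delta (eq_bigr (fun=> phiS p)); last by move=> m _; rewrite eqxx mulr1.
by rewrite sumr_const card_ord -mulrS mulr_natl.
Qed.

Lemma det_neq0 gs' gis' Gam' x : levi_civita D gs' gis' Gam' -> V x ->
  sval_ (\det (mx2 gs')) x != 0.
Proof.
move=> HG' Vx; have h0 : \det (mx2 gs') * \det (mx2 gis') = 1.
  by rewrite mulrC -det_mulmx (GiG HG') det1.
have := congr1 (fun f => sval_ f x) h0; rewrite (evM Vx) (ev1 Vx) => e.
by apply/eqP => z; move/eqP: e; rewrite z mul0r eq_sym oner_eq0.
Qed.

(** Taking traces, phi is 1/(n + 1) times the logarithmic derivative of
    the square root of det h / det g. The squares make the argument of the logarithm positive. *)
Lemma sfun_potential : exists f, (forall a, D a f = 2%:R * phiS a * f) /\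
  forall x, V x -> sval_ f x != 0.
Proof.
have n1 x := @det_neq0 _ _ _ x HG; have n2 x := @det_neq0 _ _ _ x HH.
have Dd1 a := deriv_det_metric HD HG a.
have Dd2 a := deriv_det_metric HD HH a.
move: n1 n2 Dd1 Dd2; set d1 := \det _; set d2 := \det _.
move: d1 d2 => d1 d2 n1 n2 Dd1 Dd2.
have nz x (Vx : V x) : sval_ (d1 * d1) x != 0.
  by rewrite (evM Vx) mulf_neq0 // n1.
have [r r1 rE] := sfun_inv nz.
have q2 x (Vx : V x) : sval_ (d2 * d2 * r) x = (sval_ d2 x / sval_ d1 x) ^+ 2.
  rewrite (evM Vx) (rE x Vx) !(evM Vx); move: (sval_ d1 x) (n1 x Vx) => u u0; by field.
have pos x (Vx : V x) : 0 < sval_ (d2 * d2 * r) x.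
  by rewrite (q2 x Vx) exprn_even_gt0 //= mulf_neq0 ?n2 // invr_neq0 // n1.
have [w wE] := sfun_ln pos.
have nzq x (Vx : V x) : sval_ (d2 * d2 * r) x != 0.
  by have := pos x Vx; rewrite lt0r => /andP[].
have [q' q'1 _] := sfun_inv nzq.
have Dr a : D a r = - (4%:R * (\sum_m Gg a m m)) * r.
  have := congr1 (D a) r1; rewrite (deriv1 HD) (derivM HD) (derivM HD) Dd1.
  move: (\sum_m _) => T /(congr1 (fun y => y * r)).
  rewrite mul0r => e.
  have : D a r * (r * (d1 * d1)) + (4%:R * T) * r * (r * (d1 * d1)) = 0.
    rewrite -[RHS]e; ring.
  by rewrite r1 !mulr1 mulNr => /eqP; rewrite addr_eq0 => /eqP.
(* w is the logarithm of (det h / det g)^2, and D (det g) = 2 tr Gam det g *)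
have Dw a : D a w = (4 * n.+1)%:R * phiS a.
  have e := wE a; rewrite (derivM HD) (derivM HD) Dd2 Dr trace_Gam in e.
  transitivity (D a w * (q' * (d2 * d2 * r))); first by rewrite q'1 mulr1.
  rewrite mulrCA -e.
  move: (\sum_m _) (phiS a) => T ph.
  rewrite -[RHS]mulr1 -[X in _ = _ * X]q'1 natrM; ring.
exists (sexp (scst V (2 * n.+1%:R)^-1 * w)); split.
  move=> a; rewrite sderiv_exp (derivM HD) sderiv_cst mul0r add0r Dw; congr (_ * _).
  rewrite mulrA; congr (_ * _); apply: sfunP => x Vx.
  rewrite (evM Vx) (ev_cst Vx) !(ev_nat Vx).
  by rewrite natrM -[4%:R]/((2 * 2)%N%:R) natrM; field; rewrite addrC natr1 pnatr_eq0.
by move=> x Vx; rewrite (ev_sexp _ Vx) gt_eqF // expR_gt0.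
Qed.

Definition same_connection x :=
  forall k a b, christoffel (g i) k a b x = christoffel (h i) k a b x.

Lemma phiS_eq0 x : V x -> (forall a, sval_ (phiS a) x = 0) <-> same_connection x.
Proof.
move=> Vx; split=> [z k a b|e a]; last first.
  by rewrite (evM Vx) (evB Vx) (ev_Gg _ _ _ Vx) (ev_Gh _ _ _ Vx) e subrr mulr0.
have := congr1 (fun F => sval_ F x) (Gam_phi a b k).
rewrite (evD Vx) (evD Vx) (evM Vx (phiS b)) (evM Vx (phiS a)) !z !mul0r !addr0.
by rewrite (ev_Gg _ _ _ Vx) (ev_Gh _ _ _ Vx).
Qed.

Lemma sinjukov_exists_aux : exists (a : 'I_n -> 'I_n -> sfun V) (lam : 'I_n -> sfun V),
  [/\ forall k l, a k l = a l k,
      forall p k l, nabla2 D Gg p a k l = lam k * gs p l + lam l * gs p k &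
      forall x, V x -> (forall k, sval_ (lam k) x = 0) <-> same_connection x].
Proof.
have [f [df fn0]] := sfun_potential.
exists (sinj_form gs his f), (sinj_grad gs his phiS f); split.
- by move=> k l; apply: (sinj_formC HG HH).
- by move=> p k l; apply: (sinjukov_of_projective HD HG HH Gam_phi df).
move=> x Vx; rewrite -(phiS_eq0 Vx) /sinj_grad.
(* In matrix form lam = - f g gbar^-1 phi, with invertible factors. *)
pose lam k : sfun V := - (f * \sum_s \sum_t gs k s * his s t * phiS t).
have lamE k : f * (\sum_s gs k s * (\sum_t his s t * phiS t)) = - lam k.
  rewrite /lam opprK; congr (_ * _); apply: eq_bigr => s _.
  by rewrite mulr_sumr; apply: eq_bigr => t _; rewrite mulrA.
split=> [z|z k]; last first.
  rewrite (evN Vx) (evM Vx) (ev_sum Vx) big1 ?mulr0 ?oppr0 // => s _.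
  rewrite (ev_sum Vx) big1 // => t _.
  by rewrite (evM Vx) z mulr0.
have e1 k : \sum_s sval_ (gs k s) x * sval_ (\sum_t his s t * phiS t) x = 0.
  have := congr1 (fun F => sval_ F x) (lamE k).
  rewrite (evM Vx) (evN Vx) z oppr0 (ev_sum Vx) => /eqP.
  rewrite mulf_eq0 (negPf (fn0 x Vx)) /= => /eqP h0; rewrite -[RHS]h0.
  by apply: eq_bigr => s _; rewrite (evM Vx).
have e2 k : sval_ (\sum_t his k t * phiS t) x = 0.
  have : sval_ (\sum_s gis k s * \sum_m gs s m * \sum_t his m t * phiS t) x = 0.
    rewrite (ev_sum Vx) big1 // => s _.
    rewrite (evM Vx) (ev_sum Vx) [X in _ * X](_ : _ = 0) ?mulr0 // -[RHS](e1 s).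
    by apply: eq_bigr => m _; rewrite (evM Vx).
  move=> <-; congr (sval_ _ x).
  rewrite -[LHS](sum_delta (fun m => \sum_t his m t * phiS t) k).
  rewrite (eq_bigr (fun m => \sum_s gis k s * gs s m * (\sum_t his m t * phiS t))); last first.
    by move=> m _; rewrite -(lc_inv HG) mulr_suml.
  rewrite exchange_big; apply: eq_bigr => s _ /=.
  by rewrite mulr_sumr; apply: eq_bigr => m _; rewrite mulrA.
move=> k.
have -> : phiS k = \sum_s hs k s * \sum_t his s t * phiS t.
  rewrite -[LHS](sum_delta phiS k).
  rewrite (eq_bigr (fun m => \sum_s hs k s * his s m * phiS m)); last first.
    move=> m _; rewrite (_ : (k == m)%:R = \sum_s hs k s * his s m) ?mulr_suml //.
    rewrite -[k == m]/(k == m) eq_sym -(lc_inv HH).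
    by apply: eq_bigr => s _; rewrite mulrC (lc_gC HH s) (lc_giC HH m).
  rewrite exchange_big; apply: eq_bigr => s _ /=.
  by rewrite mulr_sumr; apply: eq_bigr => m _; rewrite mulrA.
by rewrite (ev_sum Vx) big1 // => s _; rewrite (evM Vx) e2 mulr0.
Qed.

End TwoMetrics.

Lemma sinjukov_exists g h : projectively_equivalent g h ->
  exists (a : 'I_n -> 'I_n -> sfun V) (lam : 'I_n -> sfun V),
  [/\ forall k l, a k l = a l k,
      forall p k l, nabla2 (@sderiv _ _ V) (GamS g) p a k l = lam k * gS g p l + lam l * gS g p k &
      forall x, V x -> (forall k, sval_ (lam k) x = 0) <-> same_connection g h x].
Proof.
move=> hproj.
apply: (sinjukov_exists_aux hproj (levi_civita_sfun g) (levi_civita_sfun h)).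
  by move=> p a m x; exact: ev_GamS.
by move=> p a m x; exact: ev_GamS.
Qed.

End LocalMetric.

Section EinsteinLocal.
Context {R : realType} (M : manifold R 4) (i : atlas M) (V : region R 4).
Hypothesis VU : forall x, V x -> chart_image i x.
Context (g : metric M) (lambda : M -> R).
Hypothesis einstein_g : forall i p, dom i p ->
  ricci (g i) (chart i p) = lambda p *: g i (chart i p).

Local Notation D := (@sderiv _ _ V).

Lemma ev_ricci c a x : V x ->
  sval_ (\sum_d riem D (GamS VU g) d c a d) x = lambda (chart_inv i x) * g i x c a.
Proof.
move=> Vx; rewrite (ev_sum Vx).
have [di ci] := chart_invK (VU Vx).
have /matrixP/(_ c a) := einstein_g di; rewrite ci !mxE => <-.
by apply: eq_bigr => d _; rewrite (ev_riem VU g d c a d Vx).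
Qed.

(** The Einstein scalar is smooth because it is a contraction of the Ricci tensor. *)
Lemma einstein_sfun : exists2 K : sfun V,
  forall c a, \sum_d riem D (GamS VU g) d c a d = 3%:R * K * gS VU g c a &
  forall x, V x -> sval_ K x = lambda (chart_inv i x) / 3.
Proof.
have HG := levi_civita_sfun VU g.
pose Ric c a := \sum_d riem D (GamS VU g) d c a d.
have evR c a x (Vx : V x) : sval_ (Ric c a) x
   = lambda (chart_inv i x) * sval_ (gS VU g c a) x.
  by rewrite (ev_ricci c a Vx) (ev_gS VU g c a Vx).
suff: exists2 K : sfun V, forall c a, Ric c a = 3%:R * K * gS VU g c a &
  forall x, V x -> sval_ K x = lambda (chart_inv i x) / 3 by [].
move: HG evR; move: (gS VU g) (giS VU g) (GamS VU g) Ric => gs gis Gg Ric HG evR.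
have evK x (Vx : V x) : sval_ (scst V 12^-1 * gtr gis Ric) x = lambda (chart_inv i x) / 3.
  rewrite (evM Vx) (ev_cst Vx).
  have -> : sval_ (gtr gis Ric) x = lambda (chart_inv i x) * sval_ (gtr gis gs) x.
    rewrite /gtr !(ev_sum Vx) mulr_sumr; apply: eq_bigr => k _.
    rewrite !(ev_sum Vx) mulr_sumr; apply: eq_bigr => l _.
    by rewrite !(evM Vx) (evR k l x Vx) mulrCA.
  by rewrite (gtr_g HG) (ev_nat Vx); field.
exists (scst V 12^-1 * gtr gis Ric) => // c a; apply: sfunP => x Vx.
rewrite (evR c a x Vx) (evM Vx) (evM Vx 3%:R) (evK x Vx) (ev_nat Vx).
by field.
Qed.

End EinsteinLocal.

(** * Unique continuation for closed linear systems *)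

Section Gronwall.
Context {R : realType} (I : finType).
Implicit Types (z : I -> R -> R) (A : I -> I -> R -> R).

Lemma quadratic_form_bound (w : I -> R) (A : I -> I -> R) (B : R) :
  \sum_s \sum_t `|A s t| <= B ->
  \sum_s \sum_t w s * (A s t * w t) <= B * \sum_s w s ^+ 2.
Proof.
move=> hB; set E := \sum_s w s ^+ 2.
have wE s : w s ^+ 2 <= E.
  by rewrite /E (bigD1 s) //= lerDl sumr_ge0 // => t _; exact: sqr_ge0.
have E0 : 0 <= E by apply: sumr_ge0 => s _; exact: sqr_ge0.
(* each product |w_s| |w_t| is at most the sum of all squares *)
apply: le_trans (_ : (\sum_s \sum_t `|A s t|) * E <= _); last exact: ler_wpM2r.
rewrite mulr_suml; apply: ler_sum => s _; rewrite mulr_suml; apply: ler_sum => t _.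
rewrite (le_trans (ler_norm _)) // mulrCA normrM ler_wpM2l // normrM.
have := wE s; have := wE t; rewrite -(real_normK (num_real (w s))) -(real_normK (num_real (w t))).
have := sqr_ge0 (`|w s| - `|w t|); rewrite !expr2; lra.
Qed.

(** Gronwall's argument: if B bounds the sum of the absolute values of the
    coefficients, then exp(-2 B t) times the sum of the squares of the solution
    does not increase. *)
Lemma linear_ode_unique z A :
  (forall t : R, 0 <= t <= 1 -> forall s, is_derive t 1 (z s) (\sum_r A s r t * z r t)) ->
  (forall t : R, 0 <= t <= 1 -> forall s r, {for t, continuous (A s r)}) ->
  (forall s, z s 0 = 0) -> forall s, z s 1 = 0.
Proof.
move=> dz cA z0.
pose Q (t : R) : R := \sum_s \sum_r `|A s r t|.
have cQ : {within `[0, 1], continuous Q}.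
  apply: continuous_in_subspaceT => t; rewrite inE /= in_itv /= => t01.
  apply: continuous_sum_at => s; apply: continuous_sum_at => r.
  apply: (@continuous_comp _ _ _ (A s r) Num.norm); first exact: cA.
  exact: norm_continuous.
have [c _ hc] := EVT_max ler01 cQ.
set B := Q c in hc.
pose E (t : R) : R := \sum_s (z s t * z s t).
(* F is the energy E damped at the rate 2 B, so that F' <= 0 *)
pose F (t : R) : R := E t * expR (- (2 * B) * t).
pose dE (t : R) : R := \sum_s ((\sum_r A s r t * z r t) * z s t + z s t * (\sum_r A s r t * z r t)).
have dEt (t : R) : 0 <= t <= 1 -> is_derive t 1 E (dE t).
  by move=> t01; apply: is_derive_sumf => s; apply is_derive_mulf; exact: dz.
pose dF (t : R) : R := dE t * expR (- (2 * B) * t) + E t * (expR (- (2 * B) * t) * (- (2 * B))).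
have dFt (t : R) : 0 <= t <= 1 -> is_derive t 1 F (dF t).
  move=> t01.
  have hl : is_derive t 1 (fun s : R => - (2 * B) * s) (- (2 * B)).
    have h := is_derive_mulf (is_derive_cst (- (2 * B)) t 1) (is_derive_id t 1).
    by apply: is_derive_eq h _; rewrite mul0r add0r mulr1.
  have he := @is_derive_comp_outer _ _ expR (fun s : R => - (2 * B) * s) t 1 _ _ (is_derive_expR _) hl.
  exact: (is_derive_mulf (dEt t t01) he).
have cF : {within `[0, 1], continuous F}.
  apply: continuous_in_subspaceT => t; rewrite inE /= in_itv /= => t01.
  exact: is_derive_continuous (dFt t t01).
have [|d d01 e] := @MVT R F dF 0 1 ltr01 _ cF.
  by move=> t; rewrite in_itv /= => /andP[/ltW a /ltW b]; apply: dFt; rewrite a b.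
have d01' : 0 <= d <= 1 by move: d01; rewrite in_itv /= => /andP[/ltW -> /ltW ->].
have dEB : dE d <= 2 * B * E d.
  have hB : \sum_s \sum_r `|A s r d| <= B by apply: hc; rewrite in_itv.
  have := quadratic_form_bound (z^~ d) hB.
  have -> : dE d = 2 * \sum_s \sum_t z s d * (A s t d * z t d).
    rewrite mulr_sumr; apply: eq_bigr => s _; rewrite mulr_sumr.
    by rewrite mulr_suml mulr_sumr -big_split /=; apply: eq_bigr => r _; ring.
  have -> : \sum_s z s d ^+ 2 = E d by apply: eq_bigr => s _; rewrite expr2.
  by move=> h; rewrite -mulrA ler_wpM2l.
have F0 : F 0 = 0 by rewrite /F /E big1 ?mul0r // => s _; rewrite z0 mul0r.
have : F 1 <= 0.
  move: e; rewrite F0 !subr0 mulr1 => ->; rewrite /dF.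
  have := expR_gt0 (- (2 * B) * d); move: (expR _) => u u0.
  have -> : dE d * u + E d * (u * - (2 * B)) = u * (dE d - 2 * B * E d) by ring.
  by rewrite pmulr_rle0 // subr_le0.
rewrite /F pmulr_lle0 ?expR_gt0 // => E1 s; apply/eqP.
have : z s 1 * z s 1 <= 0.
  apply: le_trans E1; rewrite /E (bigD1 s) //= lerDl sumr_ge0 // => t _.
  by rewrite -expr2 sqr_ge0.
by rewrite -expr2 => h; rewrite -sqrf_eq0 eq_le h sqr_ge0.
Qed.

End Gronwall.

Section UniqueContinuation.
Context {R : realType} {n : nat} (V : region R n) (I : finType) (y : I -> sfun V).

(** Linear combinations of the unknowns [y] with smooth coefficients; a system is
    closed when the derivatives of the unknowns are in their span. *)
Definition in_span (F : sfun V) := exists c : I -> sfun V, F = \sum_t c t * y t.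

Lemma in_span_atom s : in_span (y s).
Proof.
exists (fun t => (s == t)%:R); rewrite (bigD1 s) //= eqxx mul1r big1 ?addr0 // => t /negPf.
by rewrite eq_sym => ->; rewrite mul0r.
Qed.

Lemma in_spanD F G : in_span F -> in_span G -> in_span (F + G).
Proof.
move=> [c ->] [d ->]; exists (fun t => c t + d t); rewrite -big_split.
by apply: eq_bigr => t _; rewrite mulrDl.
Qed.

Lemma in_spanM a F : in_span F -> in_span (a * F).
Proof.
move=> [c ->]; exists (fun t => a * c t); rewrite mulr_sumr.
by apply: eq_bigr => t _; rewrite mulrA.
Qed.

Lemma in_span_sum (J : finType) (F : J -> sfun V) :
  (forall j, in_span (F j)) -> in_span (\sum_j F j).
Proof.
move=> h; elim/big_ind : _ => [|a b ha hb|j _] //.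
  by exists (fun=> 0); rewrite big1 // => t _; rewrite mul0r.
exact: in_spanD.
Qed.

Hypothesis system : forall p s, in_span (sderiv p (y s)).

Theorem unique_continuation (x0 x1 : 'rV[R]_n) :
  (forall t : R, 0 <= t <= 1 -> V (x0 + t *: (x1 - x0))) ->
  (forall s, sval_ (y s) x0 = 0) -> forall s, sval_ (y s) x1 = 0.
Proof.
move=> seg y0.
have [C' hC'] := choice (fun ps => system ps.1 ps.2).
pose C p s := C' (p, s).
have hC p s : sderiv p (y s) = \sum_t C p s t * y t by exact: (hC' (p, s)).
pose u := x1 - x0; pose gam (t : R) := x0 + t *: u.
have dgam (t : R) k : is_derive t 1 (fun s => gam s 0 k) (u 0 k).
  have h := is_derive_addf (is_derive_cst (x0 0 k) t 1)
     (is_derive_mulf (is_derive_id t 1) (is_derive_cst (u 0 k) t 1)).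
  have e : (fun s : R => x0 0 k + id s * cst (u 0 k) s) = (fun s => gam s 0 k).
    by apply/funext => s; rewrite !mxE.
  by rewrite -e; apply: is_derive_eq h _; rewrite add0r mul1r mulr0 addr0.
have oV : open (region_set V) by exact: region_open.
have dF (F : sfun V) (t : R) : 0 <= t <= 1 ->
    is_derive t 1 (fun s => sval_ F (gam s)) (\sum_p u 0 p * sval_ (sderiv p F) (gam t)).
  move=> t01; have Vt : V (gam t) by exact: seg.
  have c1 := smooth_on_C1 oV (@sfun_smooth _ _ _ F) Vt.
  have h := chain_curve c1 (dgam t); apply: is_derive_eq h _.
  by apply: eq_bigr => p _; rewrite ev_sderiv.
pose z s (t : R) := sval_ (y s) (gam t).
pose A s r (t : R) := \sum_p u 0 p * sval_ (C p s r) (gam t).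
have g1 : gam 1 = x1 by rewrite /gam scale1r /u addrC subrK.
have g0 : gam 0 = x0 by rewrite /gam scale0r addr0.
move=> s; rewrite -g1; apply: (@linear_ode_unique _ _ z A).
- move=> t t01 {}s; apply: is_derive_eq (dF (y s) t t01) _.
  have Vt : V (gam t) by exact: seg.
  rewrite [RHS](eq_bigr (fun r => \sum_p u 0 p * sval_ (C p s r) (gam t) * z r t)); last first.
    by move=> r _; rewrite mulr_suml.
  rewrite exchange_big; apply: eq_bigr => p _ /=.
  rewrite hC (ev_sum Vt) mulr_sumr; apply: eq_bigr => r _.
  by rewrite (evM Vt) mulrA.
- move=> t t01 {}s r; apply: continuous_sum_at => p.
  apply: continuousM_at; first exact: continuous_cst_at.
  exact: is_derive_continuous (dF _ t t01).
by move=> {}s; rewrite /z g0 y0.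
Qed.

End UniqueContinuation.

(** * Local consequences of the Sinjukov equation *)

Section LocalTheory.
Context {R : realType} (V : region R 4).
Local Notation D := (@sderiv _ _ V).
Let HD : commuting_derivations D := sderiv_commuting V.
Let tf : forall m (x : sfun V), x *+ m.+1 = 0 -> x = 0 := @sfun_torsion_free _ _ V.
Context (g gi : 'I_4 -> 'I_4 -> sfun V) (Gam : 'I_4 -> 'I_4 -> 'I_4 -> sfun V).
Hypothesis HG : levi_civita D g gi Gam.
Context (K : sfun V).
Hypothesis einstein_K :
  forall c i, \sum_d riem D Gam d c i d = 3%:R * K * g c i.
Context (a : 'I_4 -> 'I_4 -> sfun V) (lam : 'I_4 -> sfun V).
Hypothesis aC : forall i j, a i j = a j i.
Hypothesis sinj :
  forall p i j, nabla2 D Gam p a i j = lam i * g p j + lam j * g p i.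

Local Notation W := (weyl D g Gam K).
Local Notation dlam := (Lam D Gam lam).
Local Notation at2 B x := (fun i j => sval_ (B i j) x).

Lemma ev_gtr B x : V x -> sval_ (gtr gi B) x = gtr (at2 gi x) (at2 B x).
Proof.
move=> Vx; rewrite (ev_sum Vx); apply: eq_bigr => k _.
by rewrite (ev_sum Vx); apply: eq_bigr => l _; rewrite (evM Vx).
Qed.

Lemma ev_ip X Y x : V x ->
  sval_ (ip gi X Y) x = ip (at2 gi x) (fun k => sval_ (X k) x) (fun k => sval_ (Y k) x).
Proof.
by move=> Vx; rewrite (ev_gtr _ Vx); apply: eq_gtr => k l; rewrite (evM Vx).
Qed.

Lemma ev_GiG x : V x -> mx2 (at2 gi x) *m mx2 (at2 g x) = 1%:M.
Proof.
move=> Vx; apply/matrixP => i j; rewrite !mxE -(ev_delta Vx) -(lc_inv HG) (ev_sum Vx).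
by apply: eq_bigr => m _; rewrite !mxE (evM Vx).
Qed.

Section Continuation.
Context (x0 x1 : 'rV[R]_4).
Hypothesis seg : forall t : R, 0 <= t <= 1 -> V (x0 + t *: (x1 - x0)).

Let V0 : V x0.
Proof. by have := seg (t := 0); rewrite scale0r addr0; apply; rewrite lexx ler01. Qed.

Lemma einstein_scalar_constant : sval_ K x1 = sval_ K x0.
Proof.
have V1 : V x1.
  by have := seg (t := 1); rewrite scale1r addrC subrK; apply; rewrite lexx ler01.
pose y (_ : unit) : sfun V := K - scst V (sval_ K x0).
have sys p s : in_span y (sderiv p (y s)).
  exists (fun=> 0); rewrite big1 ?mul0r // => [|? _]; last exact: mul0r.
  apply: sfunP => x Vx; rewrite (derivD HD) (derivN HD) (deriv_K HD HG tf einstein_K).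
  rewrite add0r (evN Vx) (ev0 Vx) sderiv_cst (ev0 Vx) oppr0 //.
have := unique_continuation sys seg _ tt; rewrite /y (evB V1) (ev_cst V1) => h.
by apply/eqP; rewrite -subr_eq0; apply/eqP; apply: h => _; rewrite (evB V0) (ev_cst V0) subrr.
Qed.

(** The components of [lam] and of nabla [lam] form a closed linear system, by
    [TlamE]. *)
Lemma gradient_unique_continuation (U : set 'rV[R]_4) : open U -> U x0 ->
  (forall x, U x -> V x /\ forall i, sval_ (lam i) x = 0) ->
  forall i, sval_ (lam i) x1 = 0.
Proof.
move=> oU Ux0 hU.
pose y (s : 'I_4 + 'I_4 * 'I_4) : sfun V :=
  match s with inl i => lam i | inr di => dlam di.1 di.2 end.
have slam i : in_span y (lam i) by exact: (in_span_atom y (inl i)).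
have sLam d i : in_span y (dlam d i) by exact: (in_span_atom y (inr (d, i))).
have Dlam p i : sderiv p (lam i) = dlam p i + \sum_m Gam p i m * lam m.
  by rewrite /Lam /nabla1 subrK.
have sys p s : in_span y (sderiv p (y s)).
  case: s => [i|[d i]] /=.
    rewrite Dlam; apply: in_spanD; first exact: sLam.
    by apply: in_span_sum => m; exact: in_spanM.
  have -> : sderiv p (dlam d i) = Tlam D Gam lam p d i + \sum_m Gam p i m * dlam d m
      + \sum_m Gam p d m * dlam m i.
    by rewrite /Tlam /nabla2 /nabla1; ring.
  apply: in_spanD; first apply: in_spanD.
  - rewrite (TlamE HD HG tf einstein_K aC sinj) -mulr_natl.
    apply: in_spanM; apply: in_spanD; first apply: in_spanD.
    + by rewrite mulrC; exact: in_spanM.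
    + by rewrite mulrC; exact: in_spanM.
    + by apply: in_spanM; rewrite mulrC; exact: in_spanM.
  - by apply: in_span_sum => m; exact: in_spanM.
  - by apply: in_span_sum => m; exact: in_spanM.
have lam0 i : sval_ (lam i) x0 = 0 by exact: (hU x0 Ux0).2.
have dlam0 p i : sval_ (sderiv p (lam i)) x0 = 0.
  rewrite (ev_sderiv _ _ V0) (eq_partial p oU Ux0 (g := cst 0)).
    by rewrite /partial derive_cst.
  by move=> z Uz; exact: (hU z Uz).2.
move=> i; apply: (unique_continuation sys seg _ (inl i)) => -[j|[d j]] //=.
rewrite /Lam /nabla1 (evB V0) dlam0 (ev_sum V0) big1 ?subrr // => m _.
by rewrite (evM V0) lam0 mulr0.
Qed.

End Continuation.

Section Dichotomy.
Hypothesis lam_neq0 : forall x, V x -> exists i, sval_ (lam i) x != 0.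
Hypothesis weyl_neq0 : forall x, V x -> exists i j k l, sval_ (W i j k l) x != 0.

(** Where [lam] is not null, [weyl_eq0_of_nonnull] applies. *)
Lemma gradient_null : ip gi lam lam = 0.
Proof.
apply: sfunP => x Vx; rewrite (ev0 Vx) (ev_ip _ _ Vx).
apply/eqP; apply: contraPT (weyl_neq0 Vx) => nz [i [j [k [l]]]]; apply/negP; rewrite negbK; apply/eqP.
apply: (weyl_eq0_of_nonnull (g := at2 g x) (gi := at2 gi x)
  (lam := fun i => sval_ (lam i) x) (W := fun i j k l => sval_ (W i j k l) x)) nz i j k l.
- by move=> i j; rewrite (lc_gC HG).
- by move=> i j; rewrite (lc_giC HG).
- exact: ev_GiG.
- by move=> i j k l; rewrite weyl_skew12 (evN Vx).
- by move=> i j k l; rewrite (weyl_skew34 HD HG) (evN Vx).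
- by move=> i j k l; rewrite (weyl_pair HD HG tf).
- move=> c i; rewrite -(ev_gtr (fun p d => W d c i p) Vx).
  by rewrite (weyl_trace HG einstein_K) (ev0 Vx).
- move=> d c i; rewrite -(ev_ip (W d c i) lam Vx).
  by rewrite (weyl_grad HD HG tf einstein_K aC sinj) (ev0 Vx).
Qed.

(** At a point with [K <> 0] the symmetrized product of lam and nabla lam vanishes
    by [K_lam_Lam]; at a point with [K = 0] a similar product vanishes by
    [contracted_integrability]. In both cases lam <> 0 can be cancelled. *)
Lemma Lam_eq0 p i : dlam p i = 0.
Proof.
apply: sfunP => x Vx; rewrite (ev0 Vx).
pose L p i := sval_ (dlam p i) x; pose l i := sval_ (lam i) x.
have LC d j : L d j = L j d by rewrite /L (LamC HD HG tf sinj).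
have [j lj] := lam_neq0 Vx; rewrite -/(l j) in lj.
have [k0|kn0] := eqVneq (sval_ K x) 0.
  have h d i' j' : L d i' * l j' + L d j' * l i' = 0.
    have := contracted_integrability HD HG tf einstein_K aC sinj gradient_null d i' j'.
    move=> /(congr1 (fun F => sval_ F x)); rewrite (evD Vx) (evM Vx) (evM Vx) => ->.
    by rewrite (evM Vx) (evN Vx) k0 oppr0 mul0r.
  have Lj d : L d j = 0.
    have := h d j j; rewrite -mulr2n => /eqP; rewrite mulrn_eq0 /= mulf_eq0 (negPf lj) orbF.
    by move/eqP.
  have := h p i j; rewrite Lj mul0r addr0 => /eqP; rewrite mulf_eq0 (negPf lj) orbF.
  by move/eqP.
have h s p' q : l p' * L q s + l q * L p' s + l s * L p' q = 0.
  have := K_lam_Lam HD HG tf einstein_K aC sinj gradient_null s p' q.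
  move=> /(congr1 (fun F => sval_ F x)); rewrite (evM Vx) (evD Vx) (evD Vx) !(evM Vx) (ev0 Vx).
  by move/eqP; rewrite mulf_eq0 (negPf kn0) => /eqP.
have cancel u : l j * u = 0 -> u = 0.
  by move/eqP; rewrite mulf_eq0 (negPf lj) => /eqP.
(* The index j is taken three times, then twice, then once. *)
have Ljj : L j j = 0 by apply: cancel; have := h j j j; lra.
have Lj q : L j q = 0.
  by apply: cancel; have := h j j q; rewrite Ljj (LC q j) mulr0; lra.
apply: cancel; have := h i j p.
by rewrite (Lj p) (Lj i) !mulr0 !addr0.
Qed.

Lemma einstein_scalar0 : K = 0.
Proof.
apply: sfunP => x Vx; rewrite (ev0 Vx); have [j lj] := lam_neq0 Vx.
have := parallel_K_lam HD HG tf einstein_K aC sinj Lam_eq0 j.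
move/(congr1 (fun F => sval_ F x)); rewrite (evM Vx) (ev0 Vx) => /eqP.
by rewrite mulf_eq0 (negPf lj) orbF => /eqP.
Qed.

Hypothesis lorentz : forall x, V x -> exists2 P : 'M[R]_4, P \in unitmx &
  P *m mx2 (at2 g x) *m P^T = diag_mx (\row_(k < 4) if k == 0%N :> nat then -1 else 1).

(** The rank one form of the trace-free part of [a], proved pointwise, is an
    identity in the ring, where it can be differentiated. *)
Lemma lorentz_impossible : False.
Proof.
pose b i j := 4%:R * a i j - gtr gi a * g i j.
have b_rank1 i j k : b i j * lam k = b k j * lam i.
  apply: sfunP => x Vx; have [P0 uP0 eP0] := lorentz Vx.
  have evb s t : sval_ (b s t) x = 4%:R * at2 a x s t - gtr (at2 gi x) (at2 a x) * at2 g x s t.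
    by rewrite (evB Vx) !(evM Vx) (ev_nat Vx) (ev_gtr _ Vx).
  rewrite (evM Vx) (evM Vx) !evb.
  apply: (null_commutant_rank1 (g := at2 g x) (gi := at2 gi x) (a := at2 a x)
    (lam := fun i => sval_ (lam i) x) (W := fun i j k l => sval_ (W i j k l) x)
    _ _ _ _ _ _ _ _ _ _ uP0 eP0).
  - by move=> s t; rewrite (lc_gC HG).
  - by move=> s t; rewrite (lc_giC HG).
  - exact: ev_GiG.
  - by move=> s t u v; rewrite weyl_skew12 (evN Vx).
  - by move=> s t u v; rewrite (weyl_skew34 HD HG) (evN Vx).
  - by move=> s t u v; rewrite (weyl_pair HD HG tf).
  - move=> s t; rewrite -(ev_gtr (fun p d => W d s t p) Vx).
    by rewrite (weyl_trace HG einstein_K) (ev0 Vx).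
  - move=> d s t; rewrite -(ev_ip (W d s t) lam Vx).
    by rewrite (weyl_grad HD HG tf einstein_K aC sinj) (ev0 Vx).
  - by move=> s t; rewrite aC.
  - move=> d c s t; rewrite -(ev_ip (W d c s) (a t) Vx) -(ev_ip (W d c t) (a s) Vx) -(evD Vx).
    have WE u v : ip gi (W d c u) (a v) = ip gi (Rl D g Gam d c u) (a v).
      by apply: eq_ip => // m; rewrite /weyl einstein_scalar0 mul0r subr0.
    rewrite !WE (integrability HD HG aC sinj) !Lam_eq0 !mul0r addr0 !subr0 oppr0.
    exact: ev0.
  - by rewrite -(ev_ip lam lam Vx) gradient_null (ev0 Vx).
  - exact: lam_neq0.
  - exact: weyl_neq0.
have [x Vx] := region_point V; have [j lj] := lam_neq0 Vx.
have := parallel_null_lam HD HG tf sinj Lam_eq0 gradient_null b_rank1 j j.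
move/(congr1 (fun F => sval_ F x)); rewrite (evM Vx) (ev0 Vx) => /eqP.
by rewrite mulf_eq0 (negPf lj).
Qed.

End Dichotomy.

Lemma riemannian_nonnull x : V x ->
  (forall u : 'rV[R]_4, u != 0 -> 0 < inner (mx2 (at2 g x)) u u) ->
  ip gi lam lam = 0 -> forall i, sval_ (lam i) x = 0.
Proof.
move=> Vx pos null i.
pose v := sharp (at2 gi x) (fun i => sval_ (lam i) x).
have v0 : v = 0.
  apply/eqP; apply: contraT => /pos; rewrite /inner /v sharp_norm.
  - by rewrite -(ev_ip lam lam Vx) null (ev0 Vx) ltxx.
  - by move=> s t; rewrite (lc_giC HG).
  - exact: ev_GiG.
have := sharpE (at2 gi x) (fun i => sval_ (lam i) x); rewrite -/v v0.
move/(congr1 (fun X => mx2 (at2 g x) *m X^T)).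
rewrite trmx0 mulmx0 trmxK mulmxA (mulmx1C (ev_GiG Vx)) mul1mx.
by move/matrixP/(_ i 0); rewrite !mxE.
Qed.

End LocalTheory.

(** * Constant sectional curvature in components *)

Section Sectional.
Context {R : realType} (G : 'rV[R]_4 -> 'M[R]_4) (x : 'rV[R]_4) (kappa : R).
Hypothesis symG : (G x)^T = G x.
Hypothesis flat : forall d c a b,
  \sum_l riemann G l a d c x * G x l b = kappa * (G x d b * G x c a - G x c b * G x d a).

Lemma innerE (A : 'M[R]_4) (u v : 'rV[R]_4) :
  inner A u v = \sum_k \sum_l A k l * (u 0 k * v 0 l).
Proof.
rewrite /inner mxE exchange_big /=; apply: eq_bigr => l _.
by rewrite !mxE mulr_suml; apply: eq_bigr => k _; ring.
Qed.

Lemma sectional_const u v : gram G x u v != 0 -> sectional G x u v = kappa.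
Proof.
move=> gn; rewrite /sectional; suff -> : inner (G x) (curvature G x u v v) u = kappa * gram G x u v.
  by rewrite mulfK.
have e : inner (G x) (curvature G x u v v) u =
    \sum_d \sum_c \sum_a \sum_b (\sum_l riemann G l a d c x * G x l b)
      * (u 0 d * v 0 c * v 0 a * u 0 b).
  rewrite innerE; transitivity (\sum_l \sum_b \sum_d \sum_c \sum_a
     riemann G l a d c x * G x l b * (u 0 d * v 0 c * v 0 a * u 0 b)).
    apply: eq_bigr => l _; apply: eq_bigr => b _; rewrite mxE.
    rewrite mulrC -mulrA mulr_suml; apply: eq_bigr => d _.
    rewrite mulr_suml; apply: eq_bigr => c _; rewrite mulr_suml; apply: eq_bigr => a _; ring.
  under eq_bigr => l _ do (rewrite exchange_big; under eq_bigr => d _ do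
    (rewrite exchange_big; under eq_bigr => c _ do rewrite exchange_big)).
  rewrite exchange_big; apply: eq_bigr => d _ /=.
  rewrite exchange_big; apply: eq_bigr => c _ /=.
  rewrite exchange_big; apply: eq_bigr => a _ /=.
  by rewrite exchange_big; apply: eq_bigr => b _ /=; rewrite mulr_suml.
have p1 : inner (G x) u u * inner (G x) v v = \sum_d \sum_c \sum_a \sum_b
    (G x d b * G x c a) * (u 0 d * v 0 c * v 0 a * u 0 b).
  rewrite !innerE mulr_suml; apply: eq_bigr => d _.
  rewrite mulr_sumr; apply: eq_bigr => c _; rewrite exchange_big /= mulr_suml exchange_big /=.
  rewrite [RHS]exchange_big; apply: eq_bigr => b _ /=.
  by rewrite mulr_sumr; apply: eq_bigr => a _; ring.
have p2 : inner (G x) u v ^+ 2 = \sum_d \sum_c \sum_a \sum_b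
    (G x c b * G x d a) * (u 0 d * v 0 c * v 0 a * u 0 b).
  have e' : inner (G x) u v = \sum_c \sum_b G x c b * (v 0 c * u 0 b).
    rewrite innerE exchange_big; apply: eq_bigr => c _; apply: eq_bigr => b _ /=.
    by rewrite -[in LHS]symG mxE; ring.
  rewrite expr2 {1}innerE e' mulr_suml; apply: eq_bigr => d _.
  rewrite mulr_suml.
  rewrite (eq_bigr (fun a => \sum_c \sum_b (G x c b * G x d a) * (u 0 d * v 0 c * v 0 a * u 0 b))).
    by rewrite exchange_big.
  move=> a _; rewrite mulr_sumr; apply: eq_bigr => c _; rewrite mulr_sumr.
  by apply: eq_bigr => b _; ring.
rewrite e /gram p1 p2 -sumrB mulr_sumr; apply: eq_bigr => d _.
rewrite -sumrB mulr_sumr; apply: eq_bigr => c _.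
rewrite -sumrB mulr_sumr; apply: eq_bigr => a _.
by rewrite -sumrB mulr_sumr; apply: eq_bigr => b _; rewrite flat; ring.
Qed.

End Sectional.

(** * Balls and open subsets of a chart *)

Section BallRegion.
Context {R : realType} {n : nat} (x0 : 'rV[R]_n) (r : R).
Hypothesis r0 : 0 < r.

Definition ball_set : set 'rV[R]_n := [set y | `|y - x0| < r].

Lemma ball_set_open : open ball_set.
Proof. exact: norm_ball_open. Qed.

Lemma ball_set_center : ball_set x0.
Proof. by rewrite /ball_set /= subrr normr0. Qed.

Definition ball_region : region R n :=
  @Region R n ball_set ball_set_open (ex_intro _ x0 ball_set_center).

Lemma ball_convex (y z : 'rV[R]_n) (t : R) : ball_set y -> ball_set z -> 0 <= t <= 1 ->
  ball_set (y + t *: (z - y)).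
Proof.
rewrite /ball_set /= => hy hz /andP[t0 t1].
have -> : y + t *: (z - y) - x0 = (1 - t) *: (y - x0) + t *: (z - x0).
  apply/rowP => k; rewrite !mxE; ring.
apply: le_lt_trans (ler_normD _ _) _; rewrite !normrZ ger0_norm ?subr_ge0 // (ger0_norm t0).
have [->|tn] := eqVneq t 0; first by rewrite subr0 mul1r mul0r addr0.
have tp : 0 < t by rewrite lt0r tn.
have -> : r = (1 - t) * r + t * r by ring.
apply: ler_ltD; last by rewrite ltr_pM2l.
by rewrite ler_wpM2l ?subr_ge0 // ltW.
Qed.

End BallRegion.

Section Local.
Context {R : realType} (M : manifold R 4) (g h : metric M) (lambda : M -> R).
Hypothesis hproj : projectively_equivalent g h.
Hypothesis hsign : riemannian g \/ lorentzian g.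
Hypothesis einstein_g : forall i p, dom i p ->
  ricci (g i) (chart i p) = lambda p *: g i (chart i p).
Context (i : atlas M).
Local Notation same x := (same_connection i g h x).

Definition weyl_at (x : 'rV[R]_4) d c a b :=
  \sum_l riemann (g i) l a d c x * g i x l b
   - lambda (chart_inv i x) / 3 * (g i x d b * g i x c a - g i x c b * g i x d a).

Lemma ev_weyl (V : region R 4) (VU : forall x, V x -> chart_image i x) (K : sfun V) x d c a b :
  V x -> sval_ K x = lambda (chart_inv i x) / 3 ->
  sval_ (weyl (@sderiv _ _ V) (gS VU g) (GamS VU g) K d c a b) x = weyl_at x d c a b.
Proof.
move=> Vx eK.
have ev_g := fun s t => ev_gS VU g s t Vx.
have ev_r l := ev_riem VU g d c a l Vx.
rewrite /weyl_at -eK -!ev_g (evB Vx) (evM Vx K) (ev_sum Vx); congr (_ - _).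
  by apply: eq_bigr => l _; rewrite (evM Vx) ev_r ev_g.
by rewrite (evB Vx) (evM Vx) (evM Vx (gS VU g c b)).
Qed.

(** On such an open set the gradient would be null, without zeros, and the Weyl
    tensor without zeros. *)
Lemma no_open_weyl (V : region R 4) : (forall x, V x -> chart_image i x) ->
  (forall x, V x -> ~ same x) ->
  (forall x, V x -> exists d c a b, weyl_at x d c a b != 0) -> False.
Proof.
move=> VU ns nW.
have HG := levi_civita_sfun VU g.
have [K eK evK] := einstein_sfun VU einstein_g.
have [a [lam [aC sinj lamE]]] := sinjukov_exists VU hproj.
have lam0 x (Vx : V x) : exists k, sval_ (lam k) x != 0.
  apply/not_existsP => z; apply: (ns x Vx); apply/(lamE x Vx) => k.
  by apply/eqP; apply: contra_notT (z k).
have W0 x (Vx : V x) : exists d c s t,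
    sval_ (weyl (@sderiv _ _ V) (gS VU g) (GamS VU g) K d c s t) x != 0.
  have [d [c [s [t w]]]] := nW x Vx; exists d, c, s, t.
  by rewrite (ev_weyl VU d c s t Vx (evK x Vx)).
have Gx x (Vx : V x) : mx2 (fun s t => sval_ (gS VU g s t) x) = g i x.
  by apply/matrixP => s t; rewrite mxE; exact: ev_gS.
case: hsign => [pos|lor].
  have [x Vx] := region_point V; have [k] := lam0 x Vx; apply/negP; rewrite negbK; apply/eqP.
  apply: (riemannian_nonnull HG Vx).
    by move=> u un; rewrite (Gx x Vx); exact: pos (VU x Vx) u un.
  exact: (gradient_null HG eK aC sinj W0).
apply: (lorentz_impossible HG eK aC sinj lam0 W0) => x Vx.
by have [P uP eP] := lor i x (VU x Vx); exists P => //; rewrite (Gx x Vx).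
Qed.

(** Agreement of the connections is the vanishing of the gradient, which propagates
    along the segments of the ball. *)
Lemma same_ball x0 r (r0 : 0 < r) (U : set 'rV[R]_4) y :
  (forall x, ball_set x0 r x -> chart_image i x) -> open U -> U y ->
  (forall x, U x -> ball_set x0 r x /\ same x) -> forall x, ball_set x0 r x -> same x.
Proof.
move=> VU oU Uy hU x Vx.
pose V := ball_region x0 r0.
have VU' z : V z -> chart_image i z := VU z.
have HG := levi_civita_sfun VU' g.
have [K eK evK] := einstein_sfun VU' einstein_g.
have [a [lam [aC sinj lamE]]] := sinjukov_exists VU' hproj.
have seg t : 0 <= t <= 1 -> V (y + t *: (x - y)).
  by apply: ball_convex => //; exact: (hU y Uy).1.
apply/(lamE x Vx); apply: (gradient_unique_continuation HG eK aC sinj seg oU Uy).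
by move=> z Uz; split; [exact: (hU z Uz).1|apply/(lamE z (hU z Uz).1); exact: (hU z Uz).2].
Qed.

Lemma lambda_ball x0 r (r0 : 0 < r) : (forall x, ball_set x0 r x -> chart_image i x) ->
  forall x, ball_set x0 r x -> lambda (chart_inv i x) = lambda (chart_inv i x0).
Proof.
move=> VU x Vx.
pose V := ball_region x0 r0.
have VU' z : V z -> chart_image i z := VU z.
have HG := levi_civita_sfun VU' g.
have [K eK evK] := einstein_sfun VU' einstein_g.
have V0 : V x0 := ball_set_center x0 r0.
have seg t : 0 <= t <= 1 -> V (x0 + t *: (x - x0)) by exact: ball_convex.
have := einstein_scalar_constant HG eK seg.
rewrite (evK x Vx) (evK x0 V0); lra.
Qed.

End Local.

(** * From local to global *)

Lemma clopen_connected (T : topologicalType) (S : set T) :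
  connected [set: T] -> open S -> open (~` S) -> S !=set0 -> S = setT.
Proof.
move=> cT oS oC S0; apply: cT => //; first by exists S => //; rewrite setTI.
by exists S; rewrite ?setTI // -openC.
Qed.

Section Global.
Context {R : realType} (M : manifold R 4) (g h : metric M) (lambda : M -> R).
Implicit Types (i j : atlas M) (p q : M).
Hypothesis hconn : connected [set: M].
Hypothesis hproj : projectively_equivalent g h.
Hypothesis hsign : riemannian g \/ lorentzian g.
Hypothesis hnaff : ~ affinely_equivalent g h.
Hypothesis einstein_g : forall i p, dom i p ->
  ricci (g i) (chart i p) = lambda p *: g i (chart i p).

Lemma chart_ball i p : dom i p -> exists2 r : R, 0 < r &
  forall x, ball_set (chart i p) r x -> chart_image i x.
Proof.
move=> ip; have oi : open (chart_image i) by exact: chart_image_open.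
have [r r0 hr] := open_ball oi (chart_image_mem ip).
by exists r.
Qed.

Lemma near_chart i p (U : set 'rV[R]_4) : dom i p -> open U -> U (chart i p) ->
  \forall q \near p, dom i q /\ U (chart i q).
Proof.
move=> ip oU Up; apply: filterI.
  by apply: open_nbhs_nbhs; split => //; exact: dom_open.
by apply: (chart_continuous_at ip); apply: open_nbhs_nbhs.
Qed.

Lemma near_ball i p (r : R) : 0 < r -> dom i p ->
  \forall q \near p, dom i q /\ ball_set (chart i p) r (chart i q).
Proof.
move=> r0 ip; apply: near_chart => //; first exact: ball_set_open.
exact: ball_set_center.
Qed.

Lemma lambda_locally_constant p : \forall q \near p, lambda q = lambda p.
Proof.
have [i ip] := dom_cover p; have [r r0 hr] := chart_ball ip.
apply: filterS (near_ball r0 ip) => q [iq qr].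
have := lambda_ball einstein_g r0 hr qr; rewrite !chartK //.
Qed.

Lemma lambda_constant p q : lambda p = lambda q.
Proof.
have oS c : open [set p | lambda p = c].
  rewrite openE => x <-; exact: lambda_locally_constant.
have oC c : open (~` [set p | lambda p = c]).
  rewrite openE => x xc; rewrite /interior.
  by apply: filterS (lambda_locally_constant x) => y e /=; rewrite e.
have e := clopen_connected hconn (oS (lambda q)) (oC (lambda q)) (ex_intro _ q erefl).
by have : [set: M] p by []; rewrite -e.
Qed.

Definition same_at (p : M) := forall i, dom i p -> same_connection i g h (chart i p).

Lemma same_at_chart i p : dom i p -> same_connection i g h (chart i p) -> same_at p.
Proof.
move=> ip e j jp.
have ov : overlap i j (chart i p) by exists p.
by have := affine_at_transition ov e; rewrite /transition chartK.
Qed.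

(** The set of points near which the connections agree is open. It is closed
    because a ball around a limit point contains points of the set, and unique
    continuation propagates agreement to the whole ball. Were it nonempty, the
    connections would agree everywhere. *)
Lemma open_same_empty p : ~ (\forall q \near p, same_at q).
Proof.
move=> Sp; apply: hnaff.
pose S := [set p : M | \forall q \near p, same_at q].
have oS : open S by exact: open_interior.
have oC : open (~` S).
  rewrite openE => q Sq; rewrite /interior.
  have [i iq] := dom_cover q; have [r r0 hr] := chart_ball iq.
  apply: filterS (near_ball r0 iq) => q' [iq' br] Sq'; apply: Sq.
  have [U [oU Uq'] US] : exists2 U : set 'rV[R]_4, open U /\ U (chart i q') &
      forall x, U x -> ball_set (chart i q) r x /\ same_connection i g h x.
    pose P := [set x | ball_set (chart i q) r x /\ same_connection i g h x].
    exists P^°; last by move=> x; exact: interior_subset.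
    split; first exact: open_interior.
    have n1 : nbhs (chart i q') (ball_set (chart i q) r).
      by apply: open_nbhs_nbhs; split => //; exact: ball_set_open.
    have n2 : nbhs (chart i q') [set x | same_at (chart_inv i x)].
      apply: (chart_inv_continuous_at (chart_image_mem iq')).
      by rewrite chartK.
    apply: filterS (filterI n1 n2) => x [bx sx]; split => //.
    by have [dx ex] := chart_invK (hr x bx); have := sx i dx; rewrite ex.
  have all := same_ball hproj einstein_g r0 hr oU Uq' US.
  apply: filterS (near_ball r0 iq) => z [iz bz].
  by apply: (same_at_chart iz); exact: all.
have e := clopen_connected hconn oS oC (ex_intro _ p Sp).
move=> i x ix k a b; have [dx ex] := chart_invK ix.
have : [set: M] (chart_inv i x) by []; rewrite -e => /nbhs_singleton /(_ i dx).
by rewrite ex.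
Qed.

(** Where the Weyl tensor does not vanish there would be points with different
    connections, and around such a point both conditions hold on an open set. *)
Lemma weyl_zero i x d c a b : chart_image i x -> weyl_at g lambda i x d c a b = 0.
Proof.
move=> ix; apply/eqP; apply: contraT => wn.
have oi : open (chart_image i) by exact: chart_image_open.
pose V0 : region R 4 := @Region R 4 (chart_image i) oi (ex_intro _ x ix).
have VU z : V0 z -> chart_image i z by [].
have [K eK evK] := einstein_sfun VU einstein_g.
have [aa [lam [_ _ lamE]]] := sinjukov_exists VU hproj.
pose F : sfun V0 := weyl (@sderiv _ _ V0) (gS VU g) (GamS VU g) K d c a b.
have evF z (iz : chart_image i z) : sval_ F z = weyl_at g lambda i z d c a b.
  have e := @ev_weyl _ _ g lambda i V0 VU K z d c a b iz (evK z iz).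
  exact e.
have open_neq0 (f : sfun V0) : open [set z | chart_image i z /\ sval_ f z != 0].
  rewrite openE => z [iz fz]; rewrite /interior.
  have n1 : nbhs z (chart_image i) by apply: open_nbhs_nbhs.
  have cf : {for z, continuous (sval_ f)} by exact: (smooth_on_continuous (@sfun_smooth _ _ _ f) iz).
  have n2 : nbhs z (sval_ f @^-1` [set t | t != 0]).
    by apply: cf; apply: open_nbhs_nbhs; split => //; exact: open_neq.
  exact: filterS (filterI n1 n2) => y [].
(* The open set F <> 0 contains a point where the connections differ. *)
have [y [iy [Fy ny]]] : exists y, chart_image i y /\ (sval_ F y != 0 /\ ~ same_connection i g h y).
  apply/not_existsP => z; have [dx ex] := chart_invK ix.
  apply: (@open_same_empty (chart_inv i x)).
  have n : nbhs (chart_inv i x) (fun q => dom i q /\ [set z | chart_image i z /\ sval_ F z != 0] (chart i q)).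
    by apply: near_chart => //; rewrite ex; split => //=; rewrite evF.
  apply: filterS n => q [iq [cq Fq]]; apply: (same_at_chart iq).
  by apply: contrapT => ns; apply: (z (chart i q)).
have [k ky] : exists k, sval_ (lam k) y != 0.
  apply/not_existsP => z; apply: ny; apply/(lamE y iy) => k.
  by apply/eqP; apply: contra_notT (z k).
pose O := [set z | (chart_image i z /\ sval_ F z != 0) /\ (chart_image i z /\ sval_ (lam k) z != 0)].
have oO : open O by exact: openI (open_neq0 F) (open_neq0 (lam k)).
have Oy : O y by [].
pose V : region R 4 := @Region R 4 O oO (ex_intro _ y Oy).
have VO z : V z -> chart_image i z by case=> [[iz _] _].
have ns z : V z -> ~ same_connection i g h z.
  move=> [_ [iz lz]] sz; move/eqP: lz; apply; exact: ((lamE z iz).2 sz).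
have nW z : V z -> exists d c a b, weyl_at g lambda i z d c a b != 0.
  by move=> [[iz Fz] _]; exists d, c, a, b; rewrite -evF.
by have := no_open_weyl hproj hsign einstein_g VO ns nW.
Qed.

End Global.

Theorem corollary2 (R : realType) (M : manifold R 4) (g gbar : metric M)
  (hconn : connected [set: M])
  (hsign : riemannian g \/ lorentzian g)
  (heinstein : einstein g)
  (hproj : projectively_equivalent g gbar)
  (hnaff : ~ affinely_equivalent g gbar) :
  constant_sectional_curvature g.
Proof.
have [lambda hl] := heinstein.
have [[p0 _]|M0] := pselect (exists p : M, True); last first.
  by exists 0 => i x [p _ _]; case: M0; exists p.
exists (lambda p0 / 3) => i x ix u v.
apply: sectional_const; first exact: metric_sym.
move=> d c a b; apply/eqP; rewrite -subr_eq0; apply/eqP.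
rewrite (lambda_constant hconn hl p0 (chart_inv i x)).
exact: (weyl_zero hconn hproj hsign hnaff hl d c a b ix).
Qed.
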